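(* Let $\sigma,\tau>-1/2$. Suppose that one of the following two sets of hypotheses holds. (Concave case) $\Gamma$ is concave and strictly decreasing, with $$\max\Big\{f\Big(\frac{1-\sigma^-}{2-\sigma^-}L\Big),\ g\Big(\frac{1-\tau^-}{2-\tau^-}L\Big)\Big\}<2\Big(\frac12-\sigma^--\tau^-\Big)L ,$$ and for some $(\alpha,\beta)\in\Gamma$ with $\alpha,\beta>0$ one has $f\in C^2[0,\alpha]$, $g\in C^2[0,\beta]$, with $f'<0$ on $(0,\alpha]$, $f''<0$ on $[0,\alpha]$, $f''$ monotonic on $[0,\alpha]$, and $g'<0$ on $(0,\beta]$, $g''<0$ on $[0,\beta]$, $g''$ monotonic on $[0,\beta]$. (Convex case) $\Gamma$ is convex and strictly decreasing, with $$\min\Big\{(1-\sigma^-)f\Big(\frac{1-\sigma^-}{2-\sigma^-}L\Big),\ (1-\tau^-)g\Big(\frac{1-\tau^-}{2-\tau^-}L\Big)\Big\}>2(\sigma^-+\tau^-)L,$$ $$\mu_f(\sigma)=\min\Big\{(1+\sigma)f\Big(\frac{1+\sigma}{2+\sigma}x\Big)-f(x):\ \frac{1+\sigma}{2+\sigma}L\le x\le L\Big\}>0,$$ $$\mu_g(\tau)=\min\Big\{(1+\tau)g\Big(\frac{1+\tau}{2+\tau}y\Big)-g(y):\ \frac{1+\tau}{2+\tau}L\le y\le L\Big\}>0 ,$$ and for some $(\alpha,\beta)\in\Gamma$ with $\alpha,\beta>0$ one has $f\in C^2[\alpha,L]$, $g\in C^2[\beta,L]$, with $f'<0$ on $[\alpha,L)$,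 $f''>0$ on $[\alpha,L]$, $f''$ monotonic on $[\alpha,L]$, and $g'<0$ on $[\beta,L)$, $g''>0$ on $[\beta,L]$, $g''$ monotonic on $[\beta,L]$. Then the stretch factors maximizing $N(r,s)$ approach $$s^*=\sqrt{\frac{\tau+1/2}{\sigma+1/2}}$$ as $r\to\infty$, with $$S(r)\subset\big[s^*-O(r^{-1/6}),\ s^*+O(r^{-1/6})\big],$$ and the maximal lattice count has the asymptotic formula $$\max_{s>0}N(r,s)=r^2\operatorname{Area}(\Gamma)-2rL\sqrt{(\sigma+1/2)(\tau+1/2)}+O(r^{2/3}).$$ In particular, when $\sigma=\tau$, the optimal stretch factors for maximizing $N(r,s)$ approach $s^*=1$ as $r\to\infty$.
   Context: Let $L>0$ and let $\Gamma$ be a strictly decreasing curve in the first quadrant with $x$- and $y$-intercepts both equal to $L$: $\Gamma$ is the graph of $y=f(x)$, where $f:[0,L]\to[0,L]$ is a strictly decreasing bijection (so $f(0)=L$, $f(L)=0$), and $g:[0,L]\to[0,L]$ is the inverse function of $f$. $\Gamma$ is called concave (respectively convex) if $f$ is concave (respectively convex). $\operatorname{Area}(\Gamma)=\int_0^Lf(x)\,dx$ is the area under $\Gamma$ in the first quadrant. For $r,s>0$, $r\Gamma(s)$ denotes the graph of $x\mapsto rsf(sx/r)$, $0\le x\le rL/s$. Write $\mathbb N=\{1,2,3,\dots\}$. For shift parameters $\sigma,\tau>-1$, the counting function $$N(r,s)=\#\{(j,k)\in\mathbb N\times\mathbb N:\ (j+\sigma)s/r\le L,\ k+\tau\le rsf((j+\sigma)s/r)\}$$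 is the number of points of the shifted lattice $(\mathbb N+\sigma)\times(\mathbb N+\tau)$ lying inside or on $r\Gamma(s)$. The set $S(r)=\operatorname{arg\,max}_{s>0}N(r,s)$ is the set of all $s>0$ at which $s\mapsto N(r,s)$ attains its maximum. The negative part is $x^-=0$ if $x\ge0$ and $x^-=|x|$ if $x<0$. The $O(\cdot)$ statements are as $r\to\infty$, with constants that may depend on $\Gamma,\sigma,\tau$; the inclusion $S(r)\subset[s^*-O(r^{-e}),s^*+O(r^{-e})]$ means that there are constants $C,R>0$ with $|s-s^*|\le Cr^{-e}$ for all $s\in S(r)$ and all $r\ge R$. *)

(* Defs.v *)
From HB Require Import structures.
From mathcomp Require Import all_boot all_order all_algebra.
From mathcomp Require Import finmap.
From mathcomp Require Import all_classical all_reals all_analysis.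

Set Implicit Arguments.
Unset Strict Implicit.
Unset Printing Implicit Defensive.

Import Order.TTheory GRing.Theory Num.Theory.
Import numFieldNormedType.Exports.
Local Open Scope classical_set_scope.
Local Open Scope ring_scope.

Definition is_max d (T : porderType d) (A : set T) (m : T) := A m /\ ubound A m.

Definition is_min d (T : porderType d) (A : set T) (m : T) := A m /\ lbound A m.

Section Calculus.
Variable R : realType.
Implicit Types (D : set R) (f : R -> R).

Definition neg_part (x : R) : R := if 0 <= x then 0 else `|x|.

(* Difference quotients are taken along points of D only, hence one-sidedly at
   an endpoint of an interval D. *)
Definition has_derivative_within D f (x l : R) :=
  (fun y => (f y - f x) / (y - x)) @ within D x^' --> l.

(* f is C^2 on D, with first and second derivatives f1 and f2 there.  On a
   nondegenerate interval D the values of f1 and f2 are determined by f. *)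
Definition C2_within D f (f1 f2 : R -> R) :=
  [/\ forall x, D x -> has_derivative_within D f x (f1 x),
      forall x, D x -> has_derivative_within D f1 x (f2 x)
    & {within D, continuous f2}].

Definition monotonic_on D f :=
  {in D &, {homo f : x y / x <= y}} \/ {in D &, {homo f : x y /~ x <= y}}.

Definition concave_function D f := convex_function D (fun x => - f x).

End Calculus.

Section Curve.
Variable R : realType.
Implicit Types (L r s sigma tau : R) (f g : R -> R).

(* Only the values of f and g on [0, L] are ever constrained or used. *)
Record decreasing_curve L f g : Prop := {
  curve_f_bij : set_bij `[0, L] `[0, L] f ;
  curve_f_decr : {in `[0, L] &, forall x y, x < y -> f y < f x} ;
  curve_g_maps : set_fun `[0, L] `[0, L] g ;
  curve_fK : {in `[0, L], cancel f g} ;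
  curve_gK : {in `[0, L], cancel g f}
}.

Definition area L f : R := \int[lebesgue_measure]_(x in `[0, L]) f x.

Definition lattice_points L f sigma tau r s : set (nat * nat) :=
  [set p | [/\ (0 < p.1)%N, (0 < p.2)%N,
               (p.1%:R + sigma) * s / r <= L
             & p.2%:R + tau <= r * s * f ((p.1%:R + sigma) * s / r)]].

(* For a decreasing curve, shifts > -1 and r, s > 0 the set is finite, so that
   fset_set does not take its default value. *)
Definition lattice_count L f sigma tau r s : nat :=
  #|` fset_set (lattice_points L f sigma tau r s)|%fset.

Definition lattice_counts L f sigma tau r : set nat :=
  [set lattice_count L f sigma tau r s | s in `]0, +oo[].

Definition optimal_stretch L f sigma tau r : set R :=
  [set s | 0 < s /\
    is_max (lattice_counts L f sigma tau r) (lattice_count L f sigma tau r s)].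

Definition shift_ratio sigma : R := (1 - neg_part sigma) / (2 - neg_part sigma).

(* I is the closed interval carrying the C^2 condition; f' < 0 is required on
   the smaller set I' only, since f' may vanish at the endpoint left out. *)
Definition concave_smooth (I I' : set R) f := exists f1 f2 : R -> R,
  [/\ C2_within I f f1 f2,
      forall x, I' x -> f1 x < 0,
      forall x, I x -> f2 x < 0
    & monotonic_on I f2].

Definition convex_smooth (I I' : set R) f := exists f1 f2 : R -> R,
  [/\ C2_within I f f1 f2,
      forall x, I' x -> f1 x < 0,
      forall x, I x -> 0 < f2 x
    & monotonic_on I f2].

(* The function minimized here is continuous on a compact interval (a decreasing
   bijection of [0, L] is continuous), so the minimum exists. *)
Definition mu_values L sigma f : set R :=
  [set (1 + sigma) * f ((1 + sigma) / (2 + sigma) * x) - f x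
    | x in `[(1 + sigma) / (2 + sigma) * L, L]].

Definition concave_case L sigma tau f g : Prop :=
  [/\ concave_function `[0, L] f,
      Num.max (f (shift_ratio sigma * L)) (g (shift_ratio tau * L))
        < 2 * (1 / 2 - neg_part sigma - neg_part tau) * L
    & exists alpha beta : R,
        [/\ 0 < alpha <= L, 0 < beta, beta = f alpha,
            concave_smooth `[0, alpha] `]0, alpha] f
          & concave_smooth `[0, beta] `]0, beta] g]].

Definition convex_case L sigma tau f g : Prop :=
  [/\ convex_function `[0, L] f,
      2 * (neg_part sigma + neg_part tau) * L
        < Num.min ((1 - neg_part sigma) * f (shift_ratio sigma * L))
                  ((1 - neg_part tau) * g (shift_ratio tau * L)),
      exists2 mu_f, is_min (mu_values L sigma f) mu_f & 0 < mu_f,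
      exists2 mu_g, is_min (mu_values L tau g) mu_g & 0 < mu_g
    & exists alpha beta : R,
        [/\ 0 < alpha <= L, 0 < beta, beta = f alpha,
            convex_smooth `[alpha, L] `[alpha, L[ f
          & convex_smooth `[beta, L] `[beta, L[ g]].

Definition optimal_stretch_approaches L f sigma tau (s0 : R) :=
  forall e : R, 0 < e ->
    \forall r \near +oo,
      optimal_stretch L f sigma tau r `<=` `[s0 - e, s0 + e].

End Curve.

(* Main.v *)
Require Import Defs.
From mathcomp Require Import all_boot all_order all_algebra.
From mathcomp Require Import finmap.
From mathcomp Require Import all_classical all_reals all_analysis.
From mathcomp Require Import ring lra zify.

Set Implicit Arguments.
Unset Strict Implicit.
Unset Printing Implicit Defensive.

Import Order.TTheory GRing.Theory Num.Theory.
Import numFieldNormedType.Exports.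
Local Open Scope classical_set_scope.
Local Open Scope ring_scope.

(** Write [p = sigma + 1/2] and [q = tau + 1/2]. For a stretch factor s in a
    fixed compact interval the number of shifted lattice points under the
    dilated curve is
    [N(r,s) = r^2 Area - r L (s p + q / s) + O(r^(2/3))]:
    the two terms of order r are the areas of the strips along the axes that
    the unit squares around the lattice points leave uncovered. By the
    inequality between the arithmetic and geometric means, [s p + q / s] is
    least, with value [2 sqrt(p q)], at [s^* = sqrt(q / p)], and it exceeds
    this minimum by [p (s - s^* )^2 / s] ([stretch_excess]). Comparing a
    maximizer s with s^* therefore gives [r (s - s^* )^2 = O(r^(2/3))], that is
    [s - s^* = O(r^(-1/6))], and the maximum agrees with the count at s^* up to
    [O(r^(2/3))] ([optimal_stretch_asymptotics]). Two things remain: the error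
    term, and confining the maximizers to a compact interval.

    The error term. Cut the region under the curve at a point (alpha, beta) of
    the curve. In the concave case it is the union of the columns left of alpha
    and the rows below beta, which overlap in a rectangle; in the convex case
    it is the disjoint union of that rectangle, the columns right of alpha and
    the rows above beta. Either way only smooth arcs with curvature of
    constant sign matter ([curved_piece]). In a family of columns the count is
    a sum of integer parts; replacing integer parts by mean values leaves a
    Riemann sum, which the trapezoid rule evaluates ([strip_sum]), and a sum of
    the sawtooth function. The heights of successive columns have second
    differences of constant sign and of size [1/r], so van der Corput's second
    derivative test bounds their exponential sums. To pass from these to the
    sawtooth, its Fourier series is replaced by a de la Vallee-Poussin mean of
    order K, whose error is dominated by [K^-2] times a sum of two Fejer
    kernels; for K near [r^(1/3)] all contributions are
    [O(r^(2/3))] ([sum_sawtooth_second_difference]). The areas of the pieces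
    recombine by Young's identity ([young]), and the terms of order r that
    depend on the fractional parts of the cutting point cancel
    ([residue_inner], [residue_outer]).

    The confinement. Suppose [s >= 1]; otherwise exchange the axes. Now the
    columns are few and the points are compared with areas column by column:
    under a concave curve the inscribed trapezoids fit, under a convex curve
    the Hermite--Hadamard inequality places the rectangle of each column under
    the curve. The area left over near the vertical axis is proportional to
    [r s], and it exceeds what negative shifts may add precisely by the
    assumed inequality on [f] at the point [shift_ratio sigma * L]. Hence
    [N(r,s)] is at most [r^2 Area - C r s + 1/2], unless there is at most one
    column, when a fixed proportion of the area is lost
    ([large_stretch_bound]). As the count at s^* is within O(r) of
    [r^2 Area], both a large and a small s are excluded for a maximizer. *)

(** * Exponential sums: the second derivative test *)

Section Trig.
Variable R : realType.
Implicit Types x y d : R.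

Lemma sin_subE x y : sin x - sin y = 2 * cos ((x + y) / 2) * sin ((x - y) / 2).
Proof.
have -> : sin x = sin ((x + y) / 2 + (x - y) / 2) by congr sin; field.
have -> : sin y = sin ((x + y) / 2 - (x - y) / 2) by congr sin; field.
rewrite sinD sinB; ring.
Qed.

Lemma cos_addE x y : cos x + cos y = 2 * cos ((x + y) / 2) * cos ((x - y) / 2).
Proof.
have -> : cos x = cos ((x + y) / 2 + (x - y) / 2) by congr cos; field.
have -> : cos y = cos ((x + y) / 2 - (x - y) / 2) by congr cos; field.
rewrite cosD cosB; ring.
Qed.

Definition cot x : R := cos x / sin x.

(** The real counterpart of writing the terms of an exponential sum as quotients
    of increments: sums of cosines become weighted sums of increments of sines,
    which can be summed by parts. *)
Lemma cos_add_cot x y : sin ((y - x) / 2) != 0 ->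
  cos x + cos y = cot ((y - x) / 2) * (sin y - sin x).
Proof.
move=> s0; rewrite addrC cos_addE sin_subE /cot; field.
by rewrite s0.
Qed.

Lemma cot_le x y : 0 < x -> x <= y -> y < pi -> cot y <= cot x.
Proof.
move=> x0 xy ypi.
have sx : 0 < sin x by apply: sin_gt0_pi; rewrite x0 (le_lt_trans xy).
have sy : 0 < sin y by apply: sin_gt0_pi; rewrite ypi (lt_le_trans x0).
rewrite -subr_ge0.
have -> : cot x - cot y = sin (y - x) / (sin x * sin y).
  rewrite sinB /cot; field; by rewrite !gt_eqF.
apply: divr_ge0; last by rewrite mulr_ge0 // ltW.
apply: sin_ge0_pi; lra.
Qed.

Lemma sin_ge_mul_cos x : 0 <= x -> x <= pi -> x * cos x <= sin x.
Proof.
move=> x0 xpi.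
pose h (t : R) := sin t - t * cos t.
have dh (t : R) : is_derive t 1 h (t * sin t).
  rewrite /h; apply: is_derive_eq.
  rewrite /GRing.scale /=; ring.
have [c cx] : exists2 c, c \in `[0, x]%R & h x - h 0 = c * sin c * (x - 0).
  apply: MVT_segment => //.
  by apply: derivable_within_continuous => t _; case: (dh t).
rewrite {2}/h sin0 mul0r !subr0 => E.
rewrite -subr_ge0 -/(h x) E mulr_ge0 //.
move: cx; rewrite in_itv /= => /andP[c0 cx].
by rewrite mulr_ge0 // sin_ge0_pi // c0 (le_trans cx).
Qed.

(** Jordan's inequality with a non-optimal constant. *)
Lemma sin_ge_quarter x : 0 <= x -> x <= pi / 2 -> x / 4 <= sin x.
Proof.
move=> x0 xpi.
have p2 := @pihalf_lt2 R.
have xle : x <= pi by have := pi_ge0 R; lra.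
have s0 : 0 <= sin x by apply: sin_ge0_pi; rewrite x0.
have [c2|c2] := lerP (1 / 2) (cos x).
  by have := sin_ge_mul_cos x0 xle; nra.
have c0 : 0 <= cos x by apply: cos_ge0_pihalf; have := pi_ge0 R; lra.
by have := cos2Dsin2 x; nra.
Qed.

End Trig.

Section KusminLandau.
Variable R : realType.

Lemma cosD2piz (x : R) (z : int) : cos (x + 2 * pi * z%:~R) = cos x.
Proof.
have E : 2 * pi = pi *+ 2 :> R by rewrite mulr2n; ring.
case: z => n; rewrite E.
  by rewrite -pmulrn mulr_natr (periodicn (@cosD2pi R)).
have := periodicn (@cosD2pi R) n.+1 (x + (pi *+ 2) * (Negz n)%:~R) => <-.
congr cos; rewrite NegzE mulrNz mulrN -pmulrn -[X in _ + X = _]mulr_natr; ring.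
Qed.

(** Summation by parts; the weights decrease, so that their variation
    telescopes. *)
Lemma abel_bound (c s : nat -> R) (n : nat) :
  (forall i, (i < n)%N -> c i.+1 <= c i) -> (forall i, `|s i| <= 1) ->
  `|\sum_(i < n.+1) c i * (s i.+1 - s i) - c n * s n.+1| <= `|c 0%N| + (c 0%N - c n).
Proof.
move=> + s1; elim: n => [_|n IH cm].
  rewrite big_ord1 subrr addr0 mulrBr addrAC subrr add0r normrN normrM.
  by rewrite ler_piMr.
rewrite big_ord_recr /=.
have := IH (fun i h => cm i (ltnW h)).
set S := \sum_(i < _) _ => H.
have -> : S + c n.+1 * (s n.+2 - s n.+1) - c n.+1 * s n.+2 =
  (S - c n * s n.+1) + (c n - c n.+1) * s n.+1 by ring.
apply: (le_trans (ler_normD _ _)).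
have h1 : `|(c n - c n.+1) * s n.+1| <= c n - c n.+1.
  have cc : 0 <= c n - c n.+1 by rewrite subr_ge0 cm.
  by rewrite normrM (ger0_norm cc) ler_piMr.
lra.
Qed.

Lemma cot_norm_le (x d : R) : 0 < d -> pi * d <= x -> x <= pi * (1 - d) ->
  `|cot x| <= 2 / d.
Proof.
move=> d0 dx xd.
have pi2 := @pi_ge2 R.
have sx : d / 2 <= sin x.
  have [xh|xh] := lerP x (pi / 2).
    by have := @sin_ge_quarter R x; nra.
  have -> : sin x = sin (pi - x).
    by rewrite sinB sinpi cospi; ring.
  have := @sin_ge_quarter R (pi - x); nra.
have sx0 : 0 < sin x by lra.
rewrite /cot normrM normfV (gtr0_norm sx0) ler_pdivrMr //.
apply: (le_trans (cos_max x)).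
have : 2 / d * (d / 2) <= 2 / d * sin x by rewrite ler_wpM2l // divr_ge0 // ltW.
by have -> : 2 / d * (d / 2) = 1 by field; rewrite gt_eqF.
Qed.

(** The Kusmin--Landau inequality in real form. By [cos_add_cot], twice the sum
    is, up to its end terms, a weighted sum of increments of sines; the weights
    are the cotangents of the half increments, which decrease and are at most
    [2 / d]. *)
Lemma kusmin_landau (y : nat -> R) (N : nat) (d : R) : 0 < d -> d <= 1 / 2 ->
  (forall i, (i.+1 < N)%N -> 2 * pi * d <= y i.+1 - y i <= 2 * pi * (1 - d)) ->
  (forall i, (i.+2 < N)%N -> y i.+1 - y i <= y i.+2 - y i.+1) ->
  `|\sum_(i < N) cos (y i)| <= 5 / d.
Proof.
move=> d0 d1 yd ym.
have d5 : 1 <= 1 / d by rewrite ler_pdivlMr //; lra.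
case: N => [|[|N]] in yd ym *.
- by rewrite big_ord0 normr0 divr_ge0 // ltW.
- rewrite big_ord1; apply: (le_trans (cos_max _)).
  by apply: (le_trans d5); rewrite ler_pM2r ?invr_gt0 // ler1n.
pose c i := cot ((y i.+1 - y i) / 2).
have pi0 := pi_gt0 R.
have cb i : (i < N.+1)%N -> `|c i| <= 2 / d.
  by move=> iN; have := yd i iN => /andP[h1 h2]; apply: cot_norm_le; lra.
have key : 2 * \sum_(i < N.+2) cos (y i) =
   cos (y 0%N) + cos (y N.+1) + \sum_(i < N.+1) c i * (sin (y i.+1) - sin (y i)).
  have -> : \sum_(i < N.+1) c i * (sin (y i.+1) - sin (y i)) =
      \sum_(i < N.+1) (cos (y i) + cos (y i.+1)).
    apply: eq_bigr => i _; rewrite cos_add_cot // gt_eqF // sin_gt0_pi //.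
    have := yd i (ltn_ord i); nra.
  rewrite big_split /= mulr2n mulrDl mul1r.
  by rewrite {1}big_ord_recr /= [in X in _ + X = _]big_ord_recl /=; ring.
have cm i : (i < N)%N -> c i.+1 <= c i.
  move=> iN; have /andP[h1 h2] := yd i (ltnW iN).
  have /andP[h3 h4] := yd i.+1 iN; have h5 := ym i iN.
  have pd : 0 < pi * d by rewrite mulr_gt0.
  by apply: cot_le; lra.
have := @abel_bound c (fun i => sin (y i)) N cm (fun i => sin_max _).
have := cb 0%N isT; have := cb N (ltnSn _).
have := cos_max (y 0%N); have := cos_max (y N.+1); have := sin_max (y N.+1).
move: key; set S := \sum_(i < N.+2) _; set T := \sum_(i < N.+1) _ => key.
set D := 2 / d => hs hN h0 cN c0 ab.
have h1 : `|c N * sin (y N.+1)| <= D.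
  by rewrite normrM -[D]mulr1 ler_pM.
have TD : `|T| <= 4 * D.
  have -> : T = (T - c N * sin (y N.+1)) + c N * sin (y N.+1) by ring.
  apply: (le_trans (ler_normD _ _)).
  have [c0' cN'] := (ler_normlW c0, lerNnormlW cN).
  by move: ab h1 => /=; lra.
have -> : 5 / d = 5 / 2 * D by rewrite /D; field; rewrite gt_eqF.
have D2 : 2 <= D by rewrite /D; lra.
move: TD hN h0; rewrite !ler_norml; lra.
Qed.

(** Serves to cut the range of summation where the increments cross a level. *)
Lemma monotone_threshold (D : nat -> R) (t : R) (u v : nat) : (u <= v)%N ->
  (forall i j, (u <= i)%N -> (i <= j)%N -> (j < v)%N -> D i <= D j) ->
  exists w, [/\ (u <= w)%N, (w <= v)%N,
    forall i, (u <= i)%N -> (i < w)%N -> D i < t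
  & forall i, (w <= i)%N -> (i < v)%N -> t <= D i].
Proof.
move=> uv Dm.
have P : exists n, (u <= n)%N && ((n == v) || (t <= D n)) by exists v; rewrite uv eqxx.
exists (ex_minn P); case: ex_minnP => w /andP[uw wv] wmin.
have wv' : (w <= v)%N by apply: wmin; rewrite uv eqxx.
split => // i.
  move=> ui iw; rewrite ltNge; apply/negP => tD.
  by have := wmin i; rewrite ui tD orbT leqNgt iw => /(_ isT).
move=> wi iv; case/orP: wv => [/eqP wE|tD]; first by move: iv; rewrite -wE ltnNge wi.
exact: le_trans tD (Dm _ _ uw wi iv).
Qed.

Section SecondDerivative.
Variables (x : nat -> R) (theta mu : R) (M : nat).
Let D i := x i.+1 - x i.
Let S u v := \sum_(u <= i < v) cos (2 * pi * x i + theta).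
Hypothesis mu_gt0 : 0 < mu.
Hypothesis D_incr : forall i j, (i <= j)%N -> (j < M)%N ->
  (j - i)%:R * mu <= D j - D i.

Let S_trivial u v : (u <= v)%N -> `|S u v| <= (v - u)%:R.
Proof.
move=> uv; apply: (le_trans (ler_norm_sum _ _ _)).
rewrite -sumr_const_nat; apply: ler_sum => i _; exact: cos_max.
Qed.

Let S_cat u w v : (u <= w)%N -> (w <= v)%N -> S u v = S u w + S w v.
Proof. by move=> uw wv; rewrite /S (big_cat_nat uw wv). Qed.

(** The increments grow by at least [mu] at each step, so only [d / mu + 1] of
    them fit into an interval of length [d]. *)
Let short_block (t d : R) u v : (u <= v)%N -> (v <= M)%N -> 0 <= d ->
  (forall i, (u <= i)%N -> (i < v)%N -> t <= D i < t + d) ->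
  `|S u v| <= d / mu + 1.
Proof.
move=> uv vM d0 Dt; apply: (le_trans (S_trivial uv)).
case: (ltnP u v) => [uv'|vu]; last first.
  have -> : (v - u)%N = 0%N by apply/eqP; rewrite subn_eq0.
  by rewrite addr_ge0 // divr_ge0 // ltW.
have vm : (v.-1 < v)%N by case: (v) uv'.
have uv1 : (u <= v.-1)%N by case: (v) uv'.
have /andP[h1 h2] := Dt u (leqnn _) uv'.
have /andP[h3 h4] := Dt v.-1 uv1 vm.
have := D_incr uv1 (leq_trans vm vM).
have -> : (v - u)%N = (v.-1 - u).+1 by rewrite -subSn // prednK // (leq_ltn_trans _ uv').
move=> H; rewrite -natr1 lerD2r ler_pdivlMr //; lra.
Qed.

Let D_mono u v : (v <= M)%N ->
  forall i j, (u <= i)%N -> (i <= j)%N -> (j < v)%N -> D i <= D j.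
Proof.
move=> vM i j _ ij jv; rewrite -subr_ge0.
apply: le_trans (D_incr ij (leq_trans jv vM)).
by rewrite mulr_ge0 // ltW.
Qed.

(** Increments within [d] of an integer are few. For the others the integer [m]
    can be subtracted from the increments by periodicity, and the
    Kusmin--Landau inequality applies. *)
Let unit_block (m : int) (d : R) u v : (u <= v)%N -> (v <= M)%N ->
  0 < d -> d <= 1 / 2 ->
  (forall i, (u <= i)%N -> (i < v)%N -> m%:~R <= D i < m%:~R + 1) ->
  `|S u v| <= 2 * (d / mu + 1) + 5 / d.
Proof.
move=> uv vM d0 d1 Dm.
have [w1 [uw1 w1v lt1 ge1]] := @monotone_threshold D (m%:~R + d) u v uv (@D_mono u v vM).
have [w2 [w12 w2v lt2 ge2]] :=
  @monotone_threshold D (m%:~R + 1 - d) w1 v w1v (@D_mono w1 v vM).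
have uw2 := leq_trans uw1 w12.
rewrite (S_cat uw1 w1v) (S_cat w12 w2v).
have h1 : `|S u w1| <= d / mu + 1.
  apply: (@short_block m%:~R) => //; [exact: leq_trans vM|exact: ltW|].
  move=> i ui iw; rewrite lt1 // andbT.
  by have /andP[] := Dm i ui (leq_trans iw w1v).
have h3 : `|S w2 v| <= d / mu + 1.
  apply: (@short_block (m%:~R + 1 - d)) => //; first exact: ltW.
  move=> i wi iv; rewrite ge2 //=.
  by have := Dm i (leq_trans uw2 wi) iv; lra.
have h2 : `|S w1 w2| <= 5 / d.
  pose y i := 2 * pi * (x (i + w1)%N - (i + w1)%N%:R * m%:~R) + theta.
  have -> : S w1 w2 = \sum_(i < w2 - w1) cos (y i).
    rewrite /S -{1}[w1]add0n big_addn big_mkord; apply: eq_bigr => i _.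
    rewrite -[RHS](cosD2piz _ (m * (i + w1)%N%:Z)); congr cos.
    by rewrite /y intrM; ring.
  have pi0 := pi_gt0 R.
  have yE i : y i.+1 - y i = 2 * pi * (D (i + w1)%N - m%:~R).
    by rewrite /y /D addSn -[in X in X * m%:~R]natr1; ring.
  apply: kusmin_landau => // i iw; rewrite !yE.
    have iw2 : (i + w1 < w2)%N by lia.
    have a := ge1 (i + w1)%N (leq_addl _ _) (leq_trans iw2 w2v).
    have b := lt2 (i + w1)%N (leq_addl _ _) iw2.
    by apply/andP; split; rewrite ler_pM2l ?mulr_gt0 //; lra.
  rewrite ler_pM2l ?mulr_gt0 // lerD2r.
  by apply: (@D_mono w1 w2); lia.
apply: (le_trans (ler_normD _ _)); have := ler_normD (S w1 w2) (S w2 v); lra.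
Qed.

Let blocks (d : R) (K : nat) : 0 < d -> d <= 1 / 2 ->
  forall (m : int) u v, (u <= v)%N -> (v <= M)%N ->
  (forall i, (u <= i)%N -> (i < v)%N -> m%:~R <= D i < m%:~R + K%:R) ->
  `|S u v| <= K%:R * (2 * (d / mu + 1) + 5 / d).
Proof.
move=> d0 d1; elim: K => [|K IH] m u v uv vM Dm.
  rewrite mul0r addr0 in Dm *; apply: (le_trans (S_trivial uv)).
  case: (ltnP u v) => [uv'|vu]; last first.
    by have -> : (v - u)%N = 0%N by apply/eqP; rewrite subn_eq0.
  by have := Dm u (leqnn _) uv'; rewrite le_lt_asym.
have [w [uw wv ltw gew]] := @monotone_threshold D (m%:~R + 1) u v uv (@D_mono u v vM).
rewrite (S_cat uw wv); apply: (le_trans (ler_normD _ _)).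
rewrite -natr1 mulrDl mul1r addrC; apply: lerD; last first.
  apply: (@unit_block m) => //; first exact: leq_trans vM.
  move=> i ui iw; rewrite ltw // andbT.
  by have /andP[] := Dm i ui (leq_trans iw wv).
apply: (IH (m + 1)) => // i wi iv; rewrite intrD gew //=.
by have /andP[_] := Dm i (leq_trans uw wi) iv; rewrite -natr1; lra.
Qed.

(** The margin [d = sqrt mu] balances the trivial bound [d / mu] near the
    integers against the Kusmin--Landau bound [5 / d] away from them. *)
Lemma second_derivative_test_incr (Y : R) : mu <= 1 / 4 -> 0 <= Y ->
  (forall i, (i < M)%N -> D i <= D 0%N + Y) ->
  `|\sum_(i < M) cos (2 * pi * x i + theta)| <= (Y + 2) * (8 / Num.sqrt mu).
Proof.
move=> mu4 Y0 DY.
pose d := Num.sqrt mu.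
have d0 : 0 < d by rewrite sqrtr_gt0.
have dd : d * d = mu by rewrite -expr2 sqr_sqrtr // ltW.
have d1 : d <= 1 / 2 by nra.
(* the increments start in the unit interval at [floor (D 0)] and move by at
   most [Y] *)
pose K := (Num.truncn Y).+2.
have KY : K%:R <= Y + 2.
  by rewrite /K -addn2 natrD lerD2r; have := truncn_itv Y0 => /andP[].
have YK : Y + 1 < K%:R.
  by rewrite /K -natr1 ltrD2r; have := truncn_itv Y0 => /andP[].
have : `|S 0 M| <= K%:R * (2 * (d / mu + 1) + 5 / d).
  apply: (@blocks d K d0 d1 (Num.floor (D 0%N))) => // i _ iM.
  have /andP[h1 h2] := floor_itv (D 0%N).
  rewrite intrD in h2.
  have := DY i iM; have := @D_mono 0 M (leqnn M) 0%N i isT isT iM.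
  by move=> h3 h4; apply/andP; split; lra.
rewrite /S big_mkord => /le_trans; apply.
have e : d / mu = 1 / d by rewrite -dd; field; rewrite gt_eqF.
have i2 : 2 <= 1 / d by rewrite ler_pdivlMr //; lra.
rewrite e -/d.
have -> : 5 / d = 5 * (1 / d) by ring.
have -> : 8 / d = 8 * (1 / d) by ring.
by apply: ler_pM => //; lra.
Qed.

End SecondDerivative.
End KusminLandau.

Section VanDerCorputTest.
Variable R : realType.

(** Van der Corput's second derivative test for sequences. Changing the sign of
    the phase leaves the cosine sum as it is and reduces to positive second
    differences. *)
Lemma second_derivative_test (x : nat -> R) (theta mu h eps : R) (N : nat) :
  0 < mu -> mu <= 1 / 4 -> 0 <= h -> eps = 1 \/ eps = -1 ->
  (forall i, (i.+2 < N)%N ->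
     mu <= eps * (x i.+2 - 2 * x i.+1 + x i) <= h * mu) ->
  `|\sum_(i < N) cos (2 * pi * x i + theta)| <=
    (N%:R * (h * mu) + 2) * (9 / Num.sqrt mu).
Proof.
move=> mu0 mu4 h0 eps1 xd.
wlog eE : x theta eps eps1 xd / eps = 1.
  move=> W; case: (eps1) => [e1|e1]; first by apply: (W x theta eps).
  have -> : \sum_(i < N) cos (2 * pi * x i + theta) =
      \sum_(i < N) cos (2 * pi * (- x i) + - theta).
    by apply: eq_bigr => i _; rewrite -cosN; congr cos; ring.
  apply: (W (fun i => - x i) (- theta) 1) => //; first by left.
  by move=> i iN; have := xd i iN; rewrite e1; lra.
rewrite eE in xd.
have s0 : 0 < Num.sqrt mu by rewrite sqrtr_gt0.
have s2 : 1 <= 9 / Num.sqrt mu - 8 / Num.sqrt mu.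
  rewrite -mulrBl ler_pdivlMr //.
  have : Num.sqrt mu * Num.sqrt mu = mu by rewrite -expr2 sqr_sqrtr // ltW.
  nra.
(* the last of the [N] terms starts no increment whose growth is controlled; it
   is bounded by 1, whence 9 instead of 8 *)
case: N xd => [|N] xd.
  by rewrite big_ord0 normr0 mul0r add0r mulr_ge0 // divr_ge0 // ltW.
have step i : (i.+1 < N)%N ->
    mu <= (x i.+2 - x i.+1) - (x i.+1 - x i) <= h * mu.
  by move=> iN; have := xd i iN; lra.
have incr i j : (i <= j)%N -> (j < N)%N ->
    (j - i)%:R * mu <= (x j.+1 - x j) - (x i.+1 - x i) <= (j - i)%:R * (h * mu).
  elim: j => [|j IH] ij jN.
    by move: ij; rewrite leqn0 => /eqP ->; rewrite subnn !mul0r subrr lexx.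
  move: ij; rewrite leq_eqVlt => /orP[/eqP ->|ij].
    by rewrite subnn !mul0r subrr lexx.
  have := IH ij (ltnW jN); have := step j jN.
  by rewrite subSn // -natr1; lra.
have hmu : 0 <= h * mu by rewrite mulr_ge0 // ltW.
have H : `|\sum_(i < N) cos (2 * pi * x i + theta)| <=
    (N%:R * (h * mu) + 2) * (8 / Num.sqrt mu).
  apply: second_derivative_test_incr => //.
  - by move=> i j ij jN; have /andP[] := incr i j ij jN.
  - by rewrite mulr_ge0.
  - move=> i iN; have /andP[_] := incr 0%N i isT iN.
    have : (i - 0)%:R * (h * mu) <= N%:R * (h * mu).
      by apply: ler_wpM2r => //; rewrite ler_nat subn0 ltnW.
    lra.
rewrite big_ord_recr /=.
apply: (le_trans (ler_normD _ _)).
have := cos_max (2 * pi * x N + theta).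
set Y := N%:R * (h * mu) in H *.
have Y0 : 0 <= Y by rewrite mulr_ge0.
have : (Y + 2) * (9 / Num.sqrt mu) <= (N.+1%:R * (h * mu) + 2) * (9 / Num.sqrt mu).
  apply: ler_wpM2r; first by rewrite divr_ge0 // ltW.
  by rewrite lerD2r ler_wpM2r // ler_nat.
have : (Y + 2) * (8 / Num.sqrt mu) + 1 <= (Y + 2) * (9 / Num.sqrt mu) by nra.
lra.
Qed.

End VanDerCorputTest.

(** * The Fejer kernel and the sawtooth function *)

Section FejerKernel.
Variable R : realType.
Implicit Types x y : R.

Lemma is_derive_ge0_le (f df : R -> R) (a b : R) : a <= b ->
  (forall t, a <= t <= b -> is_derive t 1 f (df t)) ->
  (forall t, a <= t <= b -> 0 <= df t) -> f a <= f b.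
Proof.
move=> ab fd df0.
have [c cab E] : exists2 c, c \in `[a, b]%R & f b - f a = df c * (b - a).
  apply: MVT_segment => //.
    by move=> t; rewrite in_itv /= => /andP[t1 t2]; apply: fd; rewrite !ltW.
  apply: derivable_within_continuous => t; rewrite in_itv /= => tab.
  by case: (fd t tab).
by rewrite -subr_ge0 E mulr_ge0 ?subr_ge0 // df0 // -in_itv.
Qed.

Lemma is_derive_norm_le (f df g dg : R -> R) (a b : R) : a <= b ->
  (forall t, a <= t <= b -> is_derive t 1 f (df t)) ->
  (forall t, a <= t <= b -> is_derive t 1 g (dg t)) ->
  (forall t, a <= t <= b -> `|df t| <= - dg t) -> `|f a - f b| <= g a - g b.
Proof.
move=> ab fd gd fg.
have h1 : (- f - g) a <= (- f - g) b.
  apply: (@is_derive_ge0_le _ (fun t => - df t - dg t)) => // t tab.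
    by have d1 := fd t tab; have d2 := gd t tab; apply: is_deriveB.
  by have := fg t tab; rewrite ler_norml; lra.
have h2 : (f - g) a <= (f - g) b.
  apply: (@is_derive_ge0_le _ (fun t => df t - dg t)) => // t tab.
    by have d1 := fd t tab; have d2 := gd t tab; apply: is_deriveB.
  by have := fg t tab; rewrite ler_norml; lra.
move: h1 h2.
rewrite -[(- f - g) a]/(- f a - g a) -[(- f - g) b]/(- f b - g b).
rewrite -[(f - g) a]/(f a - g a) -[(f - g) b]/(f b - g b).
by rewrite ler_norml; lra.
Qed.

Lemma is_derive_sinM (c x : R) : is_derive x 1 (fun t => sin (c * t)) (c * cos (c * x)).
Proof.
have h : is_derive x 1 ( *%R c) c.
  have -> : ( *%R c) = (fun t => c *: id t) by [].
  by apply: is_derive_eq; rewrite /GRing.scale /= mulr1.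
by have := @is_derive1_comp R (@sin R) ( *%R c) x _ _ (is_derive_sin _) h; rewrite mulrC.
Qed.

Lemma sin_le_id x : 0 <= x -> sin x <= x.
Proof.
move=> x0; rewrite -subr_ge0.
have -> : 0 = (0 : R) - sin 0 by rewrite sin0 subrr.
apply: (@is_derive_ge0_le (fun t => t - sin t) (fun t => 1 - cos t)) => //.
Qed.

Lemma sin_natM_le (k : nat) x : `|sin (k%:R * x)| <= k%:R * `|sin x|.
Proof.
elim: k => [|k IH]; first by rewrite !mul0r sin0 normr0.
rewrite -natr1 !mulrDl !mul1r sinD; apply: (le_trans (ler_normD _ _)).
rewrite !normrM; have := cos_max x; have := cos_max (k%:R * x) => h1 h2.
apply: lerD; first by apply: le_trans IH; rewrite ler_piMr.
by rewrite ler_piMl.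
Qed.

(** [fejer K] is K times the Fejer kernel. *)
Definition fejer (K : nat) x : R :=
  2 * \sum_(k < K) (K - k)%:R * cos (2 * pi * k%:R * x) - K%:R.

Lemma sin_dirichlet (K : nat) x :
  sin (pi * x) * (2 * \sum_(k < K.+1) cos (2 * pi * k%:R * x) - 1) =
  sin ((2 * K + 1)%:R * (pi * x)).
Proof.
elim: K => [|K IH].
  by rewrite big_ord1 mulr0 mul0r cos0 muln0 add0n mul1r mulr1 addrK mulr1.
rewrite big_ord_recr /=; set a := pi * x in IH *.
set b := 2 * pi * K.+1%:R * x.
have -> : forall S c, sin a * (2 * (S + c) - 1) = sin a * (2 * S - 1) + 2 * sin a * c :> R.
  by move=> S c; ring.
rewrite IH.
have -> : (2 * K + 1)%:R * a = b - a.
  by rewrite /a /b -[K.+1%:R]natr1 natrD natrM; ring.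
have -> : (2 * K.+1 + 1)%:R * a = b + a.
  by rewrite /a /b -[K.+1%:R]natr1 natrD natrM -[K.+1%:R]natr1; ring.
by rewrite sinB sinD; ring.
Qed.

Lemma fejerS (K : nat) x :
  fejer K.+1 x = fejer K x + (2 * \sum_(k < K.+1) cos (2 * pi * k%:R * x) - 1).
Proof.
rewrite /fejer.
have -> : \sum_(k < K.+1) (K.+1 - k)%:R * cos (2 * pi * k%:R * x) =
  \sum_(k < K.+1) (K - k)%:R * cos (2 * pi * k%:R * x) +
  \sum_(k < K.+1) cos (2 * pi * k%:R * x).
  rewrite -big_split /=; apply: eq_bigr => k _.
  have kK : (k <= K)%N by rewrite -ltnS.
  by rewrite (subSn kK) -natr1; ring.
rewrite [X in 2 * (X + _)]big_ord_recr /= subnn mul0r addr0 -natr1; ring.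
Qed.

(** The closed form from which the sign and the zeros of the kernel are read. *)
Lemma sin2_fejer (K : nat) x :
  2 * sin (pi * x) ^+ 2 * fejer K x = 1 - cos (2 * pi * K%:R * x).
Proof.
elim: K => [|K IH].
  by rewrite /fejer big_ord0 !mulr0 mul0r cos0 !subrr mulr0.
rewrite fejerS mulrDr IH expr2.
have -> : forall D, 2 * (sin (pi * x) * sin (pi * x)) * D =
  2 * sin (pi * x) * (sin (pi * x) * D) by move=> D; ring.
rewrite sin_dirichlet.
set a := pi * x; set b := (2 * K + 1)%:R * a.
have -> : 2 * pi * K%:R * x = b - a by rewrite /b /a natrD natrM; ring.
have -> : 2 * pi * K.+1%:R * x = b + a by rewrite /b /a natrD natrM -natr1; ring.
by rewrite cosB cosD; ring.
Qed.

Lemma cos_natM_eq1 (k : nat) x : cos x = 1 -> cos (k%:R * x) = 1.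
Proof.
move=> c1; have s1 : sin x = 0 by apply: cos1sin0; rewrite c1 normr1.
elim: k => [|k IH]; first by rewrite mul0r cos0.
by rewrite -natr1 mulrDl mul1r cosD IH c1 s1 mulr0 subr0 mulr1.
Qed.

Lemma fejer_ge0 (K : nat) x : 0 <= fejer K x.
Proof.
have H := sin2_fejer K x.
have [s0|s0] := eqVneq (sin (pi * x)) 0; last first.
  have : 0 <= 2 * sin (pi * x) ^+ 2 * fejer K x by rewrite H subr_ge0 cos_le1.
  by rewrite pmulr_rge0 // mulr_gt0 // exprn_even_gt0.
have c1 : cos (2 * pi * x) = 1.
  have -> : 2 * pi * x = (pi * x) *+ 2 by rewrite mulr2n; ring.
  by rewrite cos_mulr2n cos2sin2 s0 mulr2n; ring.
have {H} : forall k : nat, cos (2 * pi * k%:R * x) = 1.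
  move=> k; have -> : 2 * pi * k%:R * x = k%:R * (2 * pi * x) by ring.
  exact: cos_natM_eq1.
move=> c; elim: K => [|K IH]; first by rewrite /fejer big_ord0 mulr0 subrr.
rewrite fejerS addr_ge0 //.
under eq_bigr do rewrite c.
by rewrite sumr_const card_ord -natr1; have : 0 <= K%:R :> R by []; lra.
Qed.

(** A primitive of [fejer K - K]. The Fourier series of the sawtooth has the
    terms [- sin (2 pi k x) / (pi k)], so its Cesaro mean of order [K] is
    [- fejer_prim K / K]. The term of index 0 is 0 / 0 = 0. *)
Definition fejer_prim (K : nat) x : R :=
  \sum_(k < K) (K - k)%:R * sin (2 * pi * k%:R * x) / (pi * k%:R).

Lemma is_derive_fejer_prim (K : nat) x :
  is_derive x 1 (fejer_prim K) (fejer K x - K%:R).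
Proof.
pose w (k : 'I_K) : R := (K - k)%:R / (pi * k%:R).
have -> : fejer_prim K = \sum_(k < K) (fun t => w k * sin (2 * pi * k%:R * t)).
  apply/funext => t; rewrite fct_sumE; apply: eq_bigr => k _.
  by rewrite /w mulrAC.
have -> : fejer K x - K%:R = \sum_(k < K) (w k * (2 * pi * k%:R * cos (2 * pi * k%:R * x))).
  case: K @w => [|K] w; first by rewrite /fejer !big_ord0 mulr0 !subrr.
  rewrite /fejer !big_ord_recl /= !mulr0 !mul0r cos0 subn0 mulr0 mulr1 add0r.
  have -> : forall S : R, 2 * (K.+1%:R + S) - K.+1%:R - K.+1%:R = 2 * S.
    by move=> S; ring.
  rewrite mulr_sumr; apply: eq_bigr => k _.
  have pi0 : pi != 0 :> R by rewrite gt_eqF ?pi_gt0.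
  have k0 : (bump 0 k)%:R != 0 :> R by rewrite pnatr_eq0.
  move: pi0 k0; rewrite /w /=; generalize (@pi R) ((bump 0 k)%:R : R) => p m p0 m0.
  by field; rewrite p0 m0.
apply: (@is_derive_sum _ _ _ K (fun k => (fun t => w k * sin (2 * pi * k%:R * t))) x 1
  (fun k => w k * (2 * pi * k%:R * cos (2 * pi * k%:R * x)))) => k.
apply: (@is_deriveZ _ _ _ (fun t => sin (2 * pi * k%:R * t)) (w k) x 1 _
  (is_derive_sinM (2 * pi * k%:R) x)).
Qed.

End FejerKernel.

Section SawtoothApproximation.
Variable R : realType.
Implicit Types x y : R.

Lemma sqr_le2 x y : 0 <= x -> x <= y -> x ^+ 2 <= y ^+ 2.
Proof. by move=> x0 xy; rewrite !expr2; apply: ler_pM. Qed.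

Lemma sin_natpi (k : nat) : sin (k%:R * pi) = 0 :> R.
Proof.
elim: k => [|k IH]; first by rewrite mul0r sin0.
by rewrite -natr1 mulrDl mul1r sinDpi IH oppr0.
Qed.

Section Error.
Variable K : nat.
Hypothesis K_gt0 : (0 < K)%N.

Let k : R := K%:R.
Let k_gt0 : 0 < k. Proof. by rewrite ltr0n. Qed.

(** The difference between [x - 1/2] and the de la Vallee-Poussin mean
    [2 sigma_(2K) - sigma_K] of its Fourier series. The Cesaro mean [sigma_K]
    alone would leave an error of order [1 / (K x)]; here the derivative of the
    error is a difference of two Fejer kernels of equal mass, and the error
    decays like [1 / (K x)^2]. *)
Definition sawtooth_err x : R :=
  x - 1 / 2 + (fejer_prim (2 * K) x - fejer_prim K x) / k.

(* The derivative of the error is [q' / (2 sin^2)], where [q] is bounded by a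
   multiple of [1 / K^2]. Hence [Z] has a derivative of size [1 / (K^2 |sin|^3)]
   without oscillating numerator, and it is compared with [P]. *)
Let q x : R := (sin (2 * pi * k * x) - sin (4 * pi * k * x) / 2) / (2 * pi * k ^+ 2).
Let P x : R := 3 / (8 * pi * k ^+ 2) / sin (pi * x) ^+ 2.
Let Z x : R := sawtooth_err x - q x / (2 * sin (pi * x) ^+ 2).

Let dE x : is_derive x 1 sawtooth_err ((fejer (2 * K) x - fejer K x) / k).
Proof.
have d1 := is_derive_fejer_prim (2 * K) x.
have d2 := is_derive_fejer_prim K x.
have -> : sawtooth_err =
   (fun x => id x - cst (1 / 2) x + k^-1 *: (fejer_prim (2 * K) x - fejer_prim K x)).
  by apply/funext => t; rewrite /sawtooth_err /= /GRing.scale /= [X in _ = _ + X]mulrC.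
apply: is_derive_eq.
rewrite /GRing.scale /= natrM -/k; field; by rewrite gt_eqF.
Qed.

Let dq x : is_derive x 1 q ((cos (2 * pi * k * x) - cos (4 * pi * k * x)) / k).
Proof.
have d1 := is_derive_sinM (2 * pi * k) x.
have d2 := is_derive_sinM (4 * pi * k) x.
have -> : q = (fun x => (2 * pi * k ^+ 2)^-1 *:
     (sin (2 * pi * k * x) - 2^-1 *: sin (4 * pi * k * x))).
  by apply/funext => t; rewrite /q /= /GRing.scale /= mulrC [2^-1 * _]mulrC.
apply: is_derive_eq.
rewrite /GRing.scale /=; have := pi_gt0 R; generalize (@pi R) => p p0.
by field; rewrite !gt_eqF.
Qed.

Let dS x : sin (pi * x) != 0 ->
  is_derive x 1 (fun t => (sin (pi * t) ^+ 2)^-1)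
    (- 2 * pi * cos (pi * x) / sin (pi * x) ^+ 3).
Proof.
move=> s0; have d1 := is_derive_sinM pi x.
have d2 : is_derive x 1 (fun t => sin (pi * t) ^+ 2) (2 * pi * cos (pi * x) * sin (pi * x)).
  apply: is_derive_eq; rewrite /GRing.scale /=; ring.
have s2 : sin (pi * x) ^+ 2 != 0 by rewrite expf_neq0.
have := @is_deriveV R (fun t => sin (pi * t) ^+ 2) x _ 1 s2 d2.
have -> : - (sin (pi * x) ^+ 2) ^- 2 *: (2 * pi * cos (pi * x) * sin (pi * x)) =
   - 2 * pi * cos (pi * x) / sin (pi * x) ^+ 3; last by [].
rewrite /GRing.scale /=; move: s0; generalize (sin (pi * x)) (cos (pi * x)) => s c s0.
by field.
Qed.

Let dZ x : sin (pi * x) != 0 ->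
  is_derive x 1 Z (q x * pi * cos (pi * x) / sin (pi * x) ^+ 3).
Proof.
move=> s0; have d1 := dE x; have d2 := dq x; have d3 := dS s0.
have -> : Z = (fun x => sawtooth_err x - 2^-1 *: (q x * (sin (pi * x) ^+ 2)^-1)).
  apply/funext => t; rewrite /Z /= /GRing.scale /= invfM; ring.
apply: is_derive_eq.
have e1 := sin2_fejer (2 * K) x; have e2 := sin2_fejer K x.
have -> : fejer (2 * K) x = (1 - cos (4 * pi * k * x)) / (2 * sin (pi * x) ^+ 2).
  have -> : 4 * pi * k * x = 2 * pi * (2 * K)%:R * x by rewrite natrM /k; ring.
  by rewrite -e1 mulrC mulKf // mulf_neq0 // expf_neq0.
have -> : fejer K x = (1 - cos (2 * pi * k * x)) / (2 * sin (pi * x) ^+ 2).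
  by rewrite -e2 mulrC mulKf // mulf_neq0 // expf_neq0.
rewrite /GRing.scale /=; move: s0 k_gt0.
generalize (sin (pi * x)) (cos (pi * x)) (cos (2 * pi * k * x)) (cos (4 * pi * k * x)) (q x) (@pi R) k.
move=> s c c1 c2 Q p m s0 m0; field.
by rewrite s0 gt_eqF.
Qed.

Let dP x : sin (pi * x) != 0 ->
  is_derive x 1 P (- (3 / (4 * k ^+ 2)) * cos (pi * x) / sin (pi * x) ^+ 3).
Proof.
move=> s0; have d3 := dS s0.
have -> : P = (fun x => (3 / (8 * pi * k ^+ 2)) *: (sin (pi * x) ^+ 2)^-1) by [].
apply: is_derive_eq; rewrite /GRing.scale /=.
move: s0 (pi_gt0 R) k_gt0; generalize (sin (pi * x)) (cos (pi * x)) (@pi R) k.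
move=> s c p m s0 p0 m0; field.
by rewrite s0 !gt_eqF.
Qed.

Let q_le x : `|q x| <= 3 / (4 * pi * k ^+ 2).
Proof.
have p0 := pi_gt0 R; have k2 : 0 < k ^+ 2 by rewrite exprn_gt0.
have B0 : 0 < 2 * pi * k ^+ 2 by rewrite !mulr_gt0.
rewrite /q normrM normfV (gtr0_norm B0).
rewrite ler_pdivrMr ?mulr_gt0 //.
have -> : 3 / (4 * pi * k ^+ 2) * (2 * pi * k ^+ 2) = 3 / 2.
  move: p0 k2; generalize (@pi R) (k ^+ 2) => p m p0 m0.
  by field; rewrite !gt_eqF.
apply: (le_trans (ler_normB _ _)).
rewrite normrM [ `|2^-1|]ger0_norm; last by rewrite invr_ge0.
have := sin_max (2 * pi * k * x); have := sin_max (4 * pi * k * x); lra.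
Qed.

Let err_half : sawtooth_err (1 / 2) = 0.
Proof.
have W K' : fejer_prim K' (1 / 2) = 0 :> R.
  apply: big1 => i _.
  have -> : 2 * pi * i%:R * (1 / 2) = i%:R * pi :> R by field.
  by rewrite sin_natpi mulr0 mul0r.
by rewrite /sawtooth_err !W; ring.
Qed.

Let Z_half : Z (1 / 2) = 0.
Proof.
rewrite /Z err_half /q.
have -> : 2 * pi * k * (1 / 2) = K%:R * pi by rewrite /k; field.
have -> : 4 * pi * k * (1 / 2) = (2 * K)%:R * pi by rewrite /k natrM; field.
by rewrite !sin_natpi; ring.
Qed.

(** At 1/2 the error vanishes by symmetry, so that the bound follows by
    integrating from there. *)
Let err_left x : 0 < x -> x <= 1 / 2 -> `|sawtooth_err x| <= 1 / (k ^+ 2 * sin (pi * x) ^+ 2).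
Proof.
move=> x0 x1; have p0 := pi_gt0 R; have k2 : 0 < k ^+ 2 by rewrite exprn_gt0.
have sp t : x <= t <= 1 / 2 -> 0 < sin (pi * t).
  move=> /andP[t1 t2]; apply: sin_gt0_pi; apply/andP; split; nra.
have cp t : x <= t <= 1 / 2 -> 0 <= cos (pi * t).
  move=> /andP[t1 t2]; apply: cos_ge0_pihalf; apply/andP; split; nra.
have bd t : x <= t <= 1 / 2 ->
  `|q t * pi * cos (pi * t) / sin (pi * t) ^+ 3| <=
    3 / (4 * k ^+ 2) * cos (pi * t) / sin (pi * t) ^+ 3.
  move=> tx; have s0 := sp t tx; have c0 := cp t tx.
  have s3 : 0 < sin (pi * t) ^+ 3 by rewrite exprn_gt0.
  have S0 : 0 <= (sin (pi * t) ^+ 3)^-1 by rewrite invr_ge0 ltW.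
  rewrite 3!normrM (ger0_norm S0) (ger0_norm c0) (gtr0_norm p0).
  apply: ler_wpM2r => //; apply: ler_wpM2r => //.
  have -> : 3 / (4 * k ^+ 2) = 3 / (4 * pi * k ^+ 2) * pi.
    move: p0 k2; generalize (@pi R) (k ^+ 2) => p m p0 m0.
    by field; rewrite !gt_eqF.
  by apply: ler_wpM2r; [exact: ltW|exact: q_le].
have hx : x <= x <= 1 / 2 by rewrite lexx x1.
have P0 : 0 <= P (1 / 2).
  by rewrite /P !mulr_ge0 // ?invr_ge0 ?exprn_even_ge0 // !mulr_ge0 // ltW.
have Zn : `|Z x| <= P x.
  have : `|Z x - Z (1 / 2)| <= P x - P (1 / 2).
    apply: (@is_derive_norm_le _ Z (fun t => q t * pi * cos (pi * t) / sin (pi * t) ^+ 3)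
      P (fun t => - (3 / (4 * k ^+ 2)) * cos (pi * t) / sin (pi * t) ^+ 3) _ _ x1).
    - by move=> t tx; apply: dZ; rewrite gt_eqF // sp.
    - by move=> t tx; apply: dP; rewrite gt_eqF // sp.
    - by move=> t tx; have := bd t tx; rewrite !mulNr opprK.
  by rewrite Z_half subr0; lra.
have s0 := sp x hx; have s2 : 0 < sin (pi * x) ^+ 2 by rewrite exprn_gt0.
set s := sin (pi * x) ^+ 2 in s2 *.
have -> : sawtooth_err x = Z x + q x / (2 * s) by rewrite /Z -/s subrK.
apply: (le_trans (ler_normD _ _)).
have qn : `|q x / (2 * s)| <= P x.
  rewrite normrM [ `|_^-1|]gtr0_norm; last by rewrite invr_gt0 mulr_gt0.
  have -> : P x = 3 / (4 * pi * k ^+ 2) / (2 * s).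
    rewrite /P -/s; move: p0 k2 s2; generalize (@pi R) (k ^+ 2) s => p m z p0 m0 z0.
    by field; rewrite !gt_eqF.
  by rewrite ler_wpM2r // invr_ge0 mulr_ge0 // ltW.
have : P x + P x <= 1 / (k ^+ 2 * s); last by lra.
rewrite /P -/s.
have -> : 3 / (8 * pi * k ^+ 2) / s + 3 / (8 * pi * k ^+ 2) / s =
   3 / (4 * pi) * (1 / (k ^+ 2 * s)).
  move: p0 k2 s2; generalize (@pi R) (k ^+ 2) s => p m z p0 m0 z0.
  by field; rewrite !gt_eqF.
rewrite ler_piMl //; first by rewrite divr_ge0 // mulr_ge0 // ltW.
rewrite ler_pdivrMr ?mulr_gt0 //; have := pi_ge2 R; lra.
Qed.

Lemma sawtooth_err_le x : 0 < x -> x < 1 ->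
  `|sawtooth_err x| <= 1 / (k ^+ 2 * sin (pi * x) ^+ 2).
Proof.
move=> x0 x1; have [h|h] := lerP x (1 / 2); first exact: err_left.
have -> : sawtooth_err x = - sawtooth_err (1 - x).
  have W K' : fejer_prim K' (1 - x) = - fejer_prim K' x.
    rewrite /fejer_prim -sumrN; apply: eq_bigr => i _.
    have -> : 2 * pi * i%:R * (1 - x) = (2 * i)%:R * pi - 2 * pi * i%:R * x :> R.
      by rewrite natrM; ring.
    have cp : cos ((2 * i)%:R * pi) = 1 :> R.
      rewrite natrM mulrAC mulrC; apply: cos_natM_eq1.
      by rewrite mulr_natl cos2pi.
    by rewrite sinB sin_natpi cp; ring.
  by rewrite /sawtooth_err !W; field; rewrite gt_eqF.
rewrite normrN.
have -> : sin (pi * x) = sin (pi * (1 - x)).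
  by rewrite mulrBr mulr1 sinB sinpi cospi; ring.
apply: err_left; lra.
Qed.

Lemma fejer_prim_le (K' : nat) x : `|fejer_prim K' x| <= K'%:R ^+ 2 * `|sin (pi * x)|.
Proof.
apply: (le_trans (ler_norm_sum _ _ _)).
have -> : K'%:R ^+ 2 * `|sin (pi * x)| = \sum_(i < K') (K'%:R * `|sin (pi * x)|).
  by rewrite sumr_const card_ord -[RHS]mulr_natl mulrA expr2.
apply: ler_sum => i _.
have [->|i0] := eqVneq (i : nat) 0%N; first by rewrite !mulr0 invr0 mulr0 normr0 mulr_ge0.
have ip : 0 < i%:R :> R by rewrite ltr0n lt0n.
rewrite !normrM normfV ger0_norm // [ `|pi * _|]gtr0_norm ?mulr_gt0 ?pi_gt0 //.
have -> : 2 * pi * i%:R * x = (2 * i)%:R * (pi * x) by rewrite natrM; ring.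
have h := sin_natM_le (2 * i) (pi * x).
rewrite -mulrA; apply: ler_pM => //; first by rewrite mulr_ge0 // invr_ge0 mulr_ge0 ?pi_ge0.
  by rewrite ler_nat leq_subr.
rewrite ler_pdivrMr ?mulr_gt0 ?pi_gt0 //; apply: (le_trans h).
rewrite natrM mulrC ler_wpM2l // ler_wpM2r //; exact: pi_ge2.
Qed.

(** Close to the integers [sawtooth_err_le] is void, but there every term of the
    trigonometric sum is bounded through [|sin (k t)| <= k |sin t|]. *)
Lemma sawtooth_err_near x : 0 <= x <= 1 -> `|sin (pi * x)| <= 1 / k ->
  `|sawtooth_err x| <= 6.
Proof.
move=> x01 sx; rewrite /sawtooth_err; apply: (le_trans (ler_normD _ _)).
have h1 : `|x - 1 / 2| <= 1 / 2 by rewrite ler_norml; lra.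
have h2 : `|(fejer_prim (2 * K) x - fejer_prim K x) / k| <= 5; last by lra.
rewrite normrM normfV (gtr0_norm k_gt0) ler_pdivrMr //.
apply: (le_trans (ler_normB _ _)).
have := fejer_prim_le (2 * K) x; have := fejer_prim_le K x.
rewrite natrM -/k; set s := `|sin _| in sx *.
have : k ^+ 2 * s <= k.
  have k2 : 0 <= k ^+ 2 by rewrite exprn_ge0 // ltW.
  apply: (le_trans (ler_wpM2l k2 sx)).
  have -> : k ^+ 2 * (1 / k) = k by field; rewrite gt_eqF.
  by [].
rewrite exprMn; lra.
Qed.

(** [fejer K] vanishes at the multiples of [1 / K] that are not integers. The shift
    by half of their distance makes the two numerators [1 - cos] and [1 + cos], so that the sum
    stays away from 0. *)
Definition sawtooth_majorant x : R := fejer K x + fejer K (x + 1 / (2 * k)).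

Lemma sawtooth_majorant_ge x :
  1 <= sawtooth_majorant x * (`|sin (pi * x)| + 2 / k) ^+ 2.
Proof.
set m := (_ ^+ 2).
have h1 : sin (pi * x) ^+ 2 <= m.
  rewrite /m -real_normK ?num_real // lerXn2r // ?nnegrE //.
    by rewrite addr_ge0 // divr_ge0 // ltW.
  by rewrite lerDl divr_ge0 // ltW.
have h2 : sin (pi * (x + 1 / (2 * k))) ^+ 2 <= m.
  rewrite /m -real_normK ?num_real // lerXn2r // ?nnegrE //.
    by rewrite addr_ge0 // divr_ge0 // ltW.
  rewrite mulrDr sinD; apply: (le_trans (ler_normD _ _)).
  rewrite !normrM; apply: lerD; first by rewrite ler_piMr // cos_max.
  apply: (@le_trans _ _ `|sin (pi * (1 / (2 * k)))|); first by rewrite ler_piMl // cos_max.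
  have a0 : 0 <= pi * (1 / (2 * k)) :> R.
    by rewrite mulr_ge0 ?pi_ge0 // divr_ge0 // mulr_ge0 // ltW.
  have a1 : pi * (1 / (2 * k)) <= 2 / k.
    have -> : 2 / k = 4 * (1 / (2 * k)) by field; rewrite gt_eqF.
    apply: ler_wpM2r; first by rewrite divr_ge0 // mulr_ge0 // ltW.
    have := @pihalf_lt2 R; lra.
  have k1 : 1 <= k by rewrite ler1n.
  have a2 : pi * (1 / (2 * k)) <= pi :> R.
    rewrite ler_piMr ?pi_ge0 // ler_pdivrMr ?mulr_gt0 //; lra.
  rewrite ger0_norm; first exact: le_trans (sin_le_id a0) a1.
  by apply: sin_ge0_pi; rewrite a0.
have f1 := fejer_ge0 K x; have f2 := fejer_ge0 K (x + 1 / (2 * k)).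
have e1 := sin2_fejer K x; have e2 := sin2_fejer K (x + 1 / (2 * k)).
have c : cos (2 * pi * k * (x + 1 / (2 * k))) = - cos (2 * pi * k * x).
  have -> : 2 * pi * k * (x + 1 / (2 * k)) = 2 * pi * k * x + pi by field; rewrite gt_eqF.
  by rewrite cosDpi.
rewrite -/k c in e2; rewrite -/k in e1.
rewrite /sawtooth_majorant mulrDl.
have : sin (pi * x) ^+ 2 * fejer K x <= m * fejer K x by rewrite ler_wpM2r.
have : sin (pi * (x + 1 / (2 * k))) ^+ 2 * fejer K (x + 1 / (2 * k)) <=
  m * fejer K (x + 1 / (2 * k)) by rewrite ler_wpM2r.
lra.
Qed.

(** With [s = |sin (pi x)|] and [m = max (s, 1 / K)], the error is at most
    [6 / (K m)^2] and the majorant at least [1 / (3 m)^2]. *)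
Lemma sawtooth_err_majorant x : 0 <= x < 1 ->
  `|sawtooth_err x| <= 54 / k ^+ 2 * sawtooth_majorant x.
Proof.
move=> /andP[x0 x1]; have G := sawtooth_majorant_ge x.
have G0 : 0 <= sawtooth_majorant x by rewrite addr_ge0 // fejer_ge0.
have k2 : 0 < k ^+ 2 by rewrite exprn_gt0.
set s := `|sin (pi * x)| in G *.
have sn : 0 <= s by exact: normr_ge0.
have k2n : 0 <= s + 2 / k by rewrite addr_ge0 // mulr_ge0 // invr_ge0 ltW.
have [sk|sk] := lerP s (1 / k).
  apply: (@le_trans _ _ 6); first by apply: sawtooth_err_near => //; rewrite x0 ltW.
  have : (s + 2 / k) ^+ 2 <= (3 / k) ^+ 2.
    apply: sqr_le2 => //.
    have -> : 3 / k = 1 / k + 2 / k by ring.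
    by rewrite lerD2r.
  have -> : (3 / k) ^+ 2 = 9 / k ^+ 2 by field; rewrite gt_eqF.
  have -> : 54 / k ^+ 2 * sawtooth_majorant x = 6 * (sawtooth_majorant x * (9 / k ^+ 2)).
    by ring.
  move=> h; have := ler_wpM2l G0 h; lra.
have s0 : 0 < s by apply: le_lt_trans sk; rewrite divr_ge0 // ltW.
have xp : 0 < x.
  by rewrite lt_neqAle x0 andbT; apply/eqP => E; move: s0; rewrite /s -E mulr0 sin0 normr0 ltxx.
apply: (le_trans (sawtooth_err_le xp x1)).
rewrite -[sin _ ^+ 2]real_normK ?num_real // -/s.
have s2 : 0 < s ^+ 2 by rewrite exprn_gt0.
have : (s + 2 / k) ^+ 2 <= (3 * s) ^+ 2.
  apply: sqr_le2 => //.
  have -> : 2 / k = 2 * (1 / k) by ring.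
  lra.
rewrite exprMn => h; have {}h := ler_wpM2l G0 h.
rewrite ler_pdivrMr ?mulr_gt0 //.
have -> : 54 / k ^+ 2 * sawtooth_majorant x * (k ^+ 2 * s ^+ 2) =
  54 * (sawtooth_majorant x * s ^+ 2) by field; rewrite gt_eqF.
lra.
Qed.

End Error.
End SawtoothApproximation.

(** * Sawtooth sums over sequences with small second differences *)

Section FractionalParts.
Variable R : realType.

Lemma sinD2piz (x : R) (z : int) : sin (x + 2 * pi * z%:~R) = sin x.
Proof. by rewrite -!cosBpihalf addrAC cosD2piz. Qed.

Definition sawtooth (x : R) : R := x - (Num.floor x)%:~R - 1 / 2.

Lemma sawtooth_approx (K : nat) (x : R) : (0 < K)%N ->
  `|sawtooth x + (fejer_prim (2 * K) x - fejer_prim K x) / K%:R| <=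
    54 / K%:R ^+ 2 * sawtooth_majorant K x.
Proof.
move=> K0; pose z := Num.floor x; pose y := x - z%:~R.
have /andP[z1 z2] := floor_itv x; rewrite intrD -/z in z1 z2.
have y01 : 0 <= y < 1 by rewrite /y; lra.
have W K' : fejer_prim K' x = fejer_prim K' y.
  apply: eq_bigr => i _; rewrite -[in RHS](sinD2piz _ (i%:Z * z)) /y intrM.
  by congr (_ * sin _ / _); rewrite -pmulrn; ring.
have F K' c : fejer K' (x + c) = fejer K' (y + c).
  rewrite /fejer; congr (2 * _ - _); apply: eq_bigr => i _.
  rewrite -[in RHS](cosD2piz _ (i%:Z * z)) /y intrM.
  by congr (_ * cos _); rewrite -pmulrn; ring.
have -> : sawtooth x + (fejer_prim (2 * K) x - fejer_prim K x) / K%:R = sawtooth_err K y.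
  by rewrite /sawtooth -/z -/y !W /sawtooth_err.
have -> : sawtooth_majorant K x = sawtooth_majorant K y.
  by rewrite /sawtooth_majorant F -[in LHS](addr0 x) F addr0.
exact: sawtooth_err_majorant.
Qed.

(** A form of the Erdos--Turan inequality. The approximating mean is a sum of
    frequencies below [2 K] with coefficients [O(1/k)]; the error is dominated
    by a positive kernel whose constant term [108 / K] gives the first summand
    and whose other coefficients are also [O(1/k)]. *)
Lemma sum_sawtooth_le (x : nat -> R) (N K : nat) (B : nat -> R) : (0 < K)%N ->
  (forall k, 0 <= B k) ->
  (forall k theta, (0 < k)%N -> (k < 2 * K)%N ->
     `|\sum_(n < N) cos (2 * pi * (k%:R * x n) + theta)| <= B k) ->
  `|\sum_(n < N) sawtooth (x n)| <=
     108 * N%:R / K%:R + 219 * \sum_(k < 2 * K) B k / k%:R.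
Proof.
move=> K0 B0 Bk.
have k0 : 0 < K%:R :> R by rewrite ltr0n.
set S := \sum_(k < 2 * K) B k / k%:R.
have prim K' : (K' <= 2 * K)%N ->
    `|\sum_(n < N) fejer_prim K' (x n)| <= K'%:R * S.
  move=> K'K; rewrite exchange_big /=; apply: (le_trans (ler_norm_sum _ _ _)).
  have -> : K'%:R * S = \sum_(k < 2 * K) K'%:R * (B k / k%:R) by rewrite mulr_sumr.
  rewrite (big_ord_widen_cond _ xpredT (fun k =>
    `|\sum_(n < N) (K' - k)%:R * sin (2 * pi * k%:R * x n) / (pi * k%:R)|) K'K).
  rewrite big_mkcond /=; apply: ler_sum => k _.
  have Bk0 : 0 <= K'%:R * (B k / k%:R) by rewrite mulr_ge0 // divr_ge0.
  case: ifP => // kK'.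
  have [->|kn0] := eqVneq (k : nat) 0%N.
    rewrite big1 ?normr0 ?mulr_ge0 // ?divr_ge0 // => n _.
    by rewrite !mulr0 invr0 mulr0.
  have kp : 0 < k%:R :> R by rewrite ltr0n lt0n.
  have pk : 0 < pi * k%:R :> R by rewrite mulr_gt0 // pi_gt0.
  rewrite -mulr_suml -mulr_sumr !normrM normfV (gtr0_norm pk) ger0_norm //.
  rewrite -mulrA; apply: ler_pM => //.
  - by rewrite mulr_ge0 // invr_ge0 ltW.
  - by rewrite ler_nat leq_subr.
  have -> : \sum_(n < N) sin (2 * pi * k%:R * x n) =
      \sum_(n < N) cos (2 * pi * (k%:R * x n) + - (pi / 2)).
    by apply: eq_bigr => n _; rewrite cosBpihalf mulrA.
  apply: ler_pM => //; first by rewrite invr_ge0 ltW.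
    by apply: Bk; rewrite ?lt0n //.
  by rewrite lef_pV2 ?posrE //; have := pi_ge2 R; nra.
have kern c : \sum_(n < N) fejer K (x n + c) <= N%:R * K%:R + 2 * K%:R ^+ 2 * S.
  rewrite /fejer big_split /= -mulr_sumr sumr_const card_ord exchange_big /=.
  have -> : \sum_(k < K) \sum_(n < N) (K - k)%:R * cos (2 * pi * k%:R * (x n + c)) =
     \sum_(k < K) (K - k)%:R * \sum_(n < N) cos (2 * pi * (k%:R * x n) + 2 * pi * k%:R * c).
    apply: eq_bigr => k _; rewrite mulr_sumr; apply: eq_bigr => n _.
    by congr (_ * cos _); ring.
  have T : \sum_(k < K) (K - k)%:R *
      \sum_(n < N) cos (2 * pi * (k%:R * x n) + 2 * pi * k%:R * c) <=
      N%:R * K%:R + K%:R ^+ 2 * S.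
    have SK : \sum_(k < K) K%:R * (K%:R * (B k / k%:R)) <= K%:R ^+ 2 * S.
      rewrite /S mulr_sumr expr2.
      rewrite (big_ord_widen_cond (2 * K) xpredT (fun k => K%:R * (K%:R * (B k / k%:R)))).
        rewrite big_mkcond /=; apply: ler_sum => k _; case: ifP => _.
          by rewrite mulrA.
        by rewrite !mulr_ge0 // invr_ge0.
      by rewrite mul2n -addnn leq_addr.
    apply: le_trans (lerD (lexx (N%:R * K%:R)) SK).
    case: K K0 k0 {SK S prim} Bk => [//|K] _ k0 Bk.
    rewrite !big_ord_recl /= subn0 invr0 !mulr0 add0r; apply: lerD.
      rewrite [N%:R * _]mulrC ler_wpM2l //.
      under eq_bigr do rewrite !(mul0r, mulr0) addr0 cos0.
      by rewrite sumr_const card_ord.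
    apply: ler_sum => k _.
    have kp : 0 < (bump 0 k)%:R :> R by rewrite ltr0n.
    set b := bump 0 k in kp *.
    have bK : (b < K.+1)%N by rewrite /b /bump /= add1n ltnS.
    apply: (@le_trans _ _ (K.+1%:R * B b)).
      apply: (@le_trans _ _ ((K.+1 - b)%:R * B b)).
        apply: ler_wpM2l => //; apply: (le_trans (ler_norm _)); apply: Bk => //.
        by apply: (leq_trans bK); rewrite mul2n -addnn leq_addr.
      by rewrite ler_wpM2r // ler_nat leq_subr.
    rewrite ler_wpM2l // mulrA ler_pdivlMr // mulrC ler_wpM2r //.
    by rewrite ler_nat ltnW.
  rewrite -[(- K%:R) *+ N]mulr_natl; lra.
have tot : \sum_(n < N) sawtooth_majorant K (x n) <= 2 * (N%:R * K%:R + 2 * K%:R ^+ 2 * S).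
  rewrite /sawtooth_majorant big_split /=.
  have e0 : \sum_(n < N) fejer K (x n + 0) = \sum_(n < N) fejer K (x n).
    by apply: eq_bigr => n _; rewrite addr0.
  have := kern (1 / (2 * K%:R)); have := kern 0; rewrite e0; lra.
have -> : \sum_(n < N) sawtooth (x n) =
  \sum_(n < N) (sawtooth (x n) + (fejer_prim (2 * K) (x n) - fejer_prim K (x n)) / K%:R) -
  ((\sum_(n < N) fejer_prim (2 * K) (x n)) - \sum_(n < N) fejer_prim K (x n)) / K%:R.
  rewrite -sumrB mulr_suml -sumrB.
  by apply: eq_bigr => n _; rewrite addrK.
apply: (le_trans (ler_normB _ _)).
have h1 : `|\sum_(n < N) (sawtooth (x n) + (fejer_prim (2 * K) (x n) - fejer_prim K (x n)) / K%:R)|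
   <= 54 / K%:R ^+ 2 * (2 * (N%:R * K%:R + 2 * K%:R ^+ 2 * S)).
  apply: (le_trans (ler_norm_sum _ _ _)).
  apply: (@le_trans _ _ (\sum_(n < N) 54 / K%:R ^+ 2 * sawtooth_majorant K (x n))).
    by apply: ler_sum => n _; exact: sawtooth_approx.
  by rewrite -mulr_sumr ler_wpM2l // divr_ge0 // exprn_ge0.
have h2 : `|((\sum_(n < N) fejer_prim (2 * K) (x n)) - \sum_(n < N) fejer_prim K (x n)) / K%:R|
   <= 3 * S.
  rewrite normrM normfV (gtr0_norm k0) ler_pdivrMr //.
  apply: (le_trans (ler_normB _ _)).
  have := prim (2 * K)%N (leqnn _); have := prim K; rewrite natrM.
  have -> : (K <= 2 * K)%N by rewrite mul2n -addnn leq_addr.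
  move=> /(_ isT); lra.
apply: (le_trans (lerD h1 h2)).
have -> : 54 / K%:R ^+ 2 * (2 * (N%:R * K%:R + 2 * K%:R ^+ 2 * S)) + 3 * S =
  108 * N%:R / K%:R + 219 * S by field; rewrite gt_eqF.
by [].
Qed.

Lemma sum_inv_sqrt_le (n : nat) :
  \sum_(k < n.+1) (Num.sqrt k%:R)^-1 <= 2 * Num.sqrt n%:R :> R.
Proof.
elim: n => [|n IH]; first by rewrite big_ord1 sqrtr0 invr0 mulr0.
rewrite big_ord_recr /=.
set a := Num.sqrt n.+1%:R; set b := Num.sqrt n%:R in IH *.
have a0 : 0 < a by rewrite sqrtr_gt0 ltr0n.
have b0 : 0 <= b by rewrite sqrtr_ge0.
have a2 : a * a = n.+1%:R by rewrite -expr2 sqr_sqrtr.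
have b2 : b * b = n%:R by rewrite -expr2 sqr_sqrtr.
have : a^-1 <= 2 * (a - b).
  have aV : a^-1 * a = 1 by rewrite mulVf // gt_eqF.
  rewrite -[a^-1]mul1r ler_pdivrMr //.
  by rewrite -natr1 in a2; nra.
lra.
Qed.

(** For [K] near [rho] the first term of [sum_sawtooth_le] is [O(rho^2)]. The
    second derivative test bounds the sum of frequency [k] by
    [O(sqrt (k rho^3))], so that the second term is
    [O(sqrt (rho^3) sqrt K)], which is again [O(rho^2)]. *)
Lemma sum_sawtooth_second_difference (c1 c2 c3 : R) : 0 < c1 -> 0 <= c2 -> 0 <= c3 ->
  exists C rho0 : R, [/\ 0 <= C, 1 <= rho0 & forall rho (x : nat -> R) N eps,
    rho0 <= rho -> eps = 1 \/ eps = -1 -> N%:R <= c3 * rho ^+ 3 ->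
    (forall i, (i.+2 < N)%N ->
       c1 / rho ^+ 3 <= eps * (x i.+2 - 2 * x i.+1 + x i) <= c2 / rho ^+ 3) ->
    `|\sum_(n < N) sawtooth (x n)| <= C * rho ^+ 2].
Proof.
move=> c1_gt0 c2_ge0 c3_ge0.
pose D := 9 * (c2 * c3 + 2) / Num.sqrt c1.
have D0 : 0 <= D by rewrite !mulr_ge0 ?invr_ge0 // addr_ge0 // mulr_ge0.
(* [16 * c1 <= rho] ensures [mu <= 1 / 4] for all frequencies up to [4 * rho] *)
exists (108 * c3 + 219 * (4 * D)), (1 + 16 * c1); split.
- by lra.
- by lra.
move=> rho x N eps rho0 eps1 Nc xd.
have rho1 : 1 <= rho by lra.
have rhop : 0 < rho by lra.
have r3 : 0 < rho ^+ 3 by rewrite exprn_gt0.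
pose K := (Num.truncn rho).+1.
have K1 : rho < K%:R by have /andP[] := truncn_itv (ltW rhop).
have K2 : K%:R <= 2 * rho.
  by rewrite /K -natr1; have /andP[] := truncn_itv (ltW rhop); lra.
pose B (k : nat) := D * Num.sqrt (rho ^+ 3) * Num.sqrt k%:R.
have B0 k : 0 <= B k by rewrite /B mulr_ge0 // mulr_ge0.
have Bk k theta : (0 < k)%N -> (k < 2 * K)%N ->
     `|\sum_(n < N) cos (2 * pi * (k%:R * x n) + theta)| <= B k.
  move=> k0 kK; have kp : 0 < k%:R :> R by rewrite ltr0n.
  pose mu := k%:R * c1 / rho ^+ 3.
  have mu0 : 0 < mu by rewrite divr_gt0 // mulr_gt0.
  have mu4 : mu <= 1 / 4.
    have k4 : k%:R <= 4 * rho :> R.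
      have : k%:R <= (2 * K)%:R :> R by rewrite ler_nat ltnW.
      rewrite natrM; lra.
    rewrite ler_pdivrMr //.
    have -> : rho ^+ 3 = rho * (rho * rho) by rewrite !exprS expr0 mulr1.
    have : k%:R * c1 <= 4 * rho * c1 by rewrite ler_wpM2r // ltW.
    have : 16 * c1 <= rho * rho by nra.
    nra.
  have h := @second_derivative_test R (fun n => k%:R * x n) theta mu (c2 / c1) eps N mu0 mu4
    (divr_ge0 c2_ge0 (ltW c1_gt0)) eps1.
  have hm : c2 / c1 * mu = k%:R * (c2 / rho ^+ 3).
    by rewrite /mu; field; rewrite !gt_eqF.
  rewrite hm in h.
  apply: (le_trans (h _)).
    move=> i iN; have /andP[h1 h2] := xd i iN.
    have -> : eps * (k%:R * x i.+2 - 2 * (k%:R * x i.+1) + k%:R * x i) =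
      k%:R * (eps * (x i.+2 - 2 * x i.+1 + x i)) by ring.
    by rewrite /mu -mulrA !ler_wpM2l.
  have sk : 0 < Num.sqrt k%:R :> R by rewrite sqrtr_gt0.
  have sc : 0 < Num.sqrt c1 by rewrite sqrtr_gt0.
  have sr : 0 < Num.sqrt (rho ^+ 3) by rewrite sqrtr_gt0.
  have -> : Num.sqrt mu = Num.sqrt k%:R * Num.sqrt c1 / Num.sqrt (rho ^+ 3).
    rewrite /mu sqrtrM ?mulr_ge0 ?ltW // sqrtrM ?ltW // sqrtrV //.
    exact: ltW.
  have -> : B k = k%:R * (c2 * c3 + 2) *
     (9 / (Num.sqrt k%:R * Num.sqrt c1 / Num.sqrt (rho ^+ 3))).
    have -> : k%:R = Num.sqrt k%:R * Num.sqrt k%:R :> R.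
      by rewrite -expr2 sqr_sqrtr // ltW.
    rewrite /B /D -expr2 [Num.sqrt (_ ^+ 2)]sqrtr_sqr (gtr0_norm sk).
    by field; rewrite !gt_eqF.
  apply: ler_wpM2r.
    by apply: divr_ge0.
  have k1 : 1 <= k%:R :> R by rewrite ler1n.
  have : N%:R * (c2 / rho ^+ 3) <= c2 * c3.
    by rewrite mulrA ler_pdivrMr // mulrC -mulrA; exact: ler_wpM2l.
  set y := c2 / rho ^+ 3; move=> hy.
  have : k%:R * (N%:R * y) <= k%:R * (c2 * c3) by rewrite ler_wpM2l // ltW.
  nra.
apply: (le_trans (sum_sawtooth_le _ B0 Bk)) => //.
rewrite [leRHS]mulrDl. apply: lerD.
  rewrite ler_pdivrMr; last by rewrite (lt_trans rhop).
  have : N%:R <= c3 * rho ^+ 2 * K%:R.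
    apply: (le_trans Nc); rewrite exprSr mulrA ler_wpM2l //; last exact: ltW.
    by rewrite mulr_ge0 // exprn_ge0 // ltW.
  lra.
rewrite -mulrA ler_wpM2l //.
have -> : \sum_(k < 2 * K) B k / k%:R =
    D * Num.sqrt (rho ^+ 3) * \sum_(k < 2 * K) (Num.sqrt k%:R)^-1.
  rewrite mulr_sumr; apply: eq_bigr => k _; rewrite /B -mulrA; congr (_ * _).
  have [k0|k0] := eqVneq (k%:R : R) 0; first by rewrite k0 sqrtr0 invr0 mulr0.
  have kp : 0 < k%:R :> R by rewrite lt_neqAle eq_sym k0 ler0n.
  have sk : 0 < Num.sqrt k%:R :> R by rewrite sqrtr_gt0.
  rewrite -{2}[k%:R](@sqr_sqrtr R) ?ler0n //.
  by field; rewrite gt_eqF.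
have -> : 4 * D * rho ^+ 2 = D * Num.sqrt (rho ^+ 3) * (4 * Num.sqrt rho).
  have -> : rho ^+ 2 = Num.sqrt (rho ^+ 3) * Num.sqrt rho.
    rewrite -sqrtrM ?ltW // -exprSr -[4%N]/(2 * 2)%N exprM sqrtr_sqr ger0_norm //.
    by rewrite exprn_ge0 // ltW.
  ring.
apply: ler_wpM2l; first by rewrite mulr_ge0.
have [M EM] : exists M, (2 * K)%N = M.+1 by exists (2 * K).-1; rewrite prednK // muln_gt0.
rewrite EM; apply: (le_trans (sum_inv_sqrt_le M)).
have -> : 4 * Num.sqrt rho = 2 * Num.sqrt (4 * rho).
  rewrite sqrtrM // -[4]/((2 * 2)%:R) natrM -expr2 sqrtr_sqr ger0_norm //; ring.
rewrite ler_wpM2l // ler_sqrt; last by rewrite mulr_ge0 // ltW.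
have : M%:R <= (2 * K)%:R :> R by rewrite ler_nat EM.
rewrite natrM; lra.
Qed.

End FractionalParts.

(** * Arcs of nonvanishing curvature *)

Section Calculus.
Variable R : realType.
Implicit Types (f p : R -> R) (a b x y : R).

Lemma has_derivative_withinP (D : set R) f x l :
  has_derivative_within D f x l -> forall e, 0 < e -> exists2 d, 0 < d &
    forall y, D y -> y != x -> `|y - x| < d -> `|(f y - f x) / (y - x) - l| < e.
Proof.
move=> /cvgrPdist_lt H e /H; rewrite !near_withinE => /nbhs_ballP[d /= d0 dH].
exists d => // y Dy yx yd; rewrite distrC; apply: dH => //.
by rewrite /ball /= distrC.
Qed.

Variables (a b : R) (f f1 : R -> R).
Hypothesis df : forall x, `[a, b]%classic x -> has_derivative_within `[a, b] f x (f1 x).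

Lemma within_is_derive x : a < x -> x < b -> is_derive x 1 f (f1 x).
Proof.
move=> ax xb; apply/is_derive1_caratheodory.
exists (fun z => if z == x then f1 x else (f z - f x) / (z - x)); split.
- move=> z; case: eqP => [->|/eqP]; first by rewrite !subrr mulr0.
  by rewrite -subr_eq0 => /divfK->.
- apply/cvgrPdist_lt => e e0; rewrite eqxx.
  have xab : `[a, b]%classic x by rewrite /= in_itv /= !ltW.
  have [d d0 dH] := has_derivative_withinP (df xab) e0.
  apply/nbhs_ballP; exists (Num.min d (Num.min (x - a) (b - x))).
    by rewrite /= !lt_min d0 !subr_gt0 ax xb.
  move=> y; rewrite /ball /= !lt_min => /and3P[h1 h2 h3].
  case: eqP => [_|/eqP yx]; first by rewrite subrr normr0.
  rewrite distrC; apply: dH => //; last by rewrite distrC.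
  rewrite /= in_itv /=; move: h2 h3; rewrite !ltr_norml; lra.
- by rewrite eqxx.
Qed.

Lemma within_continuous : {within `[a, b], continuous f}.
Proof.
apply/subspace_continuousP => x xab; apply/cvgrPdist_lt => e e0.
have [d d0 dH] := has_derivative_withinP (df xab) ltr01.
rewrite near_withinE; apply/nbhs_ballP.
pose m := `|f1 x| + 1.
have m0 : 0 < m by rewrite /m; have := normr_ge0 (f1 x); lra.
exists (Num.min d (e / m)); first by rewrite /= lt_min d0 divr_gt0.
move=> y; rewrite /ball /= lt_min => /andP[h1 h2] yab.
have [->|yx] := eqVneq y x; first by rewrite subrr normr0.
rewrite distrC in h1; rewrite distrC in h2.
have h := dH y yab yx h1.
have yx0 : y - x != 0 by rewrite subr_eq0.
rewrite distrC -[f y - f x](divfK yx0) normrM.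
have hm : `|(f y - f x) / (y - x)| < m.
  rewrite -[X in `|X|](subrK (f1 x)); apply: (le_lt_trans (ler_normD _ _)).
  by rewrite /m addrC ltrD2l.
rewrite ltr_pdivlMr // in h2; apply: le_lt_trans h2; rewrite mulrC.
by apply: ler_wpM2l => //; exact: ltW.
Qed.

(** At the end points the derivative is only one-sided, so the mean value theorem
    is used with continuity on the closed interval and derivability inside. *)
Lemma within_MVT_le (p dp : R -> R) x y : a <= x -> x <= y -> y <= b ->
  (forall t : R, is_derive t 1 p (dp t)) ->
  ((forall t, x <= t <= y -> dp t <= f1 t) -> p y - p x <= f y - f x) /\
  ((forall t, x <= t <= y -> f1 t <= dp t) -> f y - f x <= p y - p x).
Proof.
move=> ax xy yb pd.
have [c cxy E] : exists2 c, c \in `[x, y]%R &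
    (f - p) y - (f - p) x = (f1 c - dp c) * (y - x).
  apply: (@MVT_segment R (f - p) (fun t => f1 t - dp t)) => //.
    move=> t; rewrite in_itv /= => /andP[xt ty].
    have d1 : is_derive t 1 f (f1 t).
      by apply: within_is_derive; [exact: le_lt_trans xt|exact: lt_le_trans yb].
    exact: is_deriveB.
  have sub : `[x, y] `<=` `[a, b].
    by move=> t /=; rewrite !in_itv /= => /andP[t1 t2]; rewrite (le_trans ax) // (le_trans _ yb).
  have cf := continuous_subspaceW sub within_continuous.
  move=> z; apply: continuousD _; first exact: cf.
  apply/continuousN/continuous_subspaceT => t.
  by apply: differentiable_continuous; apply/derivable1_diffP; case: (pd t).
have {}E : f y - f x - (p y - p x) = (f1 c - dp c) * (y - x).
  by rewrite -E -[(f - p) y]/(f y - p y) -[(f - p) x]/(f x - p x); ring.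
move: cxy; rewrite in_itv /= => cxy.
by split => H; have := H c cxy; nra.
Qed.

End Calculus.

Section Taylor.
Variable R : realType.
Implicit Types (f : R -> R) (a b x y : R).

(** [eps] is 1 for a convex arc and -1 for a concave one. This two-sided bound on
    the distance from the tangents carries the information on the second
    derivative in a form that applies up to the end points. *)
Definition taylor2 (eps c C a b : R) (f f1 : R -> R) :=
  forall x y, a <= x <= b -> a <= y <= b ->
    c * (y - x) ^+ 2 <= eps * (f y - f x - f1 x * (y - x)) <= C * (y - x) ^+ 2.

Lemma C2_within_taylor a b f f1 f2 m M : C2_within `[a, b] f f1 f2 ->
  (forall x, a <= x <= b -> m <= f2 x <= M) ->
  taylor2 1 (m / 2) (M / 2) a b f f1.
Proof.
move=> [df df1 _] f2b.
have inc x y : a <= x -> x <= y -> y <= b ->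
    m * (y - x) <= f1 y - f1 x <= M * (y - x).
  move=> ax xy yb.
  have lin (k t : R) : is_derive t 1 (fun t => k * t) k.
    have -> : (fun t => k * t) = (fun t => k *: id t) by [].
    by apply: is_derive_eq; rewrite /GRing.scale /= mulr1.
  have [+ _] := within_MVT_le df1 ax xy yb (lin m).
  have [_ +] := within_MVT_le df1 ax xy yb (lin M).
  rewrite !mulrBr => h1 h2; apply/andP; split; [apply: h2|apply: h1] => t txy.
    by have /andP[] : m <= f2 t <= M by apply: f2b; lra.
  by have /andP[] : m <= f2 t <= M by apply: f2b; lra.
have quad (k x t : R) : is_derive t 1 (fun t => f1 x * t + k / 2 * (t - x) ^+ 2)
    (f1 x + k * (t - x)).
  have -> : (fun t => f1 x * t + k / 2 * (t - x) ^+ 2) =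
     (fun t => f1 x *: id t + (k / 2) *: (id t - cst x t) ^+ 2) by [].
  by apply: is_derive_eq; rewrite /GRing.scale /= /cst /=; field.
move=> x y xab yab; rewrite mul1r.
have [xy|yx] := lerP x y.
  have [||h1 _] := within_MVT_le df _ xy _ (quad m x); [lra|lra|].
  have [||_ h2] := within_MVT_le df _ xy _ (quad M x); [lra|lra|].
  have {}h1 : f1 x * y + m / 2 * (y - x) ^+ 2 - (f1 x * x + m / 2 * (x - x) ^+ 2) <= f y - f x.
    apply: h1 => t txy; have := inc x t; lra.
  have {}h2 : f y - f x <= f1 x * y + M / 2 * (y - x) ^+ 2 - (f1 x * x + M / 2 * (x - x) ^+ 2).
    apply: h2 => t txy; have := inc x t; lra.
  apply/andP; split; lra.
have [||_ h1] := within_MVT_le df _ (ltW yx) _ (quad m x); [lra|lra|].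
have [||h2 _] := within_MVT_le df _ (ltW yx) _ (quad M x); [lra|lra|].
have {}h1 : f x - f y <= f1 x * x + m / 2 * (x - x) ^+ 2 - (f1 x * y + m / 2 * (y - x) ^+ 2).
  apply: h1 => t txy; have := inc t x; lra.
have {}h2 : f1 x * x + M / 2 * (x - x) ^+ 2 - (f1 x * y + M / 2 * (y - x) ^+ 2) <= f x - f y.
  apply: h2 => t txy; have := inc t x; lra.
apply/andP; split; lra.
Qed.

(** What the lattice point count uses of a twice continuously differentiable arc
    whose second derivative has no zero. *)
Definition curved_piece (eps a b : R) (f : R -> R) := exists f1 c C M,
  [/\ 0 < c, 0 <= C, taylor2 eps c C a b f f1
    & forall x, a <= x <= b -> `|f1 x| <= M].

Lemma C2_within_bounded a b f f1 f2 : a <= b -> C2_within `[a, b] f f1 f2 ->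
  exists M, forall x, a <= x <= b -> `|f1 x| <= M.
Proof.
move=> ab [_ df1 _].
have cf1 := within_continuous df1.
have [u _ uM] := EVT_max ab cf1; have [v _ vm] := EVT_min ab cf1.
exists (`|f1 u| + `|f1 v|) => x xab.
have xin : x \in `[a, b]%R by rewrite in_itv.
have := uM x xin; have := vm x xin.
have := ler_norm (f1 u); have := lerNnormlW (lexx `|f1 v|).
have := normr_ge0 (f1 u); have := normr_ge0 (f1 v).
rewrite ler_norml; lra.
Qed.

Lemma convex_smooth_piece a b (I' : set R) f : a <= b ->
  convex_smooth `[a, b] I' f -> curved_piece 1 a b f.
Proof.
move=> ab [f1 [f2 [fC _ f2p _]]].
have [M fM] := C2_within_bounded ab fC.
have [_ _ cf2] := fC.
have [u uab uM] := EVT_max ab cf2; have [v vab vm] := EVT_min ab cf2.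
have u0 := f2p u uab; have v0 := f2p v vab.
exists f1, (f2 v / 2), (f2 u / 2), M; split => //; [lra|lra|].
apply: (C2_within_taylor fC) => x xab.
by rewrite uM ?vm // in_itv.
Qed.

Lemma concave_smooth_piece a b (I' : set R) f : a <= b ->
  concave_smooth `[a, b] I' f -> curved_piece (-1) a b f.
Proof.
move=> ab [f1 [f2 [fC _ f2n _]]].
have [M fM] := C2_within_bounded ab fC.
have [_ _ cf2] := fC.
have [u uab uM] := EVT_max ab cf2; have [v vab vm] := EVT_min ab cf2.
have u0 := f2n u uab; have v0 := f2n v vab.
exists f1, (- f2 u / 2), (- f2 v / 2), M; split => //; [lra|lra|].
move=> x y xab yab.
have /(_ x y xab yab) : taylor2 1 (f2 v / 2) (f2 u / 2) a b f f1.
  apply: (C2_within_taylor fC) => z zab.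
  by rewrite uM ?vm // in_itv.
lra.
Qed.

End Taylor.

(** * Decreasing curves and Young's identity *)

Section Curve.
Variables (R : realType) (L : R) (f g : R -> R).
Hypothesis L_gt0 : 0 < L.
Hypothesis curve : decreasing_curve L f g.

Let itvE (x : R) : (x \in `[0, L]%R) = (0 <= x <= L). Proof. by rewrite in_itv. Qed.

Lemma curve_range x : 0 <= x <= L -> 0 <= f x <= L.
Proof.
move=> xL; have [fm _ _] := curve_f_bij curve.
by have := fm x; rewrite /= !in_itv /= => /(_ xL).
Qed.

Lemma curve_grange y : 0 <= y <= L -> 0 <= g y <= L.
Proof.
by move=> yL; have := curve_g_maps curve (x := y); rewrite /= !in_itv /= => /(_ yL).
Qed.

Lemma curve_lt x y : 0 <= x -> x < y -> y <= L -> f y < f x.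
Proof. by move=> x0 xy yL; apply: (curve_f_decr curve) => //; rewrite itvE; lra. Qed.

Lemma curve_le x y : 0 <= x -> x <= y -> y <= L -> f y <= f x.
Proof.
move=> x0; rewrite le_eqVlt => /orP[/eqP -> //|xy yL]; exact/ltW/curve_lt.
Qed.

Lemma curve_gf x : 0 <= x <= L -> g (f x) = x.
Proof. by move=> xL; apply: (curve_fK curve); rewrite itvE. Qed.

Lemma curve_fg y : 0 <= y <= L -> f (g y) = y.
Proof. by move=> yL; apply: (curve_gK curve); rewrite itvE. Qed.

Lemma curve_at0 : f 0 = L.
Proof.
have L0 := L_gt0.
have LL : 0 <= L <= L by lra.
have /andP[g0 gL] := curve_grange LL.
apply/eqP; rewrite eq_le; apply/andP; split.
  by have /andP[] : 0 <= f 0 <= L by apply: curve_range; lra.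
by rewrite -[leLHS](curve_fg LL) curve_le.
Qed.

Lemma curve_atL : f L = 0.
Proof.
have L0 := L_gt0.
have LL : 0 <= (0 : R) <= L by lra.
have /andP[g0 gL] := curve_grange LL.
apply/eqP; rewrite eq_le; apply/andP; split.
  by rewrite -[leRHS](curve_fg LL) curve_le.
by have /andP[] : 0 <= f L <= L by apply: curve_range; lra.
Qed.

Lemma curve_le_swap x y : 0 <= x <= L -> 0 <= y <= L -> (y <= f x) = (x <= g y).
Proof.
have L0 := L_gt0.
move=> xL yL; have /andP[g0 gL] := curve_grange yL; have fr := curve_range xL.
have /andP[x0 xL'] := xL.
apply/idP/idP => h; rewrite leNgt; apply/negP => k.
  by have := curve_lt g0 k xL'; rewrite curve_fg //; lra.
by have := curve_le x0 h gL; rewrite curve_fg //; lra.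
Qed.

Lemma curve_continuous : {within `[0, L], continuous f}.
Proof.
have L0 := L_gt0.
apply: segment_dec_surj_continuous.
  move=> x y; rewrite !itvE => xL yL; apply/idP/idP => h; last by apply: curve_le; lra.
  by rewrite leNgt; apply/negP => k; have := curve_lt (x := x) (y := y); lra.
rewrite curve_at0 curve_atL.
move=> y /=; rewrite in_itv /= => yL; exists (g y); last by rewrite curve_fg.
by rewrite /= in_itv /= curve_grange.
Qed.

Lemma curve_swap : decreasing_curve L g f.
Proof.
have L0 := L_gt0.
split.
- split.
  + exact: curve_g_maps curve.
  + move=> x y; rewrite !inE /= !in_itv /= => xL yL E.
    by rewrite -(curve_fg xL) E curve_fg.
  + move=> x /=; rewrite in_itv /= => xL; exists (f x); last by rewrite curve_gf.
    by rewrite /= in_itv /= curve_range.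
- move=> x y; rewrite !itvE => xL yL xy; rewrite ltNge; apply/negP => h.
  have /andP[gx _] := curve_grange xL; have /andP[_ gy] := curve_grange yL.
  by have := curve_le gx h gy; rewrite !curve_fg //; lra.
- by have [] := curve_f_bij curve.
- exact: curve_gK curve.
- exact: curve_fK curve.
Qed.

End Curve.

Section Primitive.
Variables (R : realType) (L : R) (f g : R -> R).
Hypothesis L_gt0 : 0 < L.
Hypothesis curve : decreasing_curve L f g.

Definition prim (x : R) : R := \int[lebesgue_measure]_(t in `[0, x]) f t.

Lemma prim0 : prim 0 = 0.
Proof. by rewrite /prim set_itv1 Rintegral_set1. Qed.

Lemma primL : prim L = area L f. Proof. by []. Qed.

Let int_f x y : 0 <= x -> y <= L ->
  lebesgue_measure.-integrable `[x, y] (EFin \o f).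
Proof.
move=> x0 yL; have sub : `[x, y] `<=` `[0, L].
  by move=> t /=; rewrite !in_itv /= => /andP[t1 t2]; rewrite (le_trans x0) // (le_trans _ yL).
apply: continuous_compact_integrable; first exact: segment_compact.
exact: continuous_subspaceW sub (curve_continuous L_gt0 curve).
Qed.

Let prim_diff x y : 0 <= x -> x <= y -> y <= L ->
  prim y - prim x = \int[lebesgue_measure]_(t in `[x, y]) f t.
Proof.
move=> x0 xy yL; rewrite /prim.
rewrite (@Rintegral_itvB _ f (BLeft 0) (BRight y) x); rewrite ?bnd_simp //.
  rewrite Rintegral_itv_obnd_cbnd //; apply: integrableS (int_f x0 yL) => //.
  by move=> t /=; rewrite !in_itv /= => /andP[/ltW -> ->].
exact: int_f.
Qed.

Let lin_cont (x y p q : R) : {within `[x, y], continuous (fun t => p + q * (t - x))}.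
Proof.
apply: continuous_subspaceT => t.
apply: differentiable_continuous; apply/derivable1_diffP.
have -> : (fun t => p + q * (t - x)) = (fun t => cst p t + q *: (id t - cst x t)) by [].
exact: ex_derive.
Qed.

Let int_lin (x y p q : R) :
  lebesgue_measure.-integrable `[x, y] (EFin \o (fun t => p + q * (t - x))).
Proof. by apply: continuous_compact_integrable; [exact: segment_compact|exact: lin_cont]. Qed.

Let Rintegral_lin (x y p q : R) : x <= y ->
  \int[lebesgue_measure]_(t in `[x, y]) (p + q * (t - x)) =
  p * (y - x) + q * (y - x) ^+ 2 / 2.
Proof.
rewrite le_eqVlt => /orP[/eqP ->|xy].
  by rewrite set_itv1 Rintegral_set1 subrr expr0n !mulr0 add0r mul0r.
pose F t := p * (t - x) + q / 2 * (t - x) ^+ 2.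
have dF (t : R) : is_derive t 1 F (p + q * (t - x)).
  have -> : F = (fun t => p *: (id t - cst x t) + (q / 2) *: (id t - cst x t) ^+ 2) by [].
  by apply: is_derive_eq; rewrite /GRing.scale /= /cst /=; field.
have cF (t : R) : {for t, continuous F}.
  by apply: differentiable_continuous; apply/derivable1_diffP; case: (dF t).
rewrite /Rintegral (@continuous_FTC2 _ (fun t => p + q * (t - x)) F x y xy).
- by rewrite -EFinB /= /F subrr expr0n !mulr0 addr0 subr0; field.
- exact: lin_cont.
- split.
  + by move=> t _; case: (dF t).
  + by apply: cvg_at_right_filter; exact: cF.
  + by apply: cvg_at_left_filter; exact: cF.
- by move=> t _; rewrite derive1E; apply: derive_val.
Qed.

Lemma prim_le_lin x y p q : 0 <= x -> x <= y -> y <= L ->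
  (forall t, x <= t <= y -> f t <= p + q * (t - x)) ->
  prim y - prim x <= p * (y - x) + q * (y - x) ^+ 2 / 2.
Proof.
move=> x0 xy yL H; rewrite prim_diff // -Rintegral_lin //.
apply: le_Rintegral; [by []|exact: int_f|exact: int_lin|].
by move=> t /=; rewrite in_itv /= => /H.
Qed.

Lemma prim_ge_lin x y p q : 0 <= x -> x <= y -> y <= L ->
  (forall t, x <= t <= y -> p + q * (t - x) <= f t) ->
  p * (y - x) + q * (y - x) ^+ 2 / 2 <= prim y - prim x.
Proof.
move=> x0 xy yL H; rewrite prim_diff // -Rintegral_lin //.
apply: le_Rintegral; [by []|exact: int_lin|exact: int_f|].
by move=> t /=; rewrite in_itv /= => /H.
Qed.

Lemma prim_bounds x y : 0 <= x -> x <= y -> y <= L ->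
  f y * (y - x) <= prim y - prim x <= f x * (y - x).
Proof.
move=> x0 xy yL; apply/andP; split.
  rewrite -[leLHS]addr0; have := @prim_ge_lin x y (f y) 0 x0 xy yL.
  rewrite !mul0r; apply => t /andP[t1 t2]; rewrite mul0r addr0.
  by apply: (curve_le curve) => //; exact: le_trans t1.
rewrite -[leRHS]addr0; have := @prim_le_lin x y (f x) 0 x0 xy yL.
rewrite !mul0r; apply => t /andP[t1 t2]; rewrite mul0r addr0.
by apply: (curve_le curve) => //; exact: le_trans yL.
Qed.

End Primitive.

Section Young.
Variables (R : realType) (L : R) (f g : R -> R).
Hypothesis L_gt0 : 0 < L.
Hypothesis curve : decreasing_curve L f g.

Let Y x := prim f x + prim g (f x) - x * f x.

Let Y_step x y : 0 <= x -> x <= y -> y <= L ->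
  `|Y y - Y x| <= (y - x) * (f x - f y).
Proof.
move=> x0 xy yL.
have := prim_bounds L_gt0 curve x0 xy yL.
have xr : 0 <= x <= L by lra.
have yr : 0 <= y <= L by lra.
have /andP[fx0 fxL] := curve_range curve xr; have /andP[fy0 fyL] := curve_range curve yr.
have fyx : f y <= f x by apply: (curve_le curve).
have := prim_bounds L_gt0 (curve_swap L_gt0 curve) fy0 fyx fxL.
rewrite !(curve_gf curve) // /Y ler_norml; nra.
Qed.

(** Young's identity for the decreasing curve: both integrals measure the same
    region. The left-hand side changes on a subinterval by at most the area of
    the box spanned by the curve, and these boxes have total area L^2/n. *)
Lemma young x : 0 <= x <= L ->
  prim f x + prim g (f x) - x * f x = prim g L.
Proof.
have L0 := L_gt0.
move=> /andP[x0 xL].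
suff H : forall n : nat, `|Y x - Y 0| <= x * L / n.+1%:R.
  have : Y x - Y 0 = 0.
    apply/eqP; rewrite -normr_eq0 eq_le normr_ge0 andbT leNgt; apply/negP => p0.
    have c0 : 0 <= x * L by rewrite mulr_ge0 // ltW.
    have := H (Num.truncn (x * L / `|Y x - Y 0|)).
    have /andP[_] := truncn_itv (divr_ge0 c0 (ltW p0)).
    by rewrite ltr_pdivrMr // ler_pdivlMr ?ltr0n // mulrC => h1 h2; lra.
  rewrite /Y (curve_at0 L_gt0 curve) prim0 mul0r; lra.
move=> n; pose h := x / n.+1%:R.
have h0 : 0 <= h by rewrite divr_ge0.
have np : 0 < n.+1%:R :> R by rewrite ltr0n.
have hx : h * n.+1%:R = x by rewrite divfK // gt_eqF.
have P k : (k <= n.+1)%N -> `|Y (h * k%:R) - Y 0| <= h * (f 0 - f (h * k%:R)).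
  elim: k => [|k IH] kn; first by rewrite mulr0 !subrr normr0 mulr0.
  have := IH (ltnW kn).
  have k0 : 0 <= h * k%:R by rewrite mulr_ge0.
  have kS : h * k%:R <= h * k.+1%:R by rewrite ler_wpM2l // ler_nat.
  have kL : h * k.+1%:R <= L.
    by apply: le_trans xL; rewrite -hx ler_wpM2l // ler_nat.
  have := Y_step k0 kS kL.
  have -> : h * k.+1%:R - h * k%:R = h by rewrite -natr1; ring.
  move=> h1 h2.
  have -> : Y (h * k.+1%:R) - Y 0 =
    (Y (h * k.+1%:R) - Y (h * k%:R)) + (Y (h * k%:R) - Y 0) by ring.
  apply: (le_trans (ler_normD _ _)); lra.
have := P n.+1 (leqnn _); rewrite hx => /le_trans; apply.
rewrite /h mulrAC ler_wpM2r ?invr_ge0 // ler_wpM2l //.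
rewrite (curve_at0 L_gt0 curve).
have : 0 <= f x <= L by apply: (curve_range curve); rewrite x0.
lra.
Qed.

Lemma area_swap : area L g = area L f.
Proof.
have L0 := L_gt0.
have LL : 0 <= L <= L by lra.
have := young LL.
by rewrite (curve_atL L_gt0 curve) prim0 addr0 mulr0 subr0 -!primL.
Qed.

End Young.

(** * Lattice points in a strip of columns *)

Section TrapezoidRule.
Variable R : realType.
Implicit Types (f g : R -> R) (a b c C M L r s sg tau u x h eps : R).

Definition dilate f r s u := r * s * f (u * s / r).

Lemma taylor2_norm eps c C a b f f1 x y : eps = 1 \/ eps = -1 -> 0 < c ->
  taylor2 eps c C a b f f1 -> a <= x <= b -> a <= y <= b ->
  `|f y - f x - f1 x * (y - x)| <= C * (y - x) ^+ 2.
Proof.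
move=> e1 c0 T xab yab; have /andP[h1 h2] := T x y xab yab.
have h3 : 0 <= c * (y - x) ^+ 2 by rewrite mulr_ge0 ?sqr_ge0 // ltW.
by case: e1 => e in h1 h2; rewrite e in h1 h2; rewrite ler_norml; lra.
Qed.

Lemma taylor2_second_difference eps c C a b f f1 x h :
  taylor2 eps c C a b f f1 -> a <= x -> 0 <= h -> x + 2 * h <= b ->
  2 * c * h ^+ 2 <= eps * (f (x + 2 * h) - 2 * f (x + h) + f x) <= 2 * C * h ^+ 2.
Proof.
move=> T ax h0 xb.
have i1 : a <= x + h <= b by lra.
have i2 : a <= x + 2 * h <= b by lra.
have i3 : a <= x <= b by lra.
have := T _ _ i1 i2; have := T _ _ i1 i3.
have -> : x - (x + h) = - h by ring.
have -> : x + 2 * h - (x + h) = h by ring.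
rewrite sqrrN; lra.
Qed.

(** The rule is exact on the tangent at [x], which stays within [C h^2] of the
    curve. *)
Lemma trapezoid_error L f g a b eps c C f1 x h : 0 < L -> decreasing_curve L f g ->
  0 <= a -> b <= L -> eps = 1 \/ eps = -1 -> 0 < c -> 0 <= C ->
  taylor2 eps c C a b f f1 -> a <= x -> 0 <= h -> x + h <= b ->
  `|prim f (x + h) - prim f x - h * (f x + f (x + h)) / 2| <= 2 * C * h ^+ 3.
Proof.
move=> L0 cv a0 bL e1 c0 C0 T ax h0 xb.
have xab : a <= x <= b by lra.
have E t : x <= t <= x + h -> `|f t - f x - f1 x * (t - x)| <= C * h ^+ 2.
  move=> txh; have tab : a <= t <= b by lra.
  apply: (le_trans (taylor2_norm e1 c0 T xab tab)); apply: ler_wpM2l => //.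
  by rewrite !expr2; apply: ler_pM; lra.
have x0 : 0 <= x by lra.
have xh : x <= x + h by lra.
have xL : x + h <= L by lra.
have up := @prim_le_lin _ _ _ _ L0 cv x (x + h) (f x + C * h ^+ 2) (f1 x) x0 xh xL.
have lo := @prim_ge_lin _ _ _ _ L0 cv x (x + h) (f x - C * h ^+ 2) (f1 x) x0 xh xL.
have {}up : prim f (x + h) - prim f x <= (f x + C * h ^+ 2) * (x + h - x) + f1 x * (x + h - x) ^+ 2 / 2.
  by apply: up => t /E; rewrite ler_norml; lra.
have {}lo : (f x - C * h ^+ 2) * (x + h - x) + f1 x * (x + h - x) ^+ 2 / 2 <= prim f (x + h) - prim f x.
  by apply: lo => t /E; rewrite ler_norml; lra.
have eh : x + h - x = h by ring.
rewrite eh in up lo.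
have := E (x + h); rewrite eh => /(_ _)/[dup].
have xx : x <= x + h <= x + h by lra.
move=> /(_ xx) + _; rewrite ler_norml => /andP[e2 e3].
have h3 : h ^+ 3 = h * h ^+ 2 by rewrite exprS.
rewrite ler_norml h3.
have := ler_wpM2l h0 e2; have := ler_wpM2l h0 e3; rewrite !expr2; lra.
Qed.

Lemma riemann_sum_piece L f g a b eps c C f1 r s u (N : nat) :
  0 < L -> decreasing_curve L f g ->
  0 <= a -> b <= L -> eps = 1 \/ eps = -1 -> 0 < c -> 0 <= C ->
  taylor2 eps c C a b f f1 -> 0 < r -> 0 < s ->
  a <= u * s / r -> (u + N%:R) * s / r <= b ->
  `|\sum_(i < N.+1) dilate f r s (u + i%:R)
     - (dilate f r s u + dilate f r s (u + N%:R)) / 2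
     - r ^+ 2 * (prim f ((u + N%:R) * s / r) - prim f (u * s / r))|
    <= N%:R * (2 * C * s ^+ 3 / r).
Proof.
move=> L0 cv a0 bL e1 c0 C0 T r0 s0 au; elim: N => [|N IH] ub.
  rewrite big_ord1 addr0 subrr mulr0 subr0 mul0r.
  have -> : dilate f r s u - (dilate f r s u + dilate f r s u) / 2 = 0 by field.
  by rewrite normr0.
have h0 : 0 <= s / r by rewrite divr_ge0 // ltW.
have uE : (u + N.+1%:R) * s / r = (u + N%:R) * s / r + s / r.
  by rewrite -natr1; field; rewrite gt_eqF.
rewrite uE in ub *.
have auN : a <= (u + N%:R) * s / r.
  apply: (le_trans au); rewrite -!mulrA ler_wpM2r // lerDl //.
have {}IH : `|\sum_(i < N.+1) dilate f r s (u + i%:R)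
     - (dilate f r s u + dilate f r s (u + N%:R)) / 2
     - r ^+ 2 * (prim f ((u + N%:R) * s / r) - prim f (u * s / r))|
    <= N%:R * (2 * C * s ^+ 3 / r) by apply: IH; apply: le_trans ub; rewrite lerDl.
have := trapezoid_error L0 cv a0 bL e1 c0 C0 T auN h0 ub.
set P := prim f _; set Q := prim f _ in IH *.
set S := \sum_(i < N.+1) _ in IH *.
rewrite big_ord_recr /= -/S => TE.
have dE : dilate f r s (u + N.+1%:R) = r * s * f ((u + N%:R) * s / r + s / r).
  by rewrite /dilate uE.
rewrite dE; rewrite /dilate in IH *.
set y := f ((u + N%:R) * s / r) in IH TE *; set z := f (_ + s / r) in TE *.
set p0 := prim f (u * s / r) in IH *; set y0 := f (u * s / r) in IH *.
have {}TE : `|r ^+ 2 * (P - Q) - r * s * (y + z) / 2| <= 2 * C * s ^+ 3 / r.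
  have -> : r ^+ 2 * (P - Q) - r * s * (y + z) / 2 =
     r ^+ 2 * (P - Q - s / r * (y + z) / 2) by field; rewrite gt_eqF.
  rewrite normrM ger0_norm ?sqr_ge0 //.
  have -> : 2 * C * s ^+ 3 / r = r ^+ 2 * (2 * C * (s / r) ^+ 3).
    by field; rewrite gt_eqF.
  by apply: ler_wpM2l => //; exact: sqr_ge0.
have -> : N.+1%:R * (2 * C * s ^+ 3 / r) =
   N%:R * (2 * C * s ^+ 3 / r) + 2 * C * s ^+ 3 / r.
  by rewrite -[N.+1%:R]natr1; ring.
set B := 2 * C * s ^+ 3 / r in IH TE *.
set NB := N%:R * B in IH *.
clearbody P Q S y z p0 y0 B NB; move: IH TE; rewrite !ler_norml; lra.
Qed.

Lemma sum_indicator_lt (N : nat) (Z : R) : 0 <= Z ->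
  \sum_(j < N) (if j%:R < Z then 1 else 0) <= Z + 1.
Proof.
move=> Z0; suff [] : \sum_(j < N) (if j%:R < Z then 1 else 0) <= Z + 1 /\
   \sum_(j < N) (if j%:R < Z then 1 else 0) <= N%:R :> R by [].
elim: N => [|N [IH1 IH2]]; first by rewrite big_ord0; split => //; lra.
rewrite big_ord_recr /= -natr1; case: ifP => h; split; lra.
Qed.

(** A column of negative height contains no point, whereas its floor, which is
    what the sawtooth sum evaluates, is negative. *)
Lemma truncn_floor_diff (z tau : R) : - tau <= z ->
  `|(Num.truncn z)%:R - (Num.floor z)%:~R| <= (if z < 0 then `|tau| + 1 else 0).
Proof.
move=> tz; case: ltP => z0; last first.
  rewrite truncn_floor z0 -[_%:R]pmulrn.
  have f0 : 0 <= Num.floor z by rewrite floor_ge0.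
  by rewrite pmulrn gez0_abs // subrr normr0.
have -> : Num.truncn z = 0%N by rewrite truncn_floor leNgt z0.
have /andP[h1 h2] := floor_itv z; rewrite intrD in h2.
have := ler_norm tau; have := normr_ge0 tau.
rewrite ler_norml; lra.
Qed.

End TrapezoidRule.

Section StripSum.
Variable R : realType.
Implicit Types (f g : R -> R) (a b c C M L r s sg tau u x h eps : R).

Lemma taylor2_lipschitz eps c C a b f f1 M x y : eps = 1 \/ eps = -1 -> 0 < c ->
  0 <= C -> taylor2 eps c C a b f f1 -> (forall x, a <= x <= b -> `|f1 x| <= M) ->
  a <= x -> x <= y -> y <= b -> `|f y - f x| <= (M + C * (b - a)) * (y - x).
Proof.
move=> e1 c0 C0 T fM ax xy yb.
have xab : a <= x <= b by lra.
have yab : a <= y <= b by lra.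
have := taylor2_norm e1 c0 T xab yab.
have d0 : 0 <= y - x by lra.
have : `|f1 x * (y - x)| <= M * (y - x).
  by rewrite normrM (ger0_norm d0) ler_wpM2r // fM.
have : C * (y - x) ^+ 2 <= C * (b - a) * (y - x).
  rewrite expr2 mulrA; apply: ler_wpM2r => //; apply: ler_wpM2l => //; lra.
rewrite !ler_norml; lra.
Qed.

Lemma prim_edge L f g x y (K : R) : 0 < L -> decreasing_curve L f g ->
  0 <= x -> x <= y -> y <= L -> f x - f y <= K * (y - x) ->
  (`|prim f y - prim f x - (y - x) * f x| <= K * (y - x) ^+ 2) /\
  (`|prim f y - prim f x - (y - x) * f y| <= K * (y - x) ^+ 2).
Proof.
move=> L0 cv x0 xy yL fK; have d0 : 0 <= y - x by lra.
have := prim_bounds L0 cv x0 xy yL => /andP[h1 h2].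
have := ler_wpM2r d0 fK; rewrite -mulrA -expr2 mulrBl => h3.
have h4 : f y <= f x by apply: (curve_le cv).
have h5 := ler_wpM2r d0 h4.
by rewrite !ler_norml; split; lra.
Qed.

(** The expected number of lattice points in the columns [m + 1, ..., n]: the
    area between [a] and [b], the Euler--Maclaurin corrections at both ends,
    which depend on the distance of the extreme columns from [a] and [b], and
    the mean loss of [tau + 1/2] points in each column. *)
Definition strip_main L f sg tau a b r s (m n : nat) : R :=
  r ^+ 2 * (prim f b - prim f a)
  - (m%:R + sg + 1 / 2 - a * r / s) * (r * s * f a)
  + (1 / 2 - (b * r / s - n%:R - sg)) * (r * s * f b)
  - (tau + 1 / 2) * (n%:R - m%:R).

(** Between the first and the last column the trapezoid rule applies; the two
    remaining slices have width [O(1/r)], and there [f] is constant up to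
    [O(1/r)]. *)
Lemma strip_sum L f g a b eps c C f1 M r s w sg tau (m N : nat) :
  0 < L -> decreasing_curve L f g ->
  0 <= a -> b <= L -> eps = 1 \/ eps = -1 -> 0 < c -> 0 <= C ->
  taylor2 eps c C a b f f1 -> (forall x, a <= x <= b -> `|f1 x| <= M) ->
  0 < r -> 0 < s -> 0 <= w ->
  a * r / s <= m%:R + 1 + sg <= a * r / s + w ->
  m%:R + 1 + sg + N%:R <= b * r / s < m%:R + 1 + sg + N%:R + 1 ->
  `|\sum_(i < N.+1) (dilate f r s (m%:R + 1 + sg + i%:R) - tau - 1 / 2)
     - strip_main L f sg tau a b r s m (m + N.+1)| <=
   (M + C * (b - a)) * s ^+ 2 * (w ^+ 2 + w / 2 + 3 / 2) + N%:R * (2 * C * s ^+ 3 / r).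
Proof.
move=> L0 cv a0 bL e1 c0 C0 T fM r0 s0 w0.
set u := m%:R + 1 + sg => /andP[au uw] /andP[ub bu].
have sr : 0 < s / r by rewrite divr_gt0.
pose x0 := u * s / r; pose x1 := (u + N%:R) * s / r.
have tr (t v : R) : t * r / s <= v -> t <= v * s / r.
  by rewrite ler_pdivlMr // ler_pdivrMr.
have tr' (t v : R) : v <= t * r / s -> v * s / r <= t.
  by rewrite ler_pdivlMr // ler_pdivrMr.
have ax0 : a <= x0 by apply: tr.
have x0w : x0 - a <= w * (s / r).
  have : (u - w) * s / r <= a by apply: tr'; lra.
  rewrite /x0; have -> : (u - w) * s / r = u * s / r - w * (s / r) by field; rewrite gt_eqF.
  lra.
have x1b : x1 <= b by apply: tr'.
have bx1 : b - x1 <= s / r.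
  have : b <= (u + N%:R + 1) * s / r by apply: tr; exact: ltW.
  rewrite /x1; have -> : (u + N%:R + 1) * s / r = (u + N%:R) * s / r + s / r by field; rewrite gt_eqF.
  lra.
have x01 : x0 <= x1.
  by rewrite /x0 /x1 -!mulrA; apply: ler_wpM2r; [exact: ltW|rewrite lerDl].
have M0 : 0 <= M by apply: le_trans (fM a _) => //; lra.
set K := M + C * (b - a).
have K0 : 0 <= K by rewrite addr_ge0 // mulr_ge0 //; lra.
have lip x y : a <= x -> x <= y -> y <= b -> f x - f y <= K * (y - x).
  move=> h1 h2 h3; have := taylor2_lipschitz e1 c0 C0 T fM h1 h2 h3.
  by rewrite ler_norml -/K; lra.
have x0b : x0 <= b by lra.
have x0L : x0 <= L by lra.
have ax1 : a <= x1 by lra.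
have x10 : 0 <= x1 by lra.
have l0 := lip a x0 (lexx _) ax0 x0b.
have l1 := lip x1 b ax1 x1b (lexx _).
have [e0 _] := prim_edge L0 cv a0 ax0 x0L l0.
have [_ e2] := prim_edge L0 cv x10 x1b bL l1.
have RS := riemann_sum_piece (N := N) L0 cv a0 bL e1 c0 C0 T r0 s0 ax0 x1b.
rewrite -/x0 -/x1 in RS.
have r2 : 0 <= r ^+ 2 by rewrite sqr_ge0.
have {}e0 : `|r ^+ 2 * (prim f x0 - prim f a) - (u - a * r / s) * (r * s * f a)| <= K * s ^+ 2 * w ^+ 2.
  have -> : r ^+ 2 * (prim f x0 - prim f a) - (u - a * r / s) * (r * s * f a) =
     r ^+ 2 * (prim f x0 - prim f a - (x0 - a) * f a).
    by rewrite /x0; field; rewrite !gt_eqF.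
  rewrite normrM (ger0_norm r2).
  have -> : K * s ^+ 2 * w ^+ 2 = r ^+ 2 * (K * (w * (s / r)) ^+ 2) by field; rewrite gt_eqF.
  apply: ler_wpM2l => //; apply: (le_trans e0); apply: ler_wpM2l => //.
  by rewrite !expr2; apply: ler_pM => //; lra.
have {}e2 : `|r ^+ 2 * (prim f b - prim f x1) - (b * r / s - u - N%:R) * (r * s * f b)| <= K * s ^+ 2.
  have -> : r ^+ 2 * (prim f b - prim f x1) - (b * r / s - u - N%:R) * (r * s * f b) =
     r ^+ 2 * (prim f b - prim f x1 - (b - x1) * f b).
    by rewrite /x1; field; rewrite !gt_eqF.
  rewrite normrM (ger0_norm r2).
  have -> : K * s ^+ 2 = r ^+ 2 * (K * (s / r) ^+ 2) by field; rewrite gt_eqF.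
  apply: ler_wpM2l => //; apply: (le_trans e2); apply: ler_wpM2l => //.
  by rewrite !expr2; apply: ler_pM => //; lra.
have rs0 : 0 <= r * s by rewrite mulr_ge0 // ltW.
have f0 : 0 <= r * s * f a - r * s * f x0 <= K * s ^+ 2 * w.
  rewrite -mulrBr mulr_ge0 //=; last by rewrite subr_ge0 (curve_le cv).
  have -> : K * s ^+ 2 * w = r * s * (K * (w * (s / r))) by field; rewrite gt_eqF.
  apply: ler_wpM2l => //; apply: (le_trans l0); exact: ler_wpM2l.
have f2 : 0 <= r * s * f x1 - r * s * f b <= K * s ^+ 2.
  rewrite -mulrBr mulr_ge0 //=; last by rewrite subr_ge0 (curve_le cv).
  have -> : K * s ^+ 2 = r * s * (K * (s / r)) by field; rewrite gt_eqF.
  apply: ler_wpM2l => //; apply: (le_trans l1); exact: ler_wpM2l.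
have SE : \sum_(i < N.+1) (dilate f r s (u + i%:R) - tau - 1 / 2) =
   \sum_(i < N.+1) dilate f r s (u + i%:R) - (tau + 1 / 2) * N.+1%:R.
  transitivity (\sum_(i < N.+1) (dilate f r s (u + i%:R) - (tau + 1 / 2))).
    by apply: eq_bigr => i _; ring.
  by rewrite sumrB sumr_const card_ord mulr_natr.
have mE : strip_main L f sg tau a b r s m (m + N.+1) =
  r ^+ 2 * (prim f b - prim f a) - (u - 1 / 2 - a * r / s) * (r * s * f a)
  + (1 / 2 - (b * r / s - u - N%:R)) * (r * s * f b) - (tau + 1 / 2) * N.+1%:R.
  by rewrite /strip_main natrD -[N.+1%:R]natr1 /u; field; rewrite gt_eqF.
rewrite SE mE.
set S := \sum_(i < N.+1) _ in RS *; set B := N%:R * _ in RS *.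
move: RS; rewrite /dilate -/x0 -/x1 => RS.
set fa := r * s * f a in e0 f0 *; set fb := r * s * f b in e2 f2 *.
set y0 := r * s * f x0 in f0 RS; set y1 := r * s * f x1 in f2 RS.
set ka := a * r / s in e0 *; set kb := b * r / s in e2 *.
set T' := (tau + 1 / 2) * _.
move: RS e0 e2; rewrite !ler_norml; lra.
Qed.

End StripSum.

Section StripCount.
Variable R : realType.

(** The lower bound on [z] grows quadratically away from the last index, so that
    only the last [Z] terms can be negative. *)
Lemma sum_truncn_negative (z : nat -> R) (N : nat) (tau q Z : R) : 0 < q -> 0 <= Z ->
  (forall i, (i < N)%N -> q * (N - i.+1)%:R ^+ 2 - tau <= z i) -> tau <= q * Z ^+ 2 ->
  `|\sum_(i < N) (Num.truncn (z i))%:R - \sum_(i < N) (Num.floor (z i))%:~R| <=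
    (`|tau| + 1) * (Z + 1).
Proof.
move=> q0 Z0 zq tq.
have t1 : 0 <= `|tau| + 1 by have := normr_ge0 tau; lra.
rewrite -sumrB; apply: (le_trans (ler_norm_sum _ _ _)).
apply: (@le_trans _ _ ((`|tau| + 1) * \sum_(i < N) (if i%:R < Z then 1 else 0))); last first.
  by apply: ler_wpM2l => //; exact: sum_indicator_lt.
rewrite mulr_sumr [leRHS](reindex_inj rev_ord_inj) /=.
apply: ler_sum => i _; have zi := zq i (ltn_ord i).
have n0 : 0 <= (N - i.+1)%:R :> R by [].
have q2 : 0 <= q * (N - i.+1)%:R ^+ 2 by rewrite mulr_ge0 ?sqr_ge0 // ltW.
apply: le_trans (truncn_floor_diff (tau := tau) _) _; first by lra.
case: ltP => z0; last by rewrite mulr_ge0 //; case: ifP.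
case: ltP => h; first by rewrite mulr1.
have := ler_pM Z0 Z0 h h; rewrite -!expr2 => hh.
by have := ler_wpM2l (ltW q0) hh; lra.
Qed.

(** The sum of the floors is the sum in [strip_sum] minus a sawtooth sum. The
    column heights have second differences [r s] times those of [f] for steps
    [s / r], hence of order [1 / r = rho^-3]. The parabola below [f] bounds the
    number of columns of negative height, for which floor and count differ. *)
Lemma strip_count (L : R) (f g : R -> R) (a b eps kappa sg tau s1 s2 w : R) :
  0 < L -> decreasing_curve L f g -> 0 <= a -> a < b -> b <= L ->
  eps = 1 \/ eps = -1 -> curved_piece eps a b f ->
  0 < kappa -> (forall x, a <= x <= b -> kappa * (b - x) ^+ 2 <= f x) ->
  - (1 / 2) < sg -> 0 < s1 -> s1 <= s2 -> 0 <= w ->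
  exists C rho0 : R, [/\ 0 <= C, 1 <= rho0 & forall rho s (m n : nat),
    rho0 <= rho -> s1 <= s <= s2 -> (m < n)%N ->
    a * rho ^+ 3 / s <= m%:R + 1 + sg <= a * rho ^+ 3 / s + w ->
    n%:R + sg <= b * rho ^+ 3 / s < n%:R + sg + 1 ->
    `|\sum_(m <= i < n) (Num.truncn (dilate f (rho ^+ 3) s (i.+1%:R + sg) - tau))%:R
      - strip_main L f sg tau a b (rho ^+ 3) s m n| <= C * rho ^+ 2].
Proof.
move=> L0 cv a0 ab bL e1 [f1 [c [C [M [c0 C0 T fM]]]]] kap0 fkap sgh s10 s12 w0.
have s20 : 0 < s2 by lra.
pose c3 := L / s1 + 1.
have c30 : 0 <= c3 by rewrite addr_ge0 // divr_ge0 // ltW.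
have cc1 : 0 < 2 * c * s1 ^+ 3 by rewrite mulr_gt0 ?exprn_gt0 // mulr_gt0.
have cc2 : 0 <= 2 * C * s2 ^+ 3 by rewrite mulr_ge0 ?exprn_ge0 ?mulr_ge0 // ltW.
have [D [rho0 [D0 rho01 SP]]] := sum_sawtooth_second_difference cc1 cc2 c30.
have M0 : 0 <= M by apply: le_trans (fM a _) => //; lra.
set K := M + C * (b - a).
have K0 : 0 <= K by rewrite addr_ge0 // mulr_ge0 //; lra.
pose W := w ^+ 2 + w / 2 + 3 / 2.
have W0 : 0 <= W by rewrite /W; have := sqr_ge0 w; lra.
(* a column at least [Z0 * rho ^+ 2] steps before the end is at least as high as
   [tau] *)
pose Z0 := (`|tau| + 1) / (s1 ^+ 3 * kappa) + 1.
have Z00 : 0 < s1 ^+ 3 * kappa by rewrite mulr_gt0 // exprn_gt0.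
have T1 : 0 < `|tau| + 1 by have := normr_ge0 tau; lra.
have Z1 : 1 <= Z0 by rewrite /Z0 lerDr divr_ge0 // ltW.
exists (K * s2 ^+ 2 * W + c3 * (2 * C * s2 ^+ 3) + D + (`|tau| + 1) * (Z0 + 1)), rho0; split => //.
  have h1 : 0 <= K * s2 ^+ 2 * W by apply: mulr_ge0 => //; apply: mulr_ge0; rewrite ?sqr_ge0.
  have h2 : 0 <= c3 * (2 * C * s2 ^+ 3) by apply: mulr_ge0.
  have h3 : 0 <= (`|tau| + 1) * (Z0 + 1).
    by apply: mulr_ge0; [exact: ltW|clear -Z1; lra].
  clear -h1 h2 h3 D0; lra.
move=> rho s m n rr /andP[ss1 ss2] mn.
have rho1 : 1 <= rho by exact: le_trans rr.
have rhop : 0 < rho by exact: lt_le_trans rho1.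
set r := rho ^+ 3.
have r0 : 0 < r by rewrite exprn_gt0.
have r1 : 1 <= r by rewrite exprn_ege1.
have rho2 : 1 <= rho ^+ 2 by rewrite exprn_ege1.
have s0 : 0 < s by exact: lt_le_trans ss1.
have [N nE] : exists N, n = (m + N.+1)%N.
  by exists (n - m.+1)%N; rewrite addnS -addSn subnKC.
rewrite nE => hm hn.
set u := m%:R + 1 + sg in hm.
have hn' : u + N%:R <= b * r / s < u + N%:R + 1.
  by move: hn; rewrite natrD -[N.+1%:R]natr1 /u; clear; lra.
pose z i := dilate f r s (u + i%:R) - tau.
have -> : \sum_(m <= i < m + N.+1) (Num.truncn (dilate f r s (i.+1%:R + sg) - tau))%:R =
    \sum_(i < N.+1) (Num.truncn (z i))%:R :> R.
  rewrite -{1}[m]add0n big_addn addKn big_mkord; apply: eq_bigr => i _.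
  by congr (Num.truncn (dilate f r s _ - tau))%:R; rewrite -natr1 natrD /u; ring.
have SS := strip_sum (M := M) (N := N) (m := m) tau L0 cv a0 bL e1 c0 C0 T fM r0 s0 w0 hm hn'.
rewrite -/u -/K -/W in SS.
have sr0 : 0 < s / r by rewrite divr_gt0.
pose x i := (u + i%:R) * s / r.
have xa i : a <= x i.
  have : a <= u * s / r by move: hm => /andP[+ _]; rewrite ler_pdivlMr // ler_pdivrMr.
  move=> /le_trans; apply; rewrite /x -!mulrA; apply: ler_wpM2r; [exact: ltW|by rewrite lerDl].
have xb i : (i < N.+1)%N -> x i <= b - (N.+1 - i.+1)%:R * (s / r).
  rewrite ltnS => iN.
  have h : (u + N%:R) * s / r <= b.
    by move: hn' => /andP[+ _]; rewrite ler_pdivlMr // ler_pdivrMr.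
  rewrite subSS natrB // /x.
  have -> : (u + i%:R) * s / r = (u + N%:R) * s / r - (N%:R - i%:R) * (s / r) by field; rewrite gt_eqF.
  clear -h; lra.
have xbb i : (i < N.+1)%N -> x i <= b.
  move=> iN; apply: le_trans (xb i iN) _.
  by rewrite lerBlDr lerDl mulr_ge0 // ltW.
have neg : `|\sum_(i < N.+1) (Num.truncn (z i))%:R - \sum_(i < N.+1) (Num.floor (z i))%:~R| <=
    (`|tau| + 1) * (Z0 * rho ^+ 2 + 1).
  apply: (@sum_truncn_negative _ _ tau (s ^+ 3 * kappa / r)).
  - by rewrite divr_gt0 // mulr_gt0 // exprn_gt0.
  - by apply: mulr_ge0; [clear -Z1; lra|exact: sqr_ge0].
  - move=> i iN; rewrite /z lerB // /dilate -/(x i).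
    have xi : a <= x i <= b by rewrite xa xbb.
    have -> : s ^+ 3 * kappa / r * (N.+1 - i.+1)%:R ^+ 2 =
      r * s * (kappa * ((N.+1 - i.+1)%:R * (s / r)) ^+ 2) by field; rewrite gt_eqF.
    apply: ler_wpM2l; first by rewrite mulr_ge0 // ltW.
    apply: le_trans (fkap _ xi); apply: ler_wpM2l; first exact: ltW.
    have := xb i iN => h.
    have h0 : 0 <= (N.+1 - i.+1)%:R * (s / r) by rewrite mulr_ge0 // ltW.
    by rewrite !expr2; apply: ler_pM => //; clear -h h0; lra.
  - have h1 : tau <= `|tau| + 1 by have := ler_norm tau; clear; lra.
    apply: (le_trans h1).
    have h2 : `|tau| + 1 <= s1 ^+ 3 * kappa * Z0.
      rewrite /Z0 mulrDr mulr1 [X in _ <= X + _]mulrC divfK ?gt_eqF //.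
      by rewrite lerDl ltW.
    apply: (le_trans h2).
    have -> : s ^+ 3 * kappa / r * (Z0 * rho ^+ 2) ^+ 2 = s ^+ 3 * kappa * (Z0 * Z0) * rho.
      by rewrite /r; field; rewrite gt_eqF.
    have h3 : s1 ^+ 3 <= s ^+ 3 by rewrite lerXn2r // nnegrE ltW.
    have h4 : s1 ^+ 3 * kappa <= s ^+ 3 * kappa by rewrite ler_wpM2r // ltW.
    have h5 : Z0 <= Z0 * Z0 by apply: ler_peMr => //; clear -Z1; lra.
    have h6 : s1 ^+ 3 * kappa * Z0 <= s ^+ 3 * kappa * (Z0 * Z0).
      by apply: ler_pM => //; [exact: ltW|clear -Z1; lra].
    apply: (le_trans h6); apply: ler_peMr => //; apply: mulr_ge0.
      by apply: mulr_ge0; [apply: exprn_ge0; exact: ltW|exact: ltW].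
    by apply: mulr_ge0; clear -Z1; lra.
have NE : N.+1%:R <= c3 * r.
  have h : u + N%:R <= L * r / s1.
    move: hn' => /andP[+ _] => /le_trans; apply.
    have b0 : 0 <= b by exact: le_trans (ltW ab).
    apply: ler_pM.
    - by apply: mulr_ge0 => //; exact: ltW.
    - by rewrite invr_ge0 ltW.
    - by apply: ler_wpM2r => //; exact: ltW.
    - by rewrite lef_pV2.
  rewrite /c3 mulrDl mul1r.
  have -> : L / s1 * r = L * r / s1 by ring.
  rewrite -natr1; rewrite /u in h; have m0 : 0 <= m%:R :> R by [].
  clear -h m0 sgh r1; lra.
have sawB : `|\sum_(i < N.+1) sawtooth (z i)| <= D * rho ^+ 2.
  apply: (SP rho z N.+1 eps) => //.
  move=> i iN.
  have E0 : z i = r * s * f (x i) - tau by [].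
  have E1 : z i.+1 = r * s * f (x i + s / r) - tau.
    by rewrite /z /dilate; congr (_ * f _ - _); rewrite /x -natr1; field; rewrite gt_eqF.
  have E2 : z i.+2 = r * s * f (x i + 2 * (s / r)) - tau.
    by rewrite /z /dilate; congr (_ * f _ - _); rewrite /x -addn2 natrD; field; rewrite gt_eqF.
  have xb2 : x i + 2 * (s / r) <= b.
    have := xbb _ iN; rewrite /x -addn2 natrD.
    have -> : (u + (i%:R + 2)) * s / r = (u + i%:R) * s / r + 2 * (s / r) by field; rewrite gt_eqF.
    by [].
  have /andP[h1 h2] := taylor2_second_difference T (xa i) (ltW sr0) xb2.
  rewrite E0 E1 E2.
  have -> : eps * (r * s * f (x i + 2 * (s / r)) - tau - 2 * (r * s * f (x i + s / r) - tau) +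
      (r * s * f (x i) - tau)) =
     r * s * (eps * (f (x i + 2 * (s / r)) - 2 * f (x i + s / r) + f (x i))) by ring.
  have rs0 : 0 <= r * s by rewrite mulr_ge0 // ltW.
  have q (d : R) : 2 * d * s ^+ 3 / r = r * s * (2 * d * (s / r) ^+ 2) by field; rewrite gt_eqF.
  have h3 : s1 ^+ 3 <= s ^+ 3 by rewrite lerXn2r // nnegrE ltW.
  have h4 : s ^+ 3 <= s2 ^+ 3 by rewrite lerXn2r // nnegrE ltW.
  apply/andP; split.
    apply: (@le_trans _ _ (2 * c * s ^+ 3 / r)).
      by rewrite ler_wpM2r ?invr_ge0 ?(ltW r0) // ler_wpM2l // mulr_ge0 // ltW.
    by rewrite q ler_wpM2l.
  apply: (@le_trans _ _ (2 * C * s ^+ 3 / r)).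
    by rewrite q ler_wpM2l.
  by rewrite ler_wpM2r ?invr_ge0 ?(ltW r0) // ler_wpM2l // mulr_ge0.
have FE : \sum_(i < N.+1) (Num.floor (z i))%:~R =
   \sum_(i < N.+1) (dilate f r s (u + i%:R) - tau - 1 / 2) - \sum_(i < N.+1) sawtooth (z i).
  by rewrite -sumrB; apply: eq_bigr => i _; rewrite /sawtooth /z; ring.
have SB : K * s ^+ 2 * W + N%:R * (2 * C * s ^+ 3 / r) <= K * s2 ^+ 2 * W + c3 * (2 * C * s2 ^+ 3).
  apply: lerD.
    rewrite ler_wpM2r // ler_wpM2l // !expr2; apply: ler_pM => //; exact: ltW.
  have -> : N%:R * (2 * C * s ^+ 3 / r) = N%:R / r * (2 * C * s ^+ 3) by ring.
  apply: ler_pM.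
  - by rewrite divr_ge0 // ltW.
  - by rewrite mulr_ge0 ?exprn_ge0 ?mulr_ge0 // ltW.
  - rewrite ler_pdivrMr //; apply: le_trans NE; by rewrite ler_nat.
  - by rewrite ler_wpM2l ?mulr_ge0 // lerXn2r // nnegrE ltW.
rewrite FE in neg.
set G := K * s2 ^+ 2 * W + c3 * (2 * C * s2 ^+ 3) in SB *.
have G0 : 0 <= G.
  rewrite /G; apply: addr_ge0; last by apply: mulr_ge0.
  by apply: mulr_ge0 => //; apply: mulr_ge0; rewrite ?sqr_ge0.
have G1 : G <= G * rho ^+ 2 by rewrite ler_peMr.
have Z3 : (`|tau| + 1) * (Z0 * rho ^+ 2 + 1) <= (`|tau| + 1) * (Z0 + 1) * rho ^+ 2.
  by rewrite -mulrA; apply: ler_wpM2l; [exact: ltW|clear -Z1 rho2; lra].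
set X1 := \sum_(i < N.+1) _ in neg *.
set X2 := \sum_(i < N.+1) _ in neg SS.
set X3 := \sum_(i < N.+1) _ in neg sawB.
set X4 := strip_main _ _ _ _ _ _ _ _ _ _ in SS *.
have -> : (G + D + (`|tau| + 1) * (Z0 + 1)) * rho ^+ 2 =
  G * rho ^+ 2 + D * rho ^+ 2 + (`|tau| + 1) * (Z0 + 1) * rho ^+ 2 by ring.
have {}neg := le_trans neg Z3; have {}SS := le_trans SS (le_trans SB G1).
set B1 := G * _ in SS *; set B2 := D * _ in sawB *.
set B3 := _ * (Z0 + 1) * rho ^+ 2 in neg *.
clearbody B1 B2 B3 X1 X2 X3 X4; clear -neg sawB SS.
move: neg sawB SS; rewrite !ler_norml; lra.
Qed.

End StripCount.

(** * Decomposition of the lattice count *)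

Section CountSum.

Lemma card_fset_set_nat2 (Q : nat -> nat -> bool) (P : nat) :
  (forall j k, Q j k -> [/\ (0 < j)%N, (0 < k)%N, (j <= P)%N & (k <= P)%N]) ->
  #|` fset_set [set p : nat * nat | Q p.1 p.2]|%fset =
    (\sum_(j < P) \sum_(k < P) Q j.+1 k.+1)%N.
Proof.
move=> QP; pose l := [seq p <- [seq (j, k) | j <- iota 1 P, k <- iota 1 P] | Q p.1 p.2].
have lE : [set p : nat * nat | Q p.1 p.2] = [set` l].
  apply/seteqP; split => -[j k] /=.
    move=> Qjk; rewrite mem_filter /= Qjk /=; apply/allpairsP; exists (j, k).
    by have [j0 k0 jP kP] := QP _ _ Qjk; rewrite !mem_iota !add1n !ltnS j0 k0 jP kP.
  by rewrite mem_filter => /andP[].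
have -> : fset_set [set p : nat * nat | Q p.1 p.2] = [fset x in l]%fset.
  by apply/fsetP => p; rewrite lE in_fset_set //= !inE; apply/idP/idP; rewrite ?inE.
rewrite card_fseq undup_id; last first.
  apply: filter_uniq; apply: allpairs_uniq; rewrite ?iota_uniq //.
  by move=> [? ?] [? ?].
rewrite size_filter -sum1_count big_mkcond big_allpairs /=.
have big_iota (F : nat -> nat) : (\sum_(i <- iota 1 P) F i = \sum_(i < P) F i.+1)%N.
  have -> : iota 1 P = index_iota 1 P.+1 by rewrite /index_iota subn1.
  by rewrite big_add1 big_mkord.
rewrite big_iota; apply: eq_bigr => j _; rewrite big_iota.
by apply: eq_bigr => k _; case: (Q _ _).
Qed.

Variable R : realType.

Lemma sum_truncn (z : R) (P : nat) : z < P.+1%:R ->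
  \sum_(k < P) (k.+1%:R <= z)%R%:R = (Num.truncn z)%:R :> R.
Proof.
move=> zP; have tP : (Num.truncn z <= P)%N.
  case: (ltP z 0) => z0; first by rewrite truncn_floor leNgt z0.
  by rewrite -ltnS truncn_lt_nat.
transitivity (\sum_(k < P) (k < Num.truncn z)%:R : R).
  by apply: eq_bigr => k _; rewrite truncn_gt_nat.
have -> : (Num.truncn z)%:R = \sum_(k < Num.truncn z) 1 :> R.
  by rewrite sumr_const card_ord.
rewrite (big_ord_widen _ (fun _ => 1) tP) [RHS]big_mkcond /=.
by apply: eq_bigr => k _; case: ltnP.
Qed.

Lemma sum_ord_window (c : nat -> R) (m n P : nat) : (n <= P)%N ->
  \sum_(i < P) ((m <= i) && (i < n))%N%:R * c i = \sum_(m <= i < n) c i.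
Proof.
move=> nP; rewrite (big_nat_widenl m 0) // big_mkord.
rewrite (big_ord_widen_cond _ (fun i => true && (m <= i)%N) c nP) [RHS]big_mkcond /=.
by apply: eq_bigr => i _; case: (m <= i)%N; case: (i < n)%N; rewrite /= ?mul1r ?mul0r.
Qed.

Section Count.
Variables (L : R) (f g : R -> R) (sg tau r s : R).
Hypothesis L_gt0 : 0 < L.
Hypothesis curve : decreasing_curve L f g.
Hypothesis sg_gt : - (1 / 2) < sg.
Hypothesis tau_gt : - (1 / 2) < tau.
Hypothesis r_gt0 : 0 < r.
Hypothesis s_gt0 : 0 < s.

Let x (j : nat) := (j.+1%:R + sg) * s / r.
Let y (k : nat) := (k.+1%:R + tau) * s^-1 / r.
Let inside (j k : nat) := (x j <= L) && (k.+1%:R + tau <= dilate f r s (j.+1%:R + sg)).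

Let x_gt0 j : 0 < x j.
Proof.
have h := sg_gt; have : 1 <= j.+1%:R :> R by rewrite ler1n.
by move=> j1; rewrite /x divr_gt0 // mulr_gt0 //; lra.
Qed.

Let y_gt0 j : 0 < y j.
Proof.
have h := tau_gt; have : 1 <= j.+1%:R :> R by rewrite ler1n.
by move=> j1; rewrite /y divr_gt0 // mulr_gt0 ?invr_gt0 //; lra.
Qed.

Let insideE j k : inside j k = [&& x j <= L, y k <= L & y k <= f (x j)].
Proof.
rewrite /inside; case: (leP (x j) L) => //= xL.
have -> : (k.+1%:R + tau <= dilate f r s (j.+1%:R + sg)) = (y k <= f (x j)).
  rewrite /dilate -/(x j) /y.
  have -> : (k.+1%:R + tau) * s^-1 / r = (k.+1%:R + tau) / (r * s).
    by rewrite invfM; ring.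
  by rewrite ler_pdivrMr ?mulr_gt0 // mulrC.
have /andP[_ fL] : 0 <= f (x j) <= L.
  by apply: (curve_range curve); rewrite xL ltW // x_gt0.
by case: (leP (y k) (f (x j))) => h; rewrite ?andbT ?andbF // (le_trans h).
Qed.

Let inside_row j k : inside j k =
  [&& y k <= L & j.+1%:R + sg <= dilate g r s^-1 (k.+1%:R + tau)].
Proof.
rewrite insideE andbCA; case: (leP (y k) L) => //= yL.
have -> : (j.+1%:R + sg <= dilate g r s^-1 (k.+1%:R + tau)) = (x j <= g (y k)).
  rewrite /dilate -/(y k) /x.
  have -> : (j.+1%:R + sg) * s / r = (j.+1%:R + sg) / (r * s^-1).
    by rewrite invfM invrK; ring.
  by rewrite ler_pdivrMr ?mulr_gt0 ?invr_gt0 // mulrC.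
have yL' : 0 <= y k <= L by rewrite yL ltW // y_gt0.
have /andP[_ gL] := curve_grange curve yL'.
case: (leP (x j) L) => xL /=; last first.
  by apply/esym/negbTE; rewrite -ltNge (le_lt_trans gL).
by rewrite (curve_le_swap L_gt0 curve) // xL ltW // x_gt0.
Qed.

Variable P : nat.
Hypothesis Pr : L * r / s + 1 <= P%:R.
Hypothesis Ps : L * r * s + 1 <= P%:R.

Let inside_bound j k : inside j k -> (j < P)%N /\ (k < P)%N.
Proof.
have h1 := Pr; have h2 := Ps; have h3 := sg_gt; have h4 := tau_gt.
rewrite insideE => /and3P[xL yL _]; split; rewrite -(ltr_nat R).
  move: xL; rewrite /x ler_pdivrMr // -ler_pdivlMr // -natr1; lra.
move: yL; rewrite /y ler_pdivrMr // ler_pdivrMr // -natr1; lra.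
Qed.

Lemma lattice_countE :
  (lattice_count L f sg tau r s)%:R = \sum_(j < P) \sum_(k < P) (inside j k)%:R :> R.
Proof.
pose Q j k := [&& (0 < j)%N, (0 < k)%N & inside j.-1 k.-1].
have -> : lattice_count L f sg tau r s = #|` fset_set [set p : nat * nat | Q p.1 p.2]|%fset.
  rewrite /lattice_count; congr (#|` fset_set _|%fset); apply/seteqP; split => -[j k] /=.
    by move=> [j0 k0 h1 h2]; rewrite /Q j0 k0 /inside /x !prednK // h1 h2.
  rewrite /Q => /and3P[j0 k0 /andP[]]; rewrite /x !prednK // => h1 h2; by split.
rewrite (@card_fset_set_nat2 Q P).
  rewrite natr_sum; apply: eq_bigr => j _; rewrite natr_sum; by apply: eq_bigr.
move=> j k /and3P[j0 k0 /inside_bound[]]; rewrite !prednK // => jP kP; by split.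
Qed.

Let col_count j : x j <= L ->
  \sum_(k < P) (inside j k)%:R = (Num.truncn (dilate f r s (j.+1%:R + sg) - tau))%:R :> R.
Proof.
move=> xL; rewrite -(sum_truncn (P := P)).
  by apply: eq_bigr => k _; rewrite /inside xL /= lerBrDr.
have h2 := Ps; have h4 := tau_gt.
have /andP[_ fL] : 0 <= f (x j) <= L.
  by apply: (curve_range curve); rewrite xL ltW // x_gt0.
have : dilate f r s (j.+1%:R + sg) <= r * s * L.
  by rewrite /dilate ler_wpM2l // mulr_ge0 // ltW.
rewrite -natr1; lra.
Qed.

Let row_count k : y k <= L ->
  \sum_(j < P) (inside j k)%:R = (Num.truncn (dilate g r s^-1 (k.+1%:R + tau) - sg))%:R :> R.
Proof.
move=> yL; rewrite -(sum_truncn (P := P)).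
  by apply: eq_bigr => j _; rewrite inside_row yL /= lerBrDr.
have h2 := Pr; have h4 := sg_gt.
have /andP[_ fL] : 0 <= g (y k) <= L.
  by apply: (curve_grange curve); rewrite yL ltW // y_gt0.
have : dilate g r s^-1 (k.+1%:R + tau) <= r * s^-1 * L.
  by rewrite /dilate ler_wpM2l // mulr_ge0 ?invr_ge0 // ltW.
rewrite -natr1; lra.
Qed.

Variable alpha : R.
Hypothesis alphaL : 0 < alpha <= L.
Let beta := f alpha.

Let J := Num.truncn (alpha * r / s - sg).
Let K := Num.truncn (beta * r * s - tau).

Let x_le (t : R) j : (j < Num.truncn (t * r / s - sg))%N = (x j <= t).
Proof.
by rewrite truncn_gt_nat lerBrDr ler_pdivlMr // /x ler_pdivrMr.
Qed.

Let y_le (t : R) k : (k < Num.truncn (t * r * s - tau))%N = (y k <= t).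
Proof.
by rewrite truncn_gt_nat lerBrDr /y !ler_pdivrMr // mulrAC.
Qed.

Let betaL : 0 <= beta <= L.
Proof. by apply: (curve_range curve); case/andP: alphaL => /ltW -> ->. Qed.

Let tr_le (t : R) : t <= L -> (Num.truncn (t * r / s - sg) <= P)%N.
Proof.
move=> tL; have h1 := Pr; have h2 := sg_gt.
rewrite leqNgt truncn_gt_nat -ltNge.
have : t * r / s <= L * r / s.
  by rewrite -!mulrA ler_wpM2r // divr_ge0 // ltW.
rewrite -natr1; lra.
Qed.

Let trs_le (t : R) : t <= L -> (Num.truncn (t * r * s - tau) <= P)%N.
Proof.
move=> tL; have h1 := Ps; have h2 := tau_gt.
rewrite leqNgt truncn_gt_nat -ltNge.
have : t * r * s <= L * r * s.
  by rewrite -!mulrA ler_wpM2r // mulr_ge0 // ltW.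
rewrite -natr1; lra.
Qed.

Let fx_beta j : x j <= L -> (x j <= alpha) = (beta <= f (x j)).
Proof.
move=> xL; have /andP[a0 aL] := alphaL; have x0 := x_gt0 j.
apply/idP/idP => [h|h]; first by apply: (curve_le curve) => //; exact: ltW.
rewrite leNgt; apply/negP => k.
by have := curve_lt curve (ltW a0) k xL; rewrite ltNge h.
Qed.

Let box : \sum_(j < P) \sum_(k < P) ((j < J)%N && (k < K)%N)%:R = J%:R * K%:R :> R.
Proof.
have /andP[a0 aL] := alphaL; have /andP[b0 bL] := betaL.
have cnt n : (n <= P)%N -> \sum_(j < P) (j < n)%N%:R = n%:R :> R.
  move=> nP; have := sum_ord_window (fun=> 1) 0 nP.
  by under eq_bigr do rewrite leq0n /= mulr1; rewrite sumr_const_nat subn0.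
rewrite -(cnt J) ?tr_le // -(cnt K) ?trs_le // mulr_suml.
apply: eq_bigr => j _; rewrite mulr_sumr; apply: eq_bigr => k _.
by rewrite -natrM mulnb.
Qed.

Let cols m n : n = Num.truncn (alpha * r / s - sg) \/ n = Num.truncn (L * r / s - sg) ->
  \sum_(j < P) \sum_(k < P) (((m <= j) && (j < n))%N && inside j k)%:R =
  \sum_(m <= j < n) (Num.truncn (dilate f r s (j.+1%:R + sg) - tau))%:R :> R.
Proof.
move=> nE; have /andP[a0 aL] := alphaL.
have [t tL nt] : exists2 t, t <= L & n = Num.truncn (t * r / s - sg).
  by case: nE; [exists alpha|exists L].
rewrite -(@sum_ord_window _ m n P); last by rewrite nt tr_le.
apply: eq_bigr => j _; case: (boolP ((m <= j) && (j < n))%N) => /= jn; last first.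
  by rewrite mul0r big1.
rewrite mul1r col_count //; move: jn => /andP[_]; rewrite nt x_le => /le_trans; exact.
Qed.

Let rows m n : n = Num.truncn (beta * r * s - tau) \/ n = Num.truncn (L * r * s - tau) ->
  \sum_(j < P) \sum_(k < P) (((m <= k) && (k < n))%N && inside j k)%:R =
  \sum_(m <= k < n) (Num.truncn (dilate g r s^-1 (k.+1%:R + tau) - sg))%:R :> R.
Proof.
move=> nE; have /andP[b0 bL] := betaL.
have [t tL nt] : exists2 t, t <= L & n = Num.truncn (t * r * s - tau).
  by case: nE; [exists beta|exists L].
rewrite exchange_big /= -(@sum_ord_window _ m n P); last by rewrite nt trs_le.
apply: eq_bigr => k _; case: (boolP ((m <= k) && (k < n))%N) => /= kn; last first.
  by rewrite mul0r big1.
rewrite mul1r row_count //; move: kn => /andP[_]; rewrite nt y_le => /le_trans; exact.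
Qed.

(** Lattice points below the curve lie left of [alpha] or below [f alpha],
    and the whole rectangle is below the curve: inclusion--exclusion. *)
Lemma lattice_count_inner :
  (lattice_count L f sg tau r s)%:R =
    \sum_(0 <= j < J) (Num.truncn (dilate f r s (j.+1%:R + sg) - tau))%:R
  + \sum_(0 <= k < K) (Num.truncn (dilate g r s^-1 (k.+1%:R + tau) - sg))%:R
  - J%:R * K%:R :> R.
Proof.
have /andP[a0 aL] := alphaL; have /andP[b0 bL] := betaL.
rewrite -box -cols; last by left.
rewrite -rows; last by left.
rewrite -big_split -sumrB lattice_countE; apply: eq_bigr => j _ /=.
rewrite -big_split -sumrB; apply: eq_bigr => k _ /=.
rewrite ?leq0n /= /J /K x_le y_le insideE.
case: (leP (x j) L) => xL; last first.
  have -> : (x j <= alpha) = false by apply/negbTE; rewrite -ltNge; lra.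
  by rewrite !andbF /= addr0 subr0.
rewrite (fx_beta xL) /=.
case: (leP beta (f (x j))) => h1; case: (leP (y k) beta) => h2 /=.
- by rewrite (le_trans h2 bL) (le_trans h2 h1) /= addrK.
- by rewrite addr0 subr0.
- by rewrite add0r subr0.
- have -> : (y k <= f (x j)) = false by apply/negbTE; rewrite -ltNge; lra.
  by rewrite andbF addr0 subr0.
Qed.

(** The dual decomposition: the rectangle, the columns to its right and the
    rows above it are disjoint and exhaust the region. *)
Lemma lattice_count_outer :
  (lattice_count L f sg tau r s)%:R =
    \sum_(J <= j < Num.truncn (L * r / s - sg))
       (Num.truncn (dilate f r s (j.+1%:R + sg) - tau))%:R
  + \sum_(K <= k < Num.truncn (L * r * s - tau))
       (Num.truncn (dilate g r s^-1 (k.+1%:R + tau) - sg))%:R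
  + J%:R * K%:R :> R.
Proof.
have /andP[a0 aL] := alphaL; have /andP[b0 bL] := betaL.
rewrite -box -cols; last by right.
rewrite -rows; last by right.
rewrite -!big_split lattice_countE; apply: eq_bigr => j _ /=.
rewrite -!big_split; apply: eq_bigr => k _ /=.
rewrite ![(J <= _)%N]leqNgt ![(K <= _)%N]leqNgt /J /K !x_le !y_le insideE.
case: (leP (x j) L) => xL; last first.
  have -> : (x j <= alpha) = false by apply/negbTE; rewrite -ltNge; lra.
  by rewrite !andbF /= !addr0.
rewrite (fx_beta xL) /=.
case: (leP beta (f (x j))) => h1; case: (leP (y k) beta) => h2 /=.
- by rewrite (le_trans h2 bL) (le_trans h2 h1) /= !add0r.
- by rewrite addr0 add0r; case: (y k <= L).
- by rewrite !addr0.
- have -> : (y k <= f (x j)) = false by apply/negbTE; rewrite -ltNge; lra.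
  by rewrite !andbF !addr0.
Qed.

End Count.
End CountSum.

(** * Asymptotics for bounded stretch factors *)

Section Asymptotics.
Variable R : realType.
Implicit Types (L sg tau alpha beta r s rho eps : R) (f g : R -> R).

(** The lattice points miss a strip of width [sg + 1/2] along the vertical axis,
    where the dilated curve has height [r s L], and one of width [tau + 1/2]
    along the horizontal axis, of length [r L / s]. *)
Definition count_main L f sg tau r s : R :=
  r ^+ 2 * area L f - r * L * (s * (sg + 1 / 2) + (tau + 1 / 2) / s).

(** The dilation factor is [rho ^+ 3], which turns the error [O(r^(2/3))] into a
    polynomial one. *)
Definition uniform_asymptotics L f sg tau := forall s1 s2 : R, 0 < s1 -> s1 <= s2 ->
  exists C rho0 : R, [/\ 0 <= C, 1 <= rho0 & forall rho s,
    rho0 <= rho -> s1 <= s <= s2 ->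
    `|(lattice_count L f sg tau (rho ^+ 3) s)%:R - count_main L f sg tau (rho ^+ 3) s|
       <= C * rho ^+ 2].

Lemma exprn3_ge rho : 1 <= rho -> rho <= rho ^+ 3.
Proof. by move=> r1; rewrite exprS ler_peMr ?exprn_ege1 //; lra. Qed.

(** What remains of the strips and the rectangle once their terms of order [r]
    have cancelled: it only involves the fractional parts [th] and [ph] of the
    sides of the rectangle, hence is bounded. *)
Lemma residue_inner (p q th ph : R) : 0 <= th < 1 -> 0 <= ph < 1 ->
  `|(q + 1 / 2) * (p + th) + (p + 1 / 2) * (q + ph) - (p + th) * (q + ph)|
    <= 3 * ((`|p| + 1) * (`|q| + 1)).
Proof.
move=> th01 ph01.
have hp : `|p + 1 / 2| <= `|p| + 1.
  by apply: (le_trans (ler_normD _ _)); rewrite lerD2l ger0_norm; lra.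
have hq : `|q + 1 / 2| <= `|q| + 1.
  by apply: (le_trans (ler_normD _ _)); rewrite lerD2l ger0_norm; lra.
have hp' : `|p + th| <= `|p| + 1.
  by apply: (le_trans (ler_normD _ _)); rewrite lerD2l ger0_norm; lra.
have hq' : `|q + ph| <= `|q| + 1.
  by apply: (le_trans (ler_normD _ _)); rewrite lerD2l ger0_norm; lra.
apply: (le_trans (ler_normB _ _)).
have h1 : `|(p + th) * (q + ph)| <= (`|p| + 1) * (`|q| + 1) by rewrite normrM ler_pM.
have h2 : `|(q + 1 / 2) * (p + th)| <= (`|p| + 1) * (`|q| + 1) by rewrite mulrC normrM ler_pM.
have h3 : `|(p + 1 / 2) * (q + ph)| <= (`|p| + 1) * (`|q| + 1) by rewrite normrM ler_pM.
have := ler_normD ((q + 1 / 2) * (p + th)) ((p + 1 / 2) * (q + ph)); lra.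
Qed.

(** As in [residue_inner]; [th'] and [ph'] come from the ends of the curve on the
    axes. *)
Lemma residue_outer (p q th ph th' ph' : R) :
  0 <= th < 1 -> 0 <= ph < 1 -> 0 <= th' < 1 -> 0 <= ph' < 1 ->
  `|(q + 1 / 2) * (th' - th) + (p + 1 / 2) * (ph' - ph) + (p + th) * (q + ph)|
    <= 3 * ((`|p| + 1) * (`|q| + 1)).
Proof.
move=> th01 ph01 th01' ph01'.
have p0 := normr_ge0 p; have q0 := normr_ge0 q.
have hp : `|p + 1 / 2| <= `|p| + 1.
  by apply: (le_trans (ler_normD _ _)); rewrite lerD2l ger0_norm; lra.
have hq : `|q + 1 / 2| <= `|q| + 1.
  by apply: (le_trans (ler_normD _ _)); rewrite lerD2l ger0_norm; lra.
have hp' : `|p + th| <= `|p| + 1.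
  by apply: (le_trans (ler_normD _ _)); rewrite lerD2l ger0_norm; lra.
have hq' : `|q + ph| <= `|q| + 1.
  by apply: (le_trans (ler_normD _ _)); rewrite lerD2l ger0_norm; lra.
have ht : `|th' - th| <= `|p| + 1 by rewrite ler_norml; lra.
have hf : `|ph' - ph| <= `|q| + 1 by rewrite ler_norml; lra.
have h1 : `|(p + th) * (q + ph)| <= (`|p| + 1) * (`|q| + 1) by rewrite normrM ler_pM.
have h2 : `|(q + 1 / 2) * (th' - th)| <= (`|p| + 1) * (`|q| + 1) by rewrite mulrC normrM ler_pM.
have h3 : `|(p + 1 / 2) * (ph' - ph)| <= (`|p| + 1) * (`|q| + 1) by rewrite normrM ler_pM.
apply: (le_trans (ler_normD _ _)).
have := ler_normD ((q + 1 / 2) * (th' - th)) ((p + 1 / 2) * (ph' - ph)); lra.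
Qed.

(** At [L] the curve vanishes with nonpositive slope, so its curvature alone lifts
    it above a parabola. *)
Lemma convex_piece_ge L f g alpha : 0 < L -> decreasing_curve L f g ->
  0 < alpha -> alpha < L -> curved_piece 1 alpha L f ->
  exists2 kappa, 0 < kappa & forall x, alpha <= x <= L -> kappa * (L - x) ^+ 2 <= f x.
Proof.
move=> L0 cv a0 aL [f1 [c [C [M [c0 C0 T _]]]]].
exists c => // x xL.
have LL : alpha <= L <= L by lra.
have fx0 y : alpha <= y <= L -> 0 <= f y.
  by move=> yL; have /andP[] : 0 <= f y <= L by apply: (curve_range cv); lra.
have f1L : f1 L <= 0.
  rewrite leNgt; apply/negP => p.
  pose d := Num.min (L - alpha) (f1 L / (2 * (C + 1))).
  have d0 : 0 < d by rewrite lt_min subr_gt0 aL divr_gt0 // mulr_gt0 //; lra.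
  have d1 : d <= L - alpha by rewrite ge_min lexx.
  have d2 : d * (2 * (C + 1)) <= f1 L.
    by rewrite -ler_pdivlMr ?mulr_gt0 //; [rewrite ge_min lexx orbT|lra].
  have yL : alpha <= L - d <= L by lra.
  have /andP[_] := T L (L - d) LL yL.
  have := fx0 _ yL; rewrite (curve_atL L0 cv).
  have -> : L - d - L = - d by ring.
  rewrite sqrrN expr2 => h1 h2.
  have : f1 L * d <= C * d * d by lra.
  by rewrite ler_pM2r //; nra.
have /andP[+ _] := T L x LL xL; rewrite (curve_atL L0 cv) mul1r subr0.
have -> : (x - L) ^+ 2 = (L - x) ^+ 2 by ring.
have : 0 <= f1 L * (x - L) by nra.
lra.
Qed.

Lemma truncn_gap (x : R) : 0 <= x -> 0 <= x - (Num.truncn x)%:R < 1.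
Proof.
move=> x0; have /andP[h1 h2] := truncn_itv x0; rewrite -natr1 in h2; lra.
Qed.

Lemma truncn_scaled_gap (t sh r s : R) : 0 < s -> sh <= t * r / s ->
  let n := (Num.truncn (t * r / s - sh))%:R in
  n + sh <= t * r / s < n + sh + 1 /\ 0 <= t * r / s - sh - n < 1.
Proof.
move=> s0 h /=; have := @truncn_gap (t * r / s - sh); rewrite subr_ge0 => /(_ h).
by set n := _%:R; move=> h2; split; lra.
Qed.

Lemma scaled_ge (t T r s s2 : R) : 0 < t -> 0 < s -> s <= s2 -> 0 <= T ->
  T * s2 / t <= r -> T <= t * r / s.
Proof.
move=> t0 s0 ss2 T0; rewrite ler_pdivrMr // => h.
rewrite ler_pdivlMr //; apply: (le_trans (ler_wpM2l T0 ss2)).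
by rewrite [t * r]mulrC.
Qed.

(** The main terms of the two strips and of the rectangle combine by Young's
    identity: the areas add up to the area under the curve and the corrections
    at the common corner [(alpha, f alpha)] cancel up to a bounded residue. *)
Lemma lattice_count_inner_asymptotic L f g sg tau alpha eps :
  0 < L -> decreasing_curve L f g -> - (1 / 2) < sg -> - (1 / 2) < tau ->
  0 < alpha < L -> eps = 1 \/ eps = -1 ->
  curved_piece eps 0 alpha f -> curved_piece eps 0 (f alpha) g ->
  uniform_asymptotics L f sg tau.
Proof.
move=> L0 cv sgh tauh /andP[a0 aL] e1 Pf Pg s1 s2 s10 s12.
have s20 : 0 < s2 by lra.
have aL' : 0 <= alpha <= L by lra.
have cg := curve_swap L0 cv.
set beta := f alpha in Pg *.
have b0 : 0 < beta by rewrite -(curve_atL L0 cv); apply: (curve_lt cv); lra.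
have bL : beta < L by rewrite -[ltRHS](curve_at0 L0 cv); apply: (curve_lt cv); lra.
have gb : g beta = alpha by rewrite (curve_gf cv).
(* left of the corner the height is bounded below, all the more by a parabola *)
have lower h (t u : R) (h' : R -> R) : decreasing_curve L h h' -> 0 < t -> t <= L -> u = h t -> 0 < u ->
    forall x, 0 <= x <= t -> u / t ^+ 2 * (t - x) ^+ 2 <= h x.
  move=> ch t0 tL uE u0 x /andP[x0 xt]; have := curve_le ch x0 xt tL.
  rewrite -uE => /(le_trans _); apply.
  have t2 : 0 < t ^+ 2 by rewrite exprn_gt0.
  rewrite mulrAC ler_pdivrMr // ler_pM2l // !expr2; apply: ler_pM; lra.
have kf : 0 < beta / alpha ^+ 2 by rewrite divr_gt0 // exprn_gt0.
have kg : 0 < alpha / beta ^+ 2 by rewrite divr_gt0 // exprn_gt0.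
have w0 : 0 <= 1 + `|sg| + `|tau| by have := normr_ge0 sg; have := normr_ge0 tau; lra.
have [C1 [rho1 [C10 rho11 S1]]] := strip_count tau L0 cv (lexx 0) a0 (ltW aL) e1 Pf kf
  (lower _ _ _ _ cv a0 (ltW aL) (erefl _) b0) sgh s10 s12 w0.
have v1 : 0 < s2^-1 by rewrite invr_gt0.
have v2 : s2^-1 <= s1^-1 by rewrite lef_pV2.
have [C2 [rho2 [C20 rho21 S2]]] := strip_count sg L0 cg (lexx 0) b0 (ltW bL) e1 Pg kg
  (lower _ _ _ _ cg b0 (ltW bL) (esym gb) a0) tauh v1 v2 w0.
(* thresholds beyond which the rectangle contains a column and a row *)
pose T1 := (`|sg| + 1) * s2 / alpha; pose T2 := (`|tau| + 1) * s1^-1 / beta.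
have T10 : 0 <= T1 by rewrite divr_ge0 ?mulr_ge0 ?addr_ge0 // ltW.
have T20 : 0 <= T2 by rewrite divr_ge0 ?mulr_ge0 ?addr_ge0 ?invr_ge0 // ltW.
have Q0 : 0 <= 3 * ((`|sg| + 1) * (`|tau| + 1)) by rewrite !mulr_ge0 ?addr_ge0.
exists (C1 + C2 + 3 * ((`|sg| + 1) * (`|tau| + 1))), (rho1 + rho2 + T1 + T2); split.
- by clear -C10 C20 Q0; lra.
- by clear -rho11 rho21 T10 T20; lra.
move=> rho s rr ss.
have s0 : 0 < s by clear -ss s10; lra.
have sL : s <= s2 by clear -ss; lra.
have [rho1' rr1 rr2] : [/\ 1 <= rho, rho1 <= rho & rho2 <= rho].
  by clear -rr rho11 rho21 T10 T20; split; lra.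
have r1 := exprn3_ge rho1'.
have [r rE] : exists r : R, rho ^+ 3 = r by exists (rho ^+ 3).
rewrite rE in r1 *.
have r0 : 0 < r by clear -r1 rho1'; lra.
have [q1 q2] : T1 <= r /\ T2 <= r.
  by clear -rr r1 rho11 rho21 T10 T20; split; lra.
have sg1 := ler_norm sg; have tau1 := ler_norm tau.
have sgn := normr_ge0 sg; have taun := normr_ge0 tau.
have sgp : 0 <= `|sg| + 1 by clear -sgn; lra.
have taup : 0 <= `|tau| + 1 by clear -taun; lra.
have si : s^-1 <= s1^-1 by rewrite lef_pV2 ?posrE //; clear -ss s10; lra.
have si2 : s2^-1 <= s^-1 by rewrite lef_pV2 ?posrE //.
have s0' : 0 < s^-1 by rewrite invr_gt0.
have hJ : sg + 1 <= alpha * r / s.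
  by have := scaled_ge a0 s0 sL sgp q1; clear -sg1; lra.
have hK : tau + 1 <= beta * r / s^-1.
  by have := scaled_ge b0 s0' si taup q2; clear -tau1; lra.
have hJ' : sg <= alpha * r / s by clear -hJ; lra.
have hK' : tau <= beta * r / s^-1 by clear -hK; lra.
have [J1 J2] := truncn_scaled_gap s0 hJ'.
have [K1 K2] := truncn_scaled_gap s0' hK'.
rewrite invrK in K1 K2.
have aL2 : 0 < alpha <= L by rewrite a0 ltW.
pose P := (Num.truncn (L * r / s + 1 + (L * r * s + 1))).+1.
have Lr : 0 <= L * r / s by rewrite divr_ge0 ?mulr_ge0 // ltW.
have Lr2 : 0 <= L * r * s by rewrite !mulr_ge0 // ltW.
have [P1 P2] : L * r / s + 1 <= P%:R /\ L * r * s + 1 <= P%:R.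
  have /andP[_ +] := truncn_itv (addr_ge0 (addr_ge0 Lr ler01) (addr_ge0 Lr2 ler01)).
  by rewrite -/P; clear -Lr Lr2; split; lra.
rewrite (lattice_count_inner L0 cv sgh tauh r0 s0 P1 P2 aL2) -/beta.
set J := Num.truncn (alpha * r / s - sg) in J1 J2 *.
set K := Num.truncn (beta * r * s - tau) in K1 K2 *.
have J0 : (0 < J)%N by rewrite truncn_gt0; clear -hJ; lra.
have K0 : (0 < K)%N by rewrite truncn_gt0; rewrite invrK in hK; clear -hK; lra.
have ss' : s2^-1 <= s^-1 <= s1^-1 by rewrite si si2.
have H1 := S1 rho s 0%N J rr1 ss J0.
rewrite rE !mul0r !add0r in H1.
have H2 := S2 rho s^-1 0%N K rr2 ss' K0.
rewrite rE !mul0r !add0r invrK in H2.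
have c1 : 0 <= 1 + sg <= 1 + `|sg| + `|tau| by clear -sgh sg1 taun; lra.
have c2 : 0 <= 1 + tau <= 1 + `|sg| + `|tau| by clear -tauh tau1 sgn; lra.
have {}H1 := H1 c1 J1; have {}H2 := H2 c2 K1.
have Y := young L0 cv aL'.
rewrite -/beta -[RHS]/(area L g) (area_swap L0 cv) in Y.
have E : strip_main L f sg tau 0 alpha r s 0 J + strip_main L g tau sg 0 beta r s^-1 0 K
    - J%:R * K%:R - count_main L f sg tau r s =
  (tau + 1 / 2) * (sg + (alpha * r / s - sg - J%:R))
  + (sg + 1 / 2) * (tau + (beta * r * s - tau - K%:R))
  - (sg + (alpha * r / s - sg - J%:R)) * (tau + (beta * r * s - tau - K%:R)).
  rewrite /strip_main /count_main -Y !prim0 (curve_at0 L0 cv) (curve_at0 L0 cg) gb -/beta.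
  clear -s0; field; by rewrite gt_eqF.
have RB := residue_inner sg tau J2 K2.
rewrite -E in RB.
have rhosq : 1 <= rho ^+ 2 by rewrite exprn_ege1.
have QB : 3 * ((`|sg| + 1) * (`|tau| + 1)) <= 3 * ((`|sg| + 1) * (`|tau| + 1)) * rho ^+ 2.
  by rewrite ler_peMr.
have {}RB := le_trans RB QB.
set X1 := \sum_(0 <= j < J) _ in H1 *; set X2 := \sum_(0 <= j < K) _ in H2 *.
set m1 := strip_main _ _ _ _ _ _ _ _ _ _ in H1 RB.
set m2 := strip_main _ _ _ _ _ _ _ _ _ _ in H2 RB.
set jk := J%:R * K%:R in RB *; set cm := count_main _ _ _ _ _ _ in RB *.
set q := 3 * _ in RB *.
clearbody X1 X2 m1 m2 jk cm q; clear -H1 H2 RB.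
move: H1 H2 RB; rewrite !ler_norml; lra.
Qed.

Lemma lattice_count_outer_asymptotic L f g sg tau alpha :
  0 < L -> decreasing_curve L f g -> - (1 / 2) < sg -> - (1 / 2) < tau ->
  0 < alpha < L ->
  curved_piece 1 alpha L f -> curved_piece 1 (f alpha) L g ->
  uniform_asymptotics L f sg tau.
Proof.
move=> L0 cv sgh tauh /andP[a0 aL] Pf Pg s1 s2 s10 s12.
have s20 : 0 < s2 by lra.
have aL' : 0 <= alpha <= L by lra.
have cg := curve_swap L0 cv.
set beta := f alpha in Pg *.
have b0 : 0 < beta by rewrite -(curve_atL L0 cv); apply: (curve_lt cv); lra.
have bL : beta < L by rewrite -[ltRHS](curve_at0 L0 cv); apply: (curve_lt cv); lra.
have gb : g beta = alpha by rewrite (curve_gf cv).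
have [kapf kf0 kfP] := convex_piece_ge L0 cv a0 aL Pf.
have [kapg kg0 kgP] := convex_piece_ge L0 cg b0 bL Pg.
have e1 : (1 : R) = 1 \/ (1 : R) = -1 by left.
have [C1 [rho1 [C10 rho11 S1]]] := strip_count tau L0 cv (ltW a0) aL (lexx L) e1 Pf kf0
  kfP sgh s10 s12 ler01.
have v1 : 0 < s2^-1 by rewrite invr_gt0.
have v2 : s2^-1 <= s1^-1 by rewrite lef_pV2.
have [C2 [rho2 [C20 rho21 S2]]] := strip_count sg L0 cg (ltW b0) bL (lexx L) e1 Pg kg0
  kgP tauh v1 v2 ler01.
pose T1 := (`|sg| + 1) * s2 / alpha; pose T2 := (`|tau| + 1) * s1^-1 / beta.
(* beyond these there is a column right of the rectangle and a row above it *)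
pose T3 := 2 * s2 / (L - alpha); pose T4 := 2 * s1^-1 / (L - beta).
have T10 : 0 <= T1 by rewrite divr_ge0 ?mulr_ge0 ?addr_ge0 // ltW.
have T20 : 0 <= T2 by rewrite divr_ge0 ?mulr_ge0 ?addr_ge0 ?invr_ge0 // ltW.
have La : 0 < L - alpha by lra.
have Lb : 0 < L - beta by lra.
have T30 : 0 <= T3 by rewrite divr_ge0 ?mulr_ge0 // ltW.
have T40 : 0 <= T4 by rewrite divr_ge0 ?mulr_ge0 ?invr_ge0 // ltW.
have Q0 : 0 <= 3 * ((`|sg| + 1) * (`|tau| + 1)) by rewrite !mulr_ge0 ?addr_ge0.
exists (C1 + C2 + 3 * ((`|sg| + 1) * (`|tau| + 1))), (rho1 + rho2 + T1 + T2 + T3 + T4); split.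
- by clear -C10 C20 Q0; lra.
- by clear -rho11 rho21 T10 T20 T30 T40; lra.
move=> rho s rr ss.
have s0 : 0 < s by clear -ss s10; lra.
have sL : s <= s2 by clear -ss; lra.
have [rho1' rr1 rr2] : [/\ 1 <= rho, rho1 <= rho & rho2 <= rho].
  by clear -rr rho11 rho21 T10 T20 T30 T40; split; lra.
have r1 := exprn3_ge rho1'.
have [r rE] : exists r : R, rho ^+ 3 = r by exists (rho ^+ 3).
rewrite rE in r1 *.
have r0 : 0 < r by clear -r1 rho1'; lra.
have [q1 q2 q3 q4] : [/\ T1 <= r, T2 <= r, T3 <= r & T4 <= r].
  by clear -rr r1 rho11 rho21 T10 T20 T30 T40; split; lra.
have sg1 := ler_norm sg; have tau1 := ler_norm tau.
have sgn := normr_ge0 sg; have taun := normr_ge0 tau.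
have sgp : 0 <= `|sg| + 1 by clear -sgn; lra.
have taup : 0 <= `|tau| + 1 by clear -taun; lra.
have si : s^-1 <= s1^-1 by rewrite lef_pV2 ?posrE //; clear -ss s10; lra.
have si2 : s2^-1 <= s^-1 by rewrite lef_pV2 ?posrE //.
have s0' : 0 < s^-1 by rewrite invr_gt0.
have hJ : sg <= alpha * r / s.
  by have := scaled_ge a0 s0 sL sgp q1; clear -sg1; lra.
have hK : tau <= beta * r / s^-1.
  by have := scaled_ge b0 s0' si taup q2; clear -tau1; lra.
have hJn : alpha * r / s + 2 <= L * r / s.
  by have := scaled_ge La s0 sL (ler0n R 2) q3; clear; lra.
have hKn : beta * r / s^-1 + 2 <= L * r / s^-1.
  by have := scaled_ge Lb s0' si (ler0n R 2) q4; clear; lra.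
have hJL : sg <= L * r / s by clear -hJ hJn; lra.
have hKL : tau <= L * r / s^-1 by clear -hK hKn; lra.
have [J1 J2] := truncn_scaled_gap s0 hJ.
have [K1 K2] := truncn_scaled_gap s0' hK.
have [J3 J4] := truncn_scaled_gap s0 hJL.
have [K3 K4] := truncn_scaled_gap s0' hKL.
rewrite invrK in K1 K2 K3 K4 hK hKn.
have aL2 : 0 < alpha <= L by rewrite a0 ltW.
pose P := (Num.truncn (L * r / s + 1 + (L * r * s + 1))).+1.
have Lr : 0 <= L * r / s by rewrite divr_ge0 ?mulr_ge0 // ltW.
have Lr2 : 0 <= L * r * s by rewrite !mulr_ge0 // ltW.
have [P1 P2] : L * r / s + 1 <= P%:R /\ L * r * s + 1 <= P%:R.
  have /andP[_ +] := truncn_itv (addr_ge0 (addr_ge0 Lr ler01) (addr_ge0 Lr2 ler01)).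
  by rewrite -/P; clear -Lr Lr2; split; lra.
rewrite (lattice_count_outer L0 cv sgh tauh r0 s0 P1 P2 aL2) -/beta.
set J := Num.truncn (alpha * r / s - sg) in J1 J2 *.
set K := Num.truncn (beta * r * s - tau) in K1 K2 *.
set J' := Num.truncn (L * r / s - sg) in J3 J4 *.
set K' := Num.truncn (L * r * s - tau) in K3 K4 *.
have JJ : (J < J')%N by rewrite -(ltr_nat R); clear -J1 J3 hJn; lra.
have KK : (K < K')%N by rewrite -(ltr_nat R); clear -K1 K3 hKn; lra.
have ss' : s2^-1 <= s^-1 <= s1^-1 by rewrite si si2.
have H1 := S1 rho s J J' rr1 ss JJ.
rewrite rE in H1.
have H2 := S2 rho s^-1 K K' rr2 ss' KK.
rewrite rE invrK in H2.
have c1 : alpha * r / s <= J%:R + 1 + sg <= alpha * r / s + 1 by clear -J1; lra.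
have c2 : beta * r * s <= K%:R + 1 + tau <= beta * r * s + 1 by clear -K1; lra.
have {}H1 := H1 c1 J3; have {}H2 := H2 c2 K3.
have Y := young L0 cv aL'.
rewrite -/beta -[RHS]/(area L g) (area_swap L0 cv) in Y.
have E : strip_main L f sg tau alpha L r s J J' + strip_main L g tau sg beta L r s^-1 K K'
    + J%:R * K%:R - count_main L f sg tau r s =
  (tau + 1 / 2) * ((L * r / s - sg - J'%:R) - (alpha * r / s - sg - J%:R))
  + (sg + 1 / 2) * ((L * r * s - tau - K'%:R) - (beta * r * s - tau - K%:R))
  + (sg + (alpha * r / s - sg - J%:R)) * (tau + (beta * r * s - tau - K%:R)).
  rewrite /strip_main /count_main (curve_atL L0 cv) (curve_atL L0 cg) gb -/beta.
  rewrite -[prim f L]/(area L f) -[prim g L]/(area L g) (area_swap L0 cv).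
  have -> : prim f alpha = area L f + alpha * beta - prim g beta by rewrite -Y; ring.
  clear -s0; field; by rewrite gt_eqF.
have RB := residue_outer sg tau J2 K2 J4 K4.
rewrite -E in RB.
have rhosq : 1 <= rho ^+ 2 by rewrite exprn_ege1.
have QB : 3 * ((`|sg| + 1) * (`|tau| + 1)) <= 3 * ((`|sg| + 1) * (`|tau| + 1)) * rho ^+ 2.
  by rewrite ler_peMr.
have {}RB := le_trans RB QB.
set X1 := \sum_(J <= j < J') _ in H1 *; set X2 := \sum_(K <= j < K') _ in H2 *.
set m1 := strip_main _ _ _ _ _ _ _ _ _ _ in H1 RB.
set m2 := strip_main _ _ _ _ _ _ _ _ _ _ in H2 RB.
set jk := J%:R * K%:R in RB *; set cm := count_main _ _ _ _ _ _ in RB *.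
set q := 3 * _ in RB *.
clearbody X1 X2 m1 m2 jk cm q; clear -H1 H2 RB.
move: H1 H2 RB; rewrite !ler_norml; lra.
Qed.

End Asymptotics.

(** * Chords and tangents of convex curves *)

Section ConvexCurves.
Variable R : realType.
Implicit Types (L x y z : R) (f g : R -> R).

Lemma convex_chord L f x y z : convex_function `[0, L]%classic f ->
  0 <= x -> x <= z -> z <= y -> y <= L ->
  (y - x) * f z <= (y - z) * f x + (z - x) * f y.
Proof.
move=> cf x0 xz zy yL.
case: (ltP x y) => xy; last first.
  have e1 : x = y by lra.
  have e2 : z = x by lra.
  by rewrite e2 -e1 subrr !mul0r addr0.
have d0 : 0 < y - x by lra.
have t0 : 0 <= (y - z) / (y - x) by rewrite divr_ge0 //; lra.
have t1 : (y - z) / (y - x) <= 1 by rewrite ler_pdivrMr //; lra.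
have xin : x \in `[0, L]%classic by rewrite inE /= in_itv /=; apply/andP; split; lra.
have yin : y \in `[0, L]%classic by rewrite inE /= in_itv /=; apply/andP; split; lra.
have h : f ((y - z) / (y - x) * x + (1 - (y - z) / (y - x)) * y) <=
  (y - z) / (y - x) * f x + (1 - (y - z) / (y - x)) * f y := cf (Itv01 t0 t1) x y xin yin.
have zE : (y - z) / (y - x) * x + (1 - (y - z) / (y - x)) * y = z.
  by field; rewrite gt_eqF.
rewrite zE in h; have := ler_wpM2l (ltW d0) h.
have -> : (y - x) * ((y - z) / (y - x) * f x + (1 - (y - z) / (y - x)) * f y) =
   (y - z) * f x + (z - x) * f y by field; rewrite gt_eqF.
by [].
Qed.

(** Reflection in the diagonal preserves the region above a decreasing curve. *)
Lemma convex_curve_swap L f g : 0 < L -> decreasing_curve L f g ->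
  convex_function `[0, L]%classic f -> convex_function `[0, L]%classic g.
Proof.
move=> L0 cv cf t u v; rewrite !inE /= !in_itv /= => uL vL.
have gu := curve_grange cv uL; have gv := curve_grange cv vL.
have guL : g u \in `[0, L]%classic by rewrite inE /= in_itv.
have gvL : g v \in `[0, L]%classic by rewrite inE /= in_itv.
have t0 : 0 <= t%:num by [].
have t1 : t%:num <= 1 by [].
have h : f (t%:num * g u + (1 - t%:num) * g v) <=
  t%:num * f (g u) + (1 - t%:num) * f (g v) := cf t (g u) (g v) guL gvL.
change (g (t%:num * u + (1 - t%:num) * v) <= t%:num * g u + (1 - t%:num) * g v).
rewrite !(curve_fg cv) // in h.
set w := t%:num * u + _ in h *; set z := t%:num * g u + _ in h *.
have wL : 0 <= w <= L by rewrite /w; nra.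
have zL : 0 <= z <= L by rewrite /z; nra.
rewrite leNgt; apply/negP => k.
have /andP[_ gwL] := curve_grange cv wL; have /andP[z0 _] := zL.
by have := curve_lt cv z0 k gwL; rewrite (curve_fg cv) // ltNge h.
Qed.

Lemma concave_curve_swap L f g : 0 < L -> decreasing_curve L f g ->
  concave_function `[0, L]%classic f -> concave_function `[0, L]%classic g.
Proof.
move=> L0 cv cf t u v; rewrite !inE /= !in_itv /= => uL vL.
have gu := curve_grange cv uL; have gv := curve_grange cv vL.
have guL : g u \in `[0, L]%classic by rewrite inE /= in_itv.
have gvL : g v \in `[0, L]%classic by rewrite inE /= in_itv.
have t0 : 0 <= t%:num by [].
have t1 : t%:num <= 1 by [].
have h : - f (t%:num * g u + (1 - t%:num) * g v) <=
  t%:num * - f (g u) + (1 - t%:num) * - f (g v) := cf t (g u) (g v) guL gvL.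
change (- g (t%:num * u + (1 - t%:num) * v) <= t%:num * - g u + (1 - t%:num) * - g v).
rewrite !(curve_fg cv) // in h.
have -> : t%:num * - g u + (1 - t%:num) * - g v = - (t%:num * g u + (1 - t%:num) * g v) by ring.
have e : t%:num * - u + (1 - t%:num) * - v = - (t%:num * u + (1 - t%:num) * v) by ring.
rewrite e in h.
set w := t%:num * u + _ in h *; set z := t%:num * g u + _ in h *.
have wL : 0 <= w <= L by rewrite /w; nra.
have zL : 0 <= z <= L by rewrite /z; nra.
rewrite lerN2 leNgt; apply/negP => k.
rewrite lerN2 in h.
have /andP[gw0 _] := curve_grange cv wL; have /andP[_ zL'] := zL.
by have := curve_lt cv gw0 k zL'; rewrite (curve_fg cv) // ltNge h.
Qed.

Lemma supporting_line L f x : convex_function `[0, L]%classic f ->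
  0 < x -> x < L ->
  exists q, forall t, 0 <= t <= L -> f x + q * (t - x) <= f t.
Proof.
move=> cf x0 xL.
pose S := [set (f x - f t) / (x - t) | t in [set t | 0 <= t < x]].
have Sub u : x < u -> u <= L -> ubound S ((f u - f x) / (u - x)).
  move=> xu uL _ [t /= /andP[t0 tx] <-].
  rewrite ler_pdivrMr ?subr_gt0 // mulrAC ler_pdivlMr ?subr_gt0 //.
  by have := convex_chord cf t0 (ltW tx) (ltW xu) uL; lra.
have S0 : S !=set0 by exists ((f x - f 0) / (x - 0)); exists 0 => //=; rewrite lexx x0.
have Shs : has_sup S by split => //; exists ((f L - f x) / (L - x)); exact: Sub.
exists (sup S) => t /andP[t0 tL].
case: (ltgtP t x) => tx.
- have : (f x - f t) / (x - t) <= sup S.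
    by apply: ub_le_sup; [case: Shs|exists t => //=; rewrite t0 tx].
  by rewrite ler_pdivrMr ?subr_gt0 //; lra.
- have : sup S <= (f t - f x) / (t - x) by apply: ge_sup => //; exact: Sub.
  by rewrite ler_pdivlMr ?subr_gt0 //; lra.
- by rewrite tx subrr mulr0 addr0.
Qed.

(** The left half of the Hermite--Hadamard inequality, for the curve prolonged
    by 0 beyond L: the prolonged function is still convex. *)
Lemma hermite_hadamard L f g x d : 0 < L -> decreasing_curve L f g ->
  convex_function `[0, L]%classic f -> 0 <= d -> d <= x -> 0 < x -> x <= L ->
  2 * d * f x <= prim f (Num.min (x + d) L) - prim f (x - d).
Proof.
move=> L0 cv cf d0 dx x0; rewrite le_eqVlt => /orP[/eqP xE|xL].
  rewrite xE in dx *; rewrite (curve_atL L0 cv) mulr0.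
  have -> : Num.min (L + d) L = L by apply/min_idPr; rewrite lerDl.
  have Ld0 : 0 <= L - d by lra.
  have LdL : L - d <= L by lra.
  have /andP[+ _] := prim_bounds L0 cv Ld0 LdL (lexx L).
  by rewrite (curve_atL L0 cv) mul0r.
have [q qf] := supporting_line cf x0 xL.
have xd0 : 0 <= x - d by lra.
have yL : Num.min (x + d) L <= L by rewrite ge_min lexx orbT.
have xy : x - d <= Num.min (x + d) L by rewrite le_min; apply/andP; split; lra.
set y := Num.min _ _ in yL xy *.
have := @prim_ge_lin _ _ _ _ L0 cv (x - d) y (f x - q * d) q xd0 xy yL.
move=> /(_ _)/[dup]; have lin t : x - d <= t <= y -> f x - q * d + q * (t - (x - d)) <= f t.
  move=> txy; have := qf t; have -> : 0 <= t <= L by lra.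
  move=> /(_ isT); lra.
move=> /(_ lin) + _.
have [h|h] := leP (x + d) L.
  have -> : y = x + d by apply/min_idPl.
  by move=> H; apply: le_trans H; rewrite le_eqVlt; apply/orP; left; apply/eqP; field.
have -> : y = L by apply/min_idPr; exact: ltW.
have LL : 0 <= L <= L by lra.
have := qf L LL; rewrite (curve_atL L0 cv).
have f0 : 0 <= f x by have /andP[] : 0 <= f x <= L by apply: (curve_range cv); lra.
set e := L - x => qe; have e0 : 0 < e by rewrite /e; lra.
have ed : e < d by rewrite /e; lra.
have -> : L - (x - d) = e + d by rewrite /e; ring.
move=> H; apply: le_trans H.
suff : 2 * f x <= - q * (e + d) by nra.
have : f x * (e + d) <= - q * e * (e + d) by apply: ler_wpM2r; lra.
have : 2 * f x * e <= f x * (e + d) by nra.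
move=> h1 h2; rewrite -(ler_pM2r e0); lra.
Qed.

End ConvexCurves.

(** * Bounds for large stretch factors *)

Section LargeStretch.
Variable R : realType.
Implicit Types (L sg tau r s h nu : R) (f g : R -> R).

Lemma neg_part_ge0 (x : R) : 0 <= neg_part x.
Proof. by rewrite /neg_part; case: ifP. Qed.

Lemma neg_part_geN (x : R) : - neg_part x <= x.
Proof.
rewrite /neg_part; case: ifP => x0; first lra.
by rewrite lerNl -normrN ler_norm.
Qed.

Lemma neg_part_lt (x b : R) : 0 < b -> - b < x -> neg_part x < b.
Proof.
move=> b0 xb; rewrite /neg_part; case: ifP => // /negbT; rewrite -ltNge => x0.
by rewrite (ltr0_norm x0) ltrNl.
Qed.

(** Lowering a positive shift to 0 moves the points towards the axes and can only
    increase the count, so the shifts may be replaced by minus their negative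
    parts. *)
Lemma lattice_count_le_sum L f g sg tau r s :
  0 < L -> decreasing_curve L f g -> - (1 / 2) < sg -> - (1 / 2) < tau ->
  0 < r -> 0 < s ->
  (lattice_count L f sg tau r s)%:R <=
    \sum_(j < Num.truncn (L * r / s + neg_part sg))
      (dilate f r s (j.+1%:R - neg_part sg) + neg_part tau).
Proof.
move=> L0 cv sgh tauh r0 s0.
pose P := (Num.truncn (L * r / s + 1 + (L * r * s + 1))).+1.
have Lr : 0 <= L * r / s by rewrite divr_ge0 ?mulr_ge0 // ltW.
have Lr2 : 0 <= L * r * s by rewrite !mulr_ge0 // ltW.
have [P1 P2] : L * r / s + 1 <= P%:R /\ L * r * s + 1 <= P%:R.
  have /andP[_ +] := truncn_itv (addr_ge0 (addr_ge0 Lr ler01) (addr_ge0 Lr2 ler01)).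
  by rewrite -/P; clear -Lr Lr2; split; lra.
have LL : 0 < L <= L by rewrite L0 lexx.
rewrite (lattice_count_inner L0 cv sgh tauh r0 s0 P1 P2 LL) (curve_atL L0 cv).
have -> : Num.truncn (0 * r * s - tau) = 0%N.
  apply/eqP; rewrite -leqn0 -ltnS !mul0r sub0r.
  case: (leP 0 (- tau)) => t0; first by rewrite truncn_lt_nat //; lra.
  by rewrite truncn_floor leNgt t0.
rewrite mulr0 subr0 [X in _ + X]big_geq // addr0 big_mkord.
set J := Num.truncn _; set n := Num.truncn _.
have sn := neg_part_geN sg; have sn0 := neg_part_ge0 sg.
have snh : neg_part sg < 1 / 2 by apply: neg_part_lt; lra.
have tn := neg_part_geN tau; have tn0 := neg_part_ge0 tau.
have Jn : (J <= n)%N by apply: le_truncn; lra.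
pose b j := dilate f r s (j.+1%:R - neg_part sg) + neg_part tau.
have rs0 : 0 <= r * s by rewrite mulr_ge0 // ltW.
have pos j : 0 <= (j.+1%:R - neg_part sg) * s / r.
  have j1 : 1 <= j.+1%:R :> R by rewrite ler1n.
  by apply: divr_ge0; [apply: mulr_ge0; lra|lra].
have inL (j : nat) : (j < n)%N -> (j.+1%:R - neg_part sg) * s / r <= L.
  by rewrite truncn_gt_nat ler_pdivrMr // -ler_pdivlMr //; lra.
have b0 (j : nat) : (j < n)%N -> 0 <= b j.
  move=> jn; rewrite addr_ge0 // mulr_ge0 //.
  by have /andP[] : 0 <= f ((j.+1%:R - neg_part sg) * s / r) <= L
    by apply: (curve_range cv); rewrite pos inL.
apply: (@le_trans _ _ (\sum_(j < J) b j)).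
  apply: ler_sum => j _.
  have jn : (j < n)%N by apply: leq_trans Jn.
  have le : dilate f r s (j.+1%:R + sg) - tau <= b j.
    apply: lerD; last by lra.
    rewrite /dilate ler_wpM2l // (curve_le cv) //.
      rewrite -!mulrA; apply: ler_wpM2r; last by lra.
      by apply: divr_ge0; exact: ltW.
    by have := ltn_ord j; rewrite truncn_gt_nat ler_pdivrMr // -ler_pdivlMr //; lra.
  have /andP[h _] := truncn_itv (b0 _ jn); apply: le_trans h.
  by rewrite ler_nat; apply: le_truncn.
rewrite (big_ord_widen n b Jn) big_mkcond /=; apply: ler_sum => j _.
by case: ifP => // _; exact: b0.
Qed.

(** The trapezoids inscribed in the region have total area at most [area L f]. The
    first one reaches up to [L] on the vertical axis, which accounts for the gain
    [(1 / 2 - nu) h L]; every column but the last borders on two trapezoids,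
    whence the last term. *)
Lemma concave_sum L f g h nu n : 0 < L -> decreasing_curve L f g ->
  concave_function `[0, L]%classic f -> 0 < h -> 0 <= nu < 1 / 2 ->
  (n.+1%:R - nu) * h <= L ->
  \sum_(j < n.+1) h * f ((j.+1%:R - nu) * h) <=
    area L f - (1 / 2 - nu) * h * L + h * f ((n.+1%:R - nu) * h) / 2.
Proof.
move=> L0 cv cf h0 nuh nL.
have trap x y : 0 <= x -> x <= y -> y <= L ->
    (y - x) * (f x + f y) / 2 <= prim f y - prim f x.
  move=> x0; rewrite le_eqVlt => /orP[/eqP ->|xy yL]; first by rewrite !subrr !mul0r.
  have d0 : 0 < y - x by rewrite subr_gt0.
  have := @prim_ge_lin _ _ _ _ L0 cv x y (f x) ((f y - f x) / (y - x)) x0 (ltW xy) yL.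
  have -> : f x * (y - x) + (f y - f x) / (y - x) * (y - x) ^+ 2 / 2 =
     (y - x) * (f x + f y) / 2 by field; rewrite gt_eqF.
  apply => t /andP[xt ty].
  have := convex_chord cf x0 xt ty yL.
  move=> /= H.
  rewrite -(ler_pM2l d0).
  have -> : (y - x) * (f x + (f y - f x) / (y - x) * (t - x)) =
     (y - x) * f x + (f y - f x) * (t - x) by field; rewrite gt_eqF.
  lra.
suff H : \sum_(j < n.+1) h * f ((j.+1%:R - nu) * h) <=
    prim f ((n.+1%:R - nu) * h) - (1 / 2 - nu) * h * L + h * f ((n.+1%:R - nu) * h) / 2.
  apply: (le_trans H); rewrite lerD2r lerD2r.
  have x0 : 0 <= (n.+1%:R - nu) * h.
    have n1 : 1 <= n.+1%:R :> R by rewrite ler1n.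
    by apply: mulr_ge0; lra.
  have /andP[+ _] := prim_bounds L0 cv x0 nL (lexx L).
  by rewrite (curve_atL L0 cv) mul0r -[prim f L]/(area L f); lra.
elim: n nL => [|n IH] nL.
  rewrite big_ord1.
  have x0 : 0 <= (1 - nu) * h by apply: mulr_ge0; lra.
  have := trap 0 _ (lexx 0) x0 nL; rewrite (curve_at0 L0 cv) prim0 !subr0.
  have /andP[f0 fL] : 0 <= f ((1 - nu) * h) <= L by apply: (curve_range cv); rewrite x0.
  have : nu * h * f ((1 - nu) * h) <= nu * h * L.
    by apply: ler_wpM2l => //; apply: mulr_ge0; lra.
  lra.
rewrite big_ord_recr /=.
have e : (n.+2%:R - nu) * h = (n.+1%:R - nu) * h + h by rewrite -[n.+2%:R]natr1; ring.
have n1 : 1 <= n.+1%:R :> R by rewrite ler1n.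
have x0 : 0 <= (n.+1%:R - nu) * h by apply: mulr_ge0; lra.
rewrite e in nL *.
have xy : (n.+1%:R - nu) * h <= (n.+1%:R - nu) * h + h by lra.
have := trap _ _ x0 xy nL; have := IH (le_trans xy nL); lra.
Qed.

(** By [hermite_hadamard] the rectangle of each column has at most the area under
    the curve on the interval of length [h] centred at the column; these
    intervals leave out [[0, (1 / 2 - nu) h]]. *)
Lemma convex_sum L f g h nu n : 0 < L -> decreasing_curve L f g ->
  convex_function `[0, L]%classic f -> 0 < h -> 0 <= nu < 1 / 2 ->
  (n.+1%:R - nu) * h <= L ->
  \sum_(j < n.+1) h * f ((j.+1%:R - nu) * h) <= area L f - prim f ((1 / 2 - nu) * h).
Proof.
move=> L0 cv cf h0 nuh nL.
pose y := Num.min ((n.+1%:R - nu) * h + h / 2) L.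
suff H : \sum_(j < n.+1) h * f ((j.+1%:R - nu) * h) <= prim f y - prim f ((1 / 2 - nu) * h).
  apply: (le_trans H); rewrite lerD2r.
  have n1 : 1 <= n.+1%:R :> R by rewrite ler1n.
  have x0 : 0 <= (n.+1%:R - nu) * h by apply: mulr_ge0; lra.
  have y0 : 0 <= y by rewrite le_min; apply/andP; split; lra.
  have yL : y <= L by rewrite ge_min lexx orbT.
  have /andP[+ _] := prim_bounds L0 cv y0 yL (lexx L).
  by rewrite (curve_atL L0 cv) mul0r -[prim f L]/(area L f); lra.
have hh : 0 <= h / 2 by lra.
rewrite /y {y}; elim: n nL => [|n IH] nL.
  rewrite big_ord1.
  have x0 : 0 < (1 - nu) * h by rewrite mulr_gt0 //; lra.
  have dx : h / 2 <= (1 - nu) * h by nra.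
  have := hermite_hadamard L0 cv cf hh dx x0 nL.
  have -> : (1 - nu) * h - h / 2 = (1 / 2 - nu) * h by field.
  lra.
rewrite big_ord_recr /=.
have e : (n.+2%:R - nu) * h = (n.+1%:R - nu) * h + h by rewrite -[n.+2%:R]natr1; ring.
have n1 : 1 <= n.+1%:R :> R by rewrite ler1n.
have x0 : 0 <= (n.+1%:R - nu) * h by apply: mulr_ge0; lra.
rewrite e in nL *.
have nL' : (n.+1%:R - nu) * h <= L by lra.
have dx : h / 2 <= (n.+1%:R - nu) * h + h by lra.
have xp : 0 < (n.+1%:R - nu) * h + h by lra.
have := hermite_hadamard L0 cv cf hh dx xp nL; have := IH nL'.
have -> : Num.min ((n.+1%:R - nu) * h + h / 2) L = (n.+1%:R - nu) * h + h / 2.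
  by apply/min_idPl; lra.
have -> : (n.+1%:R - nu) * h + h - h / 2 = (n.+1%:R - nu) * h + h / 2 by field.
lra.
Qed.

(** Both cases lead to the same dichotomy: a stretch factor [s >= 1] either
    misses a fixed proportion of the area, or misses an area proportional to
    [r * s]. *)
Definition large_stretch_bound L f sg tau := exists C kappa : R,
  [/\ 0 < C, 0 <= kappa, kappa < 1 & forall r s, 0 < r -> 1 <= s ->
    (lattice_count L f sg tau r s)%:R <= kappa * (r ^+ 2 * area L f) + 1 / 2 \/
    (lattice_count L f sg tau r s)%:R <= r ^+ 2 * area L f - C * (r * s) + 1 / 2].

Let sum_split L f sg tau r s n : 0 < r ->
  \sum_(j < n) (dilate f r s (j.+1%:R - neg_part sg) + neg_part tau) =
  r ^+ 2 * \sum_(j < n) (s / r) * f ((j.+1%:R - neg_part sg) * (s / r))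
   + n%:R * neg_part tau.
Proof.
move=> r0; rewrite big_split /= sumr_const card_ord mulr_natl; congr (_ + _).
rewrite mulr_sumr; apply: eq_bigr => j _; rewrite /dilate.
have -> : (j.+1%:R - neg_part sg) * (s / r) = (j.+1%:R - neg_part sg) * s / r by rewrite mulrA.
field.
by rewrite gt_eqF.
Qed.

Lemma area_ge0 L f g : 0 < L -> decreasing_curve L f g -> 0 <= area L f.
Proof.
move=> L0 cv; have /andP[+ _] := prim_bounds L0 cv (lexx 0) (ltW L0) (lexx L).
by rewrite (curve_atL L0 cv) mul0r prim0 subr0.
Qed.

(** There are at most [L r / s + 1 / 2] columns, and each of them may gain the
    negative part of the vertical shift. *)
Let tail_le L (t N : R) r s : 0 < L -> 0 < r -> 1 <= s -> 0 <= t -> t < 1 / 2 ->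
  N <= L * r / s + 1 / 2 -> N * t <= L * t * (r * s) + 1 / 4.
Proof.
move=> L0 r0 s1 t0 th NL.
have : L * r / s <= L * r * s.
  have s0 : 0 < s by lra.
  have s2 : 1 <= s * s by nra.
  rewrite ler_pdivrMr // -[leRHS]mulrA; apply: ler_peMr => //.
  by apply: mulr_ge0; exact: ltW.
move=> h; have : N * t <= (L * r * s + 1 / 2) * t by apply: ler_wpM2r => //; lra.
lra.
Qed.

(** By [concave_sum] the left-over area is at least
    [(1 / 2 - neg_part sg) L - f (shift_ratio sg * L) / 2] times [r s], because
    the last column lies right of [shift_ratio sg * L]. *)
Lemma concave_large_stretch L f g sg tau : 0 < L -> decreasing_curve L f g ->
  - (1 / 2) < sg -> - (1 / 2) < tau ->
  concave_function `[0, L]%classic f ->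
  f (shift_ratio sg * L) < 2 * (1 / 2 - neg_part sg - neg_part tau) * L ->
  large_stretch_bound L f sg tau.
Proof.
move=> L0 cv sgh tauh cf H.
have sn0 := neg_part_ge0 sg; have tn0 := neg_part_ge0 tau.
have h2 : 0 < 1 / 2 :> R by lra.
have snh := neg_part_lt h2 sgh; have tnh := neg_part_lt h2 tauh.
exists ((1 / 2 - neg_part sg - neg_part tau) * L - f (shift_ratio sg * L) / 2), 0.
split => //; first lra.
move=> r s r0 s1; have s0 : 0 < s by lra.
have := lattice_count_le_sum L0 cv sgh tauh r0 s0.
set N := (lattice_count _ _ _ _ _ _)%:R; set n := Num.truncn _.
case nE : n => [|m]; first by rewrite big_ord0 mul0r; left; lra.
rewrite sum_split // => NS; right.
have hh : 0 < s / r by rewrite divr_gt0.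
have Lr : 0 <= L * r / s + neg_part sg by rewrite addr_ge0 // divr_ge0 ?mulr_ge0 // ltW.
have := truncn_itv Lr; rewrite -/n nE => /andP[m1 m2].
have mL : (m.+1%:R - neg_part sg) * (s / r) <= L.
  by rewrite mulrA ler_pdivrMr // -ler_pdivlMr //; lra.
have nu01 : 0 <= neg_part sg < 1 / 2 by rewrite sn0 snh.
have S := concave_sum (n := m) L0 cv cf hh nu01 mL.
have ml1 : 1 <= m.+1%:R :> R by rewrite ler1n.
(* the next column would lie beyond [L], and the ratio between two successive
   columns is smallest for the first two *)
have fle : f ((m.+1%:R - neg_part sg) * (s / r)) <= f (shift_ratio sg * L).
  apply: (curve_le cv) => //.
    by rewrite /shift_ratio; apply: mulr_ge0; [apply: divr_ge0; lra|exact: ltW].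
  have d0 : 0 < 2 - neg_part sg by lra.
  rewrite /shift_ratio mulrAC ler_pdivrMr //.
  have : L * r / s < m.+1%:R + 1 - neg_part sg by rewrite natr1; lra.
  rewrite ltr_pdivrMr // => hL.
  have {}hL : L <= (m.+1%:R + 1 - neg_part sg) * (s / r).
    by rewrite mulrA ler_pdivlMr // ltW.
  apply: (@le_trans _ _ ((1 - neg_part sg) * ((m.+1%:R + 1 - neg_part sg) * (s / r)))).
    by rewrite ler_wpM2l //; lra.
  have : 0 <= (m.+1%:R - 1) * (s / r) by apply: mulr_ge0; lra.
  set a := m.+1%:R; set b := neg_part sg; set d := s / r.
  have -> : (a - b) * d * (2 - b) = (1 - b) * ((a + 1 - b) * d) + (a - 1) * d by ring.
  lra.
have T := tail_le L0 r0 s1 tn0 tnh (N := m.+1%:R).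
have {}T : m.+1%:R * neg_part tau <= L * neg_part tau * (r * s) + 1 / 4 by apply: T; lra.
have r2 : 0 <= r ^+ 2 by rewrite sqr_ge0.
have S2 : \sum_(j < m.+1) s / r * f ((j.+1%:R - neg_part sg) * (s / r)) <=
  area L f - (1 / 2 - neg_part sg) * (s / r) * L + s / r * f (shift_ratio sg * L) / 2.
  apply: (le_trans S); rewrite lerD2l ler_wpM2r // ler_wpM2l // ltW //.
have := ler_wpM2l r2 S2.
have -> : r ^+ 2 * (area L f - (1 / 2 - neg_part sg) * (s / r) * L + s / r * f (shift_ratio sg * L) / 2) =
  r ^+ 2 * area L f - (1 / 2 - neg_part sg) * L * (r * s) + f (shift_ratio sg * L) / 2 * (r * s).
  by field; rewrite gt_eqF.
clear -NS T; lra.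
Qed.

(** With two columns or more, the interval left out in [convex_sum] ends before
    [shift_ratio sg * L], so the curve above it is at least as high as there. *)
Lemma convex_large_stretch L f g sg tau : 0 < L -> decreasing_curve L f g ->
  - (1 / 2) < sg -> - (1 / 2) < tau ->
  convex_function `[0, L]%classic f ->
  2 * (neg_part sg + neg_part tau) * L < (1 - neg_part sg) * f (shift_ratio sg * L) ->
  large_stretch_bound L f sg tau.
Proof.
move=> L0 cv sgh tauh cf H.
have sn0 := neg_part_ge0 sg; have tn0 := neg_part_ge0 tau.
have h2 : 0 < 1 / 2 :> R by lra.
have snh := neg_part_lt h2 sgh; have tnh := neg_part_lt h2 tauh.
have d0 : 0 < 2 - neg_part sg by lra.
have rho0 : 0 <= shift_ratio sg * L.
  by rewrite /shift_ratio; apply: mulr_ge0; [apply: divr_ge0; lra|exact: ltW].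
have rhoL : shift_ratio sg * L <= L.
  by rewrite /shift_ratio mulrAC ler_pdivrMr //; nra.
have /andP[f0 fL] : 0 <= f (shift_ratio sg * L) <= L.
  by apply: (curve_range cv); rewrite rho0.
have c0 : 0 < 2 * (1 - neg_part sg) by lra.
exists ((1 / 2 - neg_part sg) * f (shift_ratio sg * L) - neg_part tau * L),
  ((2 * (1 - neg_part sg))^-1); split.
- by nra.
- by rewrite invr_ge0 ltW.
- by rewrite invf_lt1 //; lra.
move=> r s r0 s1; have s0 : 0 < s by lra.
have := lattice_count_le_sum L0 cv sgh tauh r0 s0.
set N := (lattice_count _ _ _ _ _ _)%:R; set n := Num.truncn _.
have r2 : 0 <= r ^+ 2 by rewrite sqr_ge0.
have A0 := area_ge0 L0 cv.
have kA : 0 <= (2 * (1 - neg_part sg))^-1 * (r ^+ 2 * area L f).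
  by apply: mulr_ge0; [rewrite invr_ge0 ltW|exact: mulr_ge0].
case nE : n => [|m]; first by rewrite big_ord0; left; lra.
rewrite sum_split // => NS.
have hh : 0 < s / r by rewrite divr_gt0.
have Lr : 0 <= L * r / s + neg_part sg by rewrite addr_ge0 // divr_ge0 ?mulr_ge0 // ltW.
have := truncn_itv Lr; rewrite -/n nE => /andP[m1 m2].
have mL : (m.+1%:R - neg_part sg) * (s / r) <= L.
  by rewrite mulrA ler_pdivrMr // -ler_pdivlMr //; lra.
have nu01 : 0 <= neg_part sg < 1 / 2 by rewrite sn0 snh.
case: m => [|m] in nE NS m1 m2 mL.
  left; rewrite big_ord1 in NS.
  (* around a single column the Hermite--Hadamard interval may be extended to the
     axis; it is then [2 (1 - neg_part sg) > 1] times as wide as the column *)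
  have x0 : 0 < (1 - neg_part sg) * (s / r) by rewrite mulr_gt0 //; lra.
  have := hermite_hadamard L0 cv cf (ltW x0) (lexx _) x0 mL.
  rewrite subrr prim0 subr0.
  set y := Num.min _ _ => HH.
  have y0 : 0 <= y by rewrite le_min; apply/andP; split; [rewrite addr_ge0 // ltW|exact: ltW].
  have yL : y <= L by rewrite ge_min lexx orbT.
  have /andP[+ _] := prim_bounds L0 cv y0 yL (lexx L).
  rewrite (curve_atL L0 cv) mul0r -[prim f L]/(area L f) => yA.
  have {}HH : 2 * ((1 - neg_part sg) * (s / r)) * f ((1 - neg_part sg) * (s / r)) <= area L f by lra.
  have {}HH := ler_wpM2l r2 HH.
  have : r ^+ 2 * (s / r * f ((1 - neg_part sg) * (s / r))) <=
    (2 * (1 - neg_part sg))^-1 * (r ^+ 2 * area L f).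
    rewrite -(ler_pM2l c0) mulrA [leRHS]mulrA mulfV ?gt_eqF // mul1r.
    apply: le_trans HH; rewrite le_eqVlt; apply/orP; left; apply/eqP; ring.
  clear -NS tnh; lra.
right.
have S := convex_sum (n := m.+1) L0 cv cf hh nu01 mL.
have m2' : 2 <= m.+2%:R :> R by rewrite ler_nat.
have e : (2 - neg_part sg) * (s / r) <= L.
  by apply: le_trans mL; apply: ler_wpM2r; [exact: ltW|lra].
have y0 : 0 <= (1 / 2 - neg_part sg) * (s / r) by apply: mulr_ge0; lra.
have yrho : (1 / 2 - neg_part sg) * (s / r) <= shift_ratio sg * L.
  apply: (@le_trans _ _ ((1 - neg_part sg) * (s / r))).
    by apply: ler_wpM2r; [exact: ltW|lra].
  rewrite /shift_ratio mulrAC ler_pdivlMr //.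
  have -> : (1 - neg_part sg) * (s / r) * (2 - neg_part sg) =
     (1 - neg_part sg) * ((2 - neg_part sg) * (s / r)) by ring.
  by rewrite ler_wpM2l //; lra.
have /andP[+ _] := prim_bounds L0 cv (lexx 0) y0 (le_trans yrho rhoL).
rewrite prim0 !subr0 => P1.
have P2 : f (shift_ratio sg * L) * ((1 / 2 - neg_part sg) * (s / r)) <=
    prim f ((1 / 2 - neg_part sg) * (s / r)).
  apply: le_trans P1; rewrite ler_wpM2r // (curve_le cv) //.
have T := tail_le L0 r0 s1 tn0 tnh (N := m.+2%:R).
have {}T : m.+2%:R * neg_part tau <= L * neg_part tau * (r * s) + 1 / 4 by apply: T; lra.
have S2 : \sum_(j < m.+2) s / r * f ((j.+1%:R - neg_part sg) * (s / r)) <=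
  area L f - f (shift_ratio sg * L) * ((1 / 2 - neg_part sg) * (s / r)).
  by apply: (le_trans S); rewrite lerD2l lerN2.
have := ler_wpM2l r2 S2.
have -> : r ^+ 2 * (area L f - f (shift_ratio sg * L) * ((1 / 2 - neg_part sg) * (s / r))) =
  r ^+ 2 * area L f - (1 / 2 - neg_part sg) * f (shift_ratio sg * L) * (r * s).
  by field; rewrite gt_eqF.
clear -NS T; lra.
Qed.

End LargeStretch.

(** * The optimal stretch factor *)

Section OptimalStretch.
Variable R : realType.
Implicit Types (L sg tau r s rho p q : R) (f g : R -> R).

(** The decomposition [lattice_count_inner] is symmetric under reflection in the
    diagonal. *)
Lemma lattice_count_swap L f g sg tau r s :
  0 < L -> decreasing_curve L f g -> - (1 / 2) < sg -> - (1 / 2) < tau ->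
  0 < r -> 0 < s ->
  lattice_count L f sg tau r s = lattice_count L g tau sg r s^-1.
Proof.
move=> L0 cv sgh tauh r0 s0; have cg := curve_swap L0 cv.
have s0' : 0 < s^-1 by rewrite invr_gt0.
pose P := (Num.truncn (L * r / s + 1 + (L * r * s + 1))).+1.
have Lr : 0 <= L * r / s by rewrite divr_ge0 ?mulr_ge0 // ltW.
have Lr2 : 0 <= L * r * s by rewrite !mulr_ge0 // ltW.
have [P1 P2] : L * r / s + 1 <= P%:R /\ L * r * s + 1 <= P%:R.
  have /andP[_ +] := truncn_itv (addr_ge0 (addr_ge0 Lr ler01) (addr_ge0 Lr2 ler01)).
  by rewrite -/P; clear -Lr Lr2; split; lra.
have P2' : L * r / s^-1 + 1 <= P%:R by rewrite invrK.
have a0 : 0 < L / 2 by lra.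
have aL : 0 < L / 2 <= L by lra.
have aL' : 0 <= L / 2 <= L by lra.
have bL : 0 < f (L / 2) <= L.
  have /andP[_ ->] := curve_range cv aL'; rewrite andbT -(curve_atL L0 cv).
  by apply: (curve_lt cv); lra.
apply/eqP; rewrite -(eqr_nat R); apply/eqP.
rewrite (lattice_count_inner L0 cv sgh tauh r0 s0 P1 P2 aL).
rewrite (lattice_count_inner L0 cg tauh sgh r0 s0' P2' P1 bL).
rewrite (curve_gf cv aL') invrK; ring.
Qed.

Lemma nat_set_max (A : set nat) (B : nat) :
  A !=set0 -> (forall n, A n -> (n <= B)%N) -> exists M, is_max A M.
Proof.
move=> [a Aa] AB.
have P : exists n, `[< A n >] by exists a; apply/asboolP.
have Q n : `[< A n >] -> (n <= B)%N by move=> /asboolP /AB.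
exists (ex_maxn P Q); case: ex_maxnP => M /asboolP AM Mmax; split=> // n An.
by rewrite leEnat; apply: Mmax; apply/asboolP.
Qed.

Lemma large_stretch_bounded L f g sg tau : 0 < L -> decreasing_curve L f g ->
  large_stretch_bound L f sg tau -> forall r s, 0 < r -> 1 <= s ->
  (lattice_count L f sg tau r s)%:R <= r ^+ 2 * area L f + 1 / 2.
Proof.
move=> L0 cv [C [k [C0 k0 k1 H]]] r s r0 s1.
have A0 : 0 <= r ^+ 2 * area L f by rewrite mulr_ge0 ?sqr_ge0 ?(area_ge0 L0 cv).
have Crs : 0 <= C * (r * s) by rewrite !mulr_ge0 ?ltW //; lra.
by case: (H r s r0 s1) => /le_trans; apply; nra.
Qed.

(** The counts are integers, bounded by [large_stretch_bounded] for [s >= 1] and,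
    after exchanging the axes, for [s <= 1]. *)
Lemma lattice_count_max L f g sg tau r : 0 < L -> decreasing_curve L f g ->
  - (1 / 2) < sg -> - (1 / 2) < tau ->
  large_stretch_bound L f sg tau -> large_stretch_bound L g tau sg -> 0 < r ->
  exists M, is_max (lattice_counts L f sg tau r) M.
Proof.
move=> L0 cv sgh tauh bf bg r0.
pose B := Num.truncn (r ^+ 2 * area L f + 1 / 2).
have B0 : 0 <= r ^+ 2 * area L f + 1 / 2.
  by rewrite addr_ge0 // mulr_ge0 ?sqr_ge0 ?(area_ge0 L0 cv).
apply: (@nat_set_max _ B).
  by exists (lattice_count L f sg tau r 1); exists 1 => //=; rewrite in_itv /= ltr01.
move=> n [s /=]; rewrite in_itv /= andbT => s0 <-.
rewrite truncn_ge_nat //; case: (leP 1 s) => s1.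
  exact: (large_stretch_bounded L0 cv bf).
rewrite (lattice_count_swap L0 cv sgh tauh r0 s0) -(area_swap L0 cv).
apply: (large_stretch_bounded L0 (curve_swap L0 cv) bg) => //.
by rewrite -[leLHS]invr1 lef_pV2 ?posrE // ltW.
Qed.

(** Completing the square. *)
Lemma stretch_excess p q s : 0 < p -> 0 < q -> 0 < s ->
  s * p + q / s = 2 * Num.sqrt (p * q) + p * (s - Num.sqrt (q / p)) ^+ 2 / s.
Proof.
move=> p0 q0 s0; set t := Num.sqrt (q / p).
have t2 : t ^+ 2 = q / p by rewrite sqr_sqrtr // divr_ge0 // ltW.
have qE : q = p * t ^+ 2 by rewrite t2 mulrC divfK // gt_eqF.
have -> : Num.sqrt (p * q) = p * t.
  have -> : p * q = (p * t) ^+ 2 by rewrite exprMn qE; ring.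
  by rewrite sqrtr_sqr ger0_norm // mulr_ge0 ?sqrtr_ge0 // ltW.
by rewrite {1}qE; field; rewrite gt_eqF.
Qed.

Lemma cube_root_powers r : 0 < r ->
  [/\ (r `^ (1 / 3)) ^+ 3 = r, (r `^ (1 / 3)) ^+ 2 = r `^ (2 / 3),
      0 < r `^ (- (1 / 6)), (r `^ (- (1 / 6))) ^+ 2 * r `^ (1 / 3) = 1
    & (r `^ (- (1 / 6))) ^+ 6 * r = 1].
Proof.
move=> r0.
have X (a : R) (n : nat) : (r `^ a) ^+ n = r `^ (a * n%:R).
  by rewrite powRrM powR_mulrn // powR_ge0.
have r1 : r `^ 1 = r by rewrite powRr1 // ltW.
have r0' : r `^ 0 = 1 by rewrite powRr0.
split; rewrite ?powR_gt0 // ?X.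
- by rewrite -[RHS]r1; congr (_ `^ _); field.
- by congr (_ `^ _); field.
- by rewrite -powRD ?(gt_eqF r0) ?implybT // -[RHS]r0'; congr (_ `^ _); field.
- by rewrite -{2}r1 -powRD ?(gt_eqF r0) ?implybT // -[RHS]r0'; congr (_ `^ _); field.
Qed.

(** For large [r], losing a fixed proportion of the area costs more than [c r],
    and losing [C r s] costs more than [c r] unless [s] is bounded. *)
Lemma large_stretch_le L f g sg tau c : 0 < L -> decreasing_curve L f g ->
  0 < area L f -> 0 <= c -> large_stretch_bound L f sg tau ->
  exists S r1 : R, [/\ 0 < S, 1 <= r1 & forall r s, r1 <= r -> 1 <= s ->
    r ^+ 2 * area L f - c * r <= (lattice_count L f sg tau r s)%:R -> s <= S].
Proof.
move=> L0 cv A0 c0 [C [k [C0 k0 k1 H]]].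
have Ak : 0 < (1 - k) * area L f by rewrite mulr_gt0 //; lra.
exists ((c + 1) / C), (1 + (c + 1) / ((1 - k) * area L f)); split.
- by rewrite divr_gt0 //; lra.
- by rewrite lerDl divr_ge0 //; lra.
move=> r s rr s1 hN.
have q0 : 0 <= (c + 1) / ((1 - k) * area L f) by rewrite divr_ge0 //; lra.
have r1 : 1 <= r by lra.
have rq : c + 1 < r * ((1 - k) * area L f).
  by rewrite -ltr_pdivrMr //; lra.
have r0 : 0 < r by lra.
case: (H r s r0 s1) => h.
  have := ler_wpM2l (ltW r0) (ltW rq).
  have : r * (c + 1) < r * (r * ((1 - k) * area L f)) by rewrite ltr_pM2l.
  rewrite expr2 in hN h; move=> h1 _; exfalso.
  have : r * (c + 1) < c * r + 1 / 2 by clear -h1 hN h; lra.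
  clear -r1; lra.
have h1 : C * (r * s) <= c * r + 1 / 2 by clear -hN h; lra.
rewrite ler_pdivlMr // -(ler_pM2l r0).
clear -h1 r1; lra.
Qed.

(** The count at [s_star] is within [c r] of the full area, so the maximizers lie
    in a compact interval. There the uniform asymptotics, applied at a maximizer
    [s] and at [s_star], give [r L (V s - V s_star) <= 2 C1 rho^2] for
    [V s = s p + q / s], and the excess [V s - V s_star] is quadratic in
    [s - s_star]. *)
Lemma optimal_stretch_asymptotics L f g sg tau : 0 < L -> decreasing_curve L f g ->
  - (1 / 2) < sg -> - (1 / 2) < tau -> 0 < area L f ->
  large_stretch_bound L f sg tau -> large_stretch_bound L g tau sg ->
  uniform_asymptotics L f sg tau ->
  let s_star := Num.sqrt ((tau + 1 / 2) / (sg + 1 / 2)) in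
  exists C R0 : R, [/\ 0 < C, 0 < R0 & forall r, R0 <= r ->
    exists2 M : nat, is_max (lattice_counts L f sg tau r) M &
      `|M%:R - (r ^+ 2 * area L f
               - 2 * r * L * Num.sqrt ((sg + 1 / 2) * (tau + 1 / 2)))|
            <= C * r `^ (2 / 3) /\
      forall s, optimal_stretch L f sg tau r s ->
        `|s - s_star| <= C * r `^ (- (1 / 6))].
Proof.
move=> L0 cv sgh tauh A0 bf bg UA t.
pose p := sg + 1 / 2; pose q := tau + 1 / 2.
have p0 : 0 < p by rewrite /p; lra.
have q0 : 0 < q by rewrite /q; lra.
have t0 : 0 < t by rewrite sqrtr_gt0 divr_gt0.
pose V s := s * p + q / s.
have VE s : 0 < s -> V s = 2 * Num.sqrt (p * q) + p * (s - t) ^+ 2 / s.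
  by move=> s0; rewrite /V (stretch_excess p0 q0 s0).
have Vt : V t = 2 * Num.sqrt (p * q) by rewrite VE // subrr expr0n /= mulr0 mul0r addr0.
have V0 : 0 < V t by apply: addr_gt0; [exact: mulr_gt0|exact: divr_gt0].
have [C0 [rho0 [C00 rho01 H0]]] := UA t t t0 (lexx t).
pose c := L * V t + C0.
have c0 : 0 <= c by rewrite addr_ge0 // mulr_ge0 // ltW.
have [S1 [r1 [S10 r11 B1]]] := large_stretch_le L0 cv A0 c0 bf.
have cg := curve_swap L0 cv.
have A0' : 0 < area L g by rewrite (area_swap L0 cv).
have [S2 [r2 [S20 r21 B2]]] := large_stretch_le L0 cg A0' c0 bg.
pose S := 1 + S1 + S2 + t + t^-1.
have tV : 0 < t^-1 by rewrite invr_gt0.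
have S1' : 1 <= S by rewrite /S; lra.
have Sp : 0 < S by lra.
have Sv : S^-1 <= S.
  by apply: (@le_trans _ _ 1); [rewrite invf_le1|].
have tS : S^-1 <= t <= S.
  apply/andP; split; last by rewrite /S; lra.
  by rewrite -[leRHS]invrK lef_pV2 ?posrE // /S; lra.
have SV : 0 < S^-1 by rewrite invr_gt0.
have [C1 [rho1 [C10 rho11 H1]]] := UA S^-1 S SV Sv.
(* adding 1 makes [D <= D ^+ 2] *)
pose D := 2 * C1 * S / (L * p) + 1.
have Lp : 0 < L * p by rewrite mulr_gt0.
have D0 : 1 <= D by rewrite lerDr divr_ge0 ?mulr_ge0 // ltW.
exists (C1 + D), (rho0 ^+ 3 + rho1 ^+ 3 + r1 + r2); split.
- by clear -C10 D0; lra.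
- have h1 : 0 <= rho0 ^+ 3 by apply: exprn_ge0; clear -rho01; lra.
  have h2 : 0 <= rho1 ^+ 3 by apply: exprn_ge0; clear -rho11; lra.
  by clear -h1 h2 r11 r21; lra.
move=> r rr.
have g0 : 0 <= rho0 ^+ 3 by apply: exprn_ge0; clear -rho01; lra.
have g1 : 0 <= rho1 ^+ 3 by apply: exprn_ge0; clear -rho11; lra.
have r0 : 0 < r by clear -rr r11 r21 g0 g1; lra.
have [e1 e2 w0 e3 _] := cube_root_powers r0.
set rho := r `^ (1 / 3) in e1 e2 e3 *; set w := r `^ (- (1 / 6)) in w0 e3 *.
have rhop : 0 < rho by rewrite powR_gt0.
have cube a : 1 <= a -> a ^+ 3 <= r -> a <= rho.
  move=> a1; rewrite -[in X in X -> _]e1 ler_pXn2r // nnegrE; [lra|exact: ltW].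
have k0 : rho0 <= rho by apply: cube => //; clear -rr r11 r21 g0 g1; lra.
have k1 : rho1 <= rho by apply: cube => //; clear -rr r11 r21 g0 g1; lra.
have rho1' : 1 <= rho by exact: le_trans k0.
have [M Mmax] := lattice_count_max L0 cv sgh tauh bf bg r0.
have [[s0 /= s0p MN] Mub] := Mmax.
rewrite in_itv /= andbT in s0p.
exists M => //.
have main s : count_main L f sg tau r s = r ^+ 2 * area L f - r * L * V s by [].
have tM : (lattice_count L f sg tau r t)%:R <= M%:R :> R.
  by rewrite ler_nat -leEnat; apply: Mub; exists t => //=; rewrite in_itv /= t0.
have Ht := H0 rho t k0; rewrite lexx in Ht; have {}Ht := Ht isT.
rewrite e1 main in Ht.
have rho2r : rho ^+ 2 <= r.
  by rewrite -e1 [leRHS]exprS ler_peMl // exprn_ge0 // ltW.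
have low : r ^+ 2 * area L f - c * r <= (lattice_count L f sg tau r t)%:R.
  have : C0 * rho ^+ 2 <= C0 * r by rewrite ler_wpM2l.
  by move: Ht; rewrite ler_norml /c; clear; lra.
have opt s : 0 < s -> (lattice_count L f sg tau r s)%:R = M%:R :> R ->
    [/\ S^-1 <= s, s <= S & `|M%:R - (r ^+ 2 * area L f - r * L * V s)| <= C1 * rho ^+ 2].
  move=> sp sM.
  have lows : r ^+ 2 * area L f - c * r <= (lattice_count L f sg tau r s)%:R.
    by rewrite sM; exact: le_trans low tM.
  have sS : S^-1 <= s <= S.
    case: (leP 1 s) => s1.
      have := B1 r s; have -> : r1 <= r by clear -rr r11 r21 g0 g1; lra.
      move=> /(_ isT s1 lows) h; apply/andP; split; last by rewrite /S; lra.
      by apply: le_trans s1; rewrite invf_le1.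
    have sv : 1 <= s^-1 by rewrite -[leLHS]invr1 lef_pV2 ?posrE // ltW.
    have := B2 r s^-1; have -> : r2 <= r by clear -rr r11 r21 g0 g1; lra.
    rewrite -(lattice_count_swap L0 cv sgh tauh r0 sp) (area_swap L0 cv).
    move=> /(_ isT sv lows) h; apply/andP; split; last lra.
    by rewrite -[leRHS]invrK lef_pV2 ?posrE ?invr_gt0 // /S; lra.
  have := H1 rho s k1 sS; rewrite e1 main sM => h.
  by case/andP: sS.
have Ht1 := H1 rho t k1 tS; rewrite e1 main in Ht1.
have MN' : (lattice_count L f sg tau r s0)%:R = M%:R :> R by rewrite MN.
have rL : 0 <= r * L by rewrite mulr_ge0 // ltW.
have [_ _ hs0] := opt s0 s0p MN'.
have Vle s : 0 < s -> V t <= V s.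
  move=> sp; rewrite Vt VE // lerDl; apply: divr_ge0; last exact: ltW.
  by apply: mulr_ge0; [exact: ltW|exact: sqr_ge0].
have rho2 : 0 <= rho ^+ 2 by rewrite exprn_ge0 // ltW.
split.
  rewrite -e2.
  have -> : 2 * r * L * Num.sqrt ((sg + 1 / 2) * (tau + 1 / 2)) = r * L * V t.
    by rewrite Vt -/p -/q; ring.
  have h1 := ler_wpM2l rL (Vle s0 s0p).
  have h2 : 0 <= D * rho ^+ 2 by apply: mulr_ge0 => //; clear -D0; lra.
  rewrite mulrDl; move: hs0 Ht1 tM; rewrite !ler_norml.
  clear -h1 h2; lra.
move=> s [sp smax].
have sM : (lattice_count L f sg tau r s)%:R = M%:R :> R.
  congr (_%:R); apply/eqP; rewrite eq_le.
  have [a1 a2] := smax; have [b1 b2] := Mmax.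
  by rewrite (b2 _ a1) (a2 _ b1).
have [sS1 sS2 hs] := opt s sp sM.
have gap : r * L * (V s - V t) <= 2 * C1 * rho ^+ 2.
  by move: hs Ht1 tM; rewrite !ler_norml mulrBr; clear; lra.
have sq : (s - t) ^+ 2 <= (D * w) ^+ 2.
  have gE : V s - V t = p * (s - t) ^+ 2 / s by rewrite Vt VE //; ring.
  rewrite gE in gap.
  have e4 : rho * w ^+ 2 = 1 by rewrite mulrC.
  have h1 : L * p * (s - t) ^+ 2 * rho <= 2 * C1 * S.
    have rhosq : 0 < rho ^+ 2 by rewrite exprn_gt0.
    rewrite -(ler_pM2l rhosq).
    have h2 : s * (r * L * (p * (s - t) ^+ 2 / s)) <= S * (2 * C1 * rho ^+ 2).
      apply: ler_pM => //; first exact: ltW.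
      apply: mulr_ge0 => //; apply: divr_ge0; last exact: ltW.
      by apply: mulr_ge0; [exact: ltW|exact: sqr_ge0].
    have e5 : s * (r * L * (p * (s - t) ^+ 2 / s)) = rho ^+ 2 * (L * p * (s - t) ^+ 2 * rho).
      by rewrite -e1; field; rewrite gt_eqF.
    rewrite e5 in h2; apply: (le_trans h2); rewrite le_eqVlt; apply/orP; left; apply/eqP; ring.
  have h3 : (s - t) ^+ 2 * rho <= D.
    have : (s - t) ^+ 2 * rho <= 2 * C1 * S / (L * p).
      by rewrite ler_pdivlMr //; apply: le_trans h1; rewrite le_eqVlt; apply/orP; left; apply/eqP; ring.
    by rewrite /D; clear; lra.
  have w2 : 0 <= w ^+ 2 by rewrite sqr_ge0.
  have h4 := ler_wpM2r w2 h3; rewrite -mulrA e4 mulr1 in h4.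
  apply: (le_trans h4); rewrite exprMn ler_wpM2r // expr2 ler_peMr //; clear -D0; lra.
have Dw : 0 <= D * w by apply: mulr_ge0; [clear -D0; lra|exact: ltW].
have : `|s - t| <= D * w.
  by rewrite -(@ler_pXn2r _ 2) ?nnegrE // real_normK ?num_real.
move=> /le_trans; apply; rewrite [leRHS]mulrDl lerDr.
by apply: mulr_ge0 => //; exact: ltW.
Qed.

End OptimalStretch.

Section Cases.
Variable R : realType.
Implicit Types (L sg tau : R) (f g : R -> R).

Lemma concave_case_bounds L sg tau f g : 0 < L -> decreasing_curve L f g ->
  - (1 / 2) < sg -> - (1 / 2) < tau -> concave_case L sg tau f g ->
  [/\ large_stretch_bound L f sg tau, large_stretch_bound L g tau sg
    & uniform_asymptotics L f sg tau].
Proof.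
move=> L0 cv sgh tauh [cf + [alpha [beta [/andP[a0 aL] b0 bE sf sgm]]]].
rewrite gt_max => /andP[hf hg].
have cg := curve_swap L0 cv.
have aL' : alpha < L.
  by rewrite lt_neqAle aL andbT; apply/eqP => E; move: b0; rewrite bE E (curve_atL L0 cv) ltxx.
split.
- exact: (concave_large_stretch L0 cv sgh tauh cf hf).
- apply: (concave_large_stretch L0 cg) => //; first exact: (concave_curve_swap L0 cv cf).
  by lra.
- apply: (@lattice_count_inner_asymptotic _ L f g sg tau alpha (-1)) => //.
  + by rewrite a0.
  + by right.
  + exact: concave_smooth_piece (ltW a0) sf.
  + by rewrite -bE; exact: concave_smooth_piece (ltW b0) sgm.
Qed.

Lemma convex_case_bounds L sg tau f g : 0 < L -> decreasing_curve L f g ->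
  - (1 / 2) < sg -> - (1 / 2) < tau -> convex_case L sg tau f g ->
  [/\ large_stretch_bound L f sg tau, large_stretch_bound L g tau sg
    & uniform_asymptotics L f sg tau].
Proof.
move=> L0 cv sgh tauh [cf + _ _ [alpha [beta [/andP[a0 aL] b0 bE sf sgm]]]].
rewrite lt_min => /andP[hf hg].
have cg := curve_swap L0 cv.
have aL' : alpha < L.
  by rewrite lt_neqAle aL andbT; apply/eqP => E; move: b0; rewrite bE E (curve_atL L0 cv) ltxx.
have bL : beta <= L.
  have : 0 <= f alpha <= L by apply: (curve_range cv); rewrite aL ltW.
  by rewrite -bE => /andP[].
split.
- exact: (convex_large_stretch L0 cv sgh tauh cf hf).
- apply: (convex_large_stretch L0 cg) => //; first exact: (convex_curve_swap L0 cv cf).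
  by lra.
- apply: (@lattice_count_outer_asymptotic _ L f g sg tau alpha) => //.
  + by rewrite a0.
  + exact: convex_smooth_piece aL sf.
  + by rewrite -bE; exact: convex_smooth_piece bL sgm.
Qed.

Lemma area_gt0 L f g : 0 < L -> decreasing_curve L f g -> 0 < area L f.
Proof.
move=> L0 cv; have h0 : 0 <= L / 2 by lra.
have h1 : 0 < L / 2 by lra.
have hL : L / 2 <= L by lra.
have fp : 0 < f (L / 2) by rewrite -(curve_atL L0 cv); apply: (curve_lt cv); lra.
have /andP[+ _] := prim_bounds L0 cv (lexx 0) h0 hL.
have /andP[+ _] := prim_bounds L0 cv h0 hL (lexx L).
rewrite prim0 !subr0 (curve_atL L0 cv) mul0r -[prim f L]/(area L f) => h2 h3.
have : 0 < f (L / 2) * (L / 2) by rewrite mulr_gt0.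
lra.
Qed.

End Cases.

Theorem theorem2 (R : realType) (L sigma tau : R) (f g : R -> R)
    (L_gt0 : 0 < L)
    (curve : decreasing_curve L f g)
    (sigma_gt : - (1 / 2) < sigma) (tau_gt : - (1 / 2) < tau)
    (cases : concave_case L sigma tau f g \/ convex_case L sigma tau f g) :
  let s_star := Num.sqrt ((tau + 1 / 2) / (sigma + 1 / 2)) in
  [/\ optimal_stretch_approaches L f sigma tau s_star,
      exists C R0 : R, [/\ 0 < C, 0 < R0 & forall r, R0 <= r ->
        optimal_stretch L f sigma tau r
          `<=` `[s_star - C * r `^ (- (1 / 6)), s_star + C * r `^ (- (1 / 6))]],
      exists C R0 : R, [/\ 0 < C, 0 < R0 & forall r, R0 <= r ->
        exists2 M : nat, is_max (lattice_counts L f sigma tau r) M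
          & `|M%:R - (r ^+ 2 * area L f
               - 2 * r * L * Num.sqrt ((sigma + 1 / 2) * (tau + 1 / 2)))|
            <= C * r `^ (2 / 3)]
    & sigma = tau -> optimal_stretch_approaches L f sigma tau 1].
Proof.
have sgh := sigma_gt; have tauh := tau_gt.
have [bf bg UA] : [/\ large_stretch_bound L f sigma tau,
    large_stretch_bound L g tau sigma & uniform_asymptotics L f sigma tau].
  by case: cases; [exact: concave_case_bounds|exact: convex_case_bounds].
have A0 := area_gt0 L_gt0 curve.
move=> t.
have [C [R0 [C0 R00 H]]] := optimal_stretch_asymptotics L_gt0 curve sgh tauh A0 bf bg UA.
have rate : forall r, R0 <= r -> optimal_stretch L f sigma tau r
    `<=` `[t - C * r `^ (- (1 / 6)), t + C * r `^ (- (1 / 6))].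
  move=> r rr s sopt; have [M _ [_ Hs]] := H r rr.
  by have := Hs s sopt; rewrite -/t /= in_itv /= ler_distl.
have appr : optimal_stretch_approaches L f sigma tau t.
  move=> e e0.
  have near_r : \forall r \near +oo, Num.max R0 ((C / e) ^+ 6) <= r.
    by apply: nbhs_pinfty_ge; rewrite num_real.
  apply: filterS near_r => r; rewrite ge_max => /andP[rr re].
  apply: subset_trans (rate r rr) _.
  have r0 : 0 < r by exact: lt_le_trans rr.
  have [_ _ w0 _ w6] := cube_root_powers r0.
  have we : C * r `^ (- (1 / 6)) <= e.
    set w := r `^ _ in w0 w6 *.
    have Cw : 0 <= C * w by rewrite mulr_ge0 // ltW.
    rewrite -(@ler_pXn2r _ 6) // ?nnegrE ?(ltW e0) //.
    have h := ler_wpM2l (exprn_ge0 6 (ltW w0)) re; rewrite w6 in h.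
    have e6 : 0 < e ^+ 6 by rewrite exprn_gt0.
    have := ler_wpM2r (ltW e6) h.
    rewrite mul1r exprMn; apply: le_trans; rewrite exprMn exprVn.
    by rewrite -mulrA divfK ?gt_eqF // mulrC.
  by move=> s /=; rewrite !in_itv /= => /andP[h1 h2]; apply/andP; split; lra.
split => //.
- by exists C, R0; split.
- exists C, R0; split => // r rr; have [M MM [hM _]] := H r rr; by exists M.
- move=> E; suff -> : 1 = t by [].
  by rewrite /t E divff ?sqrtr1 // gt_eqF //; lra.
Qed.
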